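(* Let $\mathcal G_1,\mathcal G_2$ be a matched pair of measured subgroupoids of a measured groupoid $\mathcal G$. Let $W_{\mathcal G_1,\mathcal G_2}:L^2(\mathcal G^2_{s,m},\mu^2_{s,m})\to L^2(\mathcal G^2_{m,r},\mu^2_{m,r})$ be defined, for $\xi\in L^2(\mathcal G^2_{s,m},\mu^2_{s,m})$ and $\mu^2_{m,r}$-almost every $(x,y)\in\mathcal G^2_{m,r}$, by $$W_{\mathcal G_1,\mathcal G_2}\xi(x,y)=D(x,y)^{\frac12}\,\xi(\theta(x,y)),\qquad \theta(x,y)=\big(x\,p_1(p_2(x)^{-1}y),\ p_2(x)^{-1}y\big),$$ where $D$ is the Radon–Nikodym derivative $\frac{d\mu^2_{s,m}\circ\theta}{d\mu^2_{m,r}}$. Then, identifying $L^2(\mathcal G^2_{i,j},\mu^2_{i,j})$ with the relative tensor product $L^2(\mathcal G,\mu)\,{}_{i}\otimes_{j}L^2(\mathcal G,\mu)$ over $L^\infty(\mathcal G^0,\nu)$, $W_{\mathcal G_1,\mathcal G_2}$ is a pseudo-multiplicative unitary over the basis $(L^\infty(\mathcal G^0,\nu),m_{\mathcal G},s_{\mathcal G},r_{\mathcal G})$.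
   Context: A measured groupoid $(\mathcal G,(\lambda^u)_{u\in\mathcal G^0},\nu)$ is a Hausdorff, $\sigma$-compact, (second countable) locally compact groupoid with unit space $\mathcal G^0$, $r(g)=gg^{-1}$, $s(g)=g^{-1}g$ ($gg'$ is defined iff $s(g)=r(g')$), a left Haar system $(\lambda^u)$ ($\lambda^u$ has support $\mathcal G^u=r^{-1}(u)$) and a quasi-invariant Radon measure $\nu$ on $\mathcal G^0$; $\mu=\int\lambda^u d\nu(u)$. Closed subgroupoids $\mathcal G_1,\mathcal G_2$, with Haar systems $(\lambda_i^u)$, form a matched pair if $\mathcal G_1\cap\mathcal G_2=\mathcal G^0$, $\mathcal G_1\mathcal G_2=\{g_1g_2:g_i\in\mathcal G_i,\ s(g_1)=r(g_2)\}$ is $\mu$-conegligible in $\mathcal G$, and $\nu$ is quasi-invariant for the three Haar systems. For $\mu$-almost every $g$, $g=p_1(g)p_2(g)$ uniquely with $p_i(g)\in\mathcal G_i$; put $m(g)=s(p_1(g))=r(p_2(g))$. For $i\in\{r,s,m\}$, $i_{\mathcal G}$ denotes the representation $f\mapsto f\circ i$ of $L^\infty(\mathcal G^0,\nu)$ by multiplication on $L^2(\mathcal G,\mu)$. For $i,j\in\{r,s,m\}$, $\mathcal G^2_{i,j}=\{(g,g')\in\mathcal G\times\mathcal G:i(g)=j(g')\}$ and $\mu^2_{i,j}=\int\mu^i_u\times\mu^j_u\,d\nu(u)$, where $\mu=\int\mu^i_u\,d\nu(u)$ is the disintegration of $\mu$ along $i$ with respect to $\nu$ ($\mu^i_u$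 carried by $i^{-1}(u)$). $(\mu^2_{s,m}\circ\theta)(E)=\mu^2_{s,m}(\theta(E))$. Pseudo-multiplicative unitary (for a commutative basis): let $N$ be a commutative von Neumann algebra with n.s.f. weight $\nu$ and $\alpha,\beta,\hat\beta$ faithful normal nondegenerate, pairwise commuting representations of $N$ on a Hilbert space $\mathfrak H$. A unitary $W:\mathfrak H\,{}_\beta\otimes_\alpha\mathfrak H\to\mathfrak H\,{}_\alpha\otimes_{\hat\beta}\mathfrak H$ (relative tensor products over $\nu$) is a pseudo-multiplicative unitary over the basis $(N,\alpha,\beta,\hat\beta)$ if for all $n\in N$ $$W(\alpha(n)\otimes1)=(1\otimes\alpha(n))W,\quad W(1\otimes\beta(n))=(1\otimes\beta(n))W,$$ $$W(\hat\beta(n)\otimes1)=(\hat\beta(n)\otimes1)W,\quad W(1\otimes\hat\beta(n))=(\beta(n)\otimes1)W,$$ and the pentagonal equation holds, which in leg notation is $W_{23}W_{12}=W_{12}W_{13}W_{23}$ as operators from $\mathfrak H\,{}_\beta\otimes_\alpha\mathfrak H\,{}_\beta\otimes_\alpha\mathfrak H$ to $\mathfrak H\,{}_\alpha\otimes_{\hat\beta}\mathfrak H\,{}_\alpha\otimes_{\hat\beta}\mathfrak H$; here $W_{kl}$ is $W$ acting on the $k$-th and $l$-th legs (using the flips of relative tensor products for $W_{13}$), which makes sense on the successive threefold relative tensor products thanks to the four intertwining relations.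
   Formalization: The formal theorem assumes that ν and the image of μ under m have the same null sets (i.e. m_G is faithful on L^∞(G^0,ν), as a basis requires); this does not follow from the definition of a matched pair, and the claim fails without it. *)

(* Defs.v *)
From HB Require Import structures.
From mathcomp Require Import all_boot all_order all_algebra.
From mathcomp Require Import complex.
From mathcomp Require Import all_classical all_reals all_analysis.
From mathcomp Require Import measurable_realfun.
Set Implicit Arguments.
Unset Strict Implicit.
Unset Printing Implicit Defensive.
Import Order.TTheory GRing.Theory Num.Theory.
Import numFieldNormedType.Exports.
Local Open Scope classical_set_scope.
Local Open Scope ring_scope.
Local Open Scope complex_scope.

(* For e : R[i], [0 < e] means that e is real and positive. *)

Local Notation re := (@complex.Re _).
Local Notation im := (@complex.Im _).

(* Inner products are linear in the first variable. *)
Record ipspace (R : realType) := IPSpace {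
  ipcar :> lmodType R[i];
  ip : {dot ipcar for Num.conj} }.
Arguments ip {R i}.

Section Hilbert.
Context (R : realType).
Implicit Types U V T : ipspace R.

Definition hilbert U := forall u : nat -> U,
  (forall e : R[i], 0 < e -> exists N, forall m n,
     (N <= m)%N -> (N <= n)%N -> ip (u m - u n) (u m - u n) < e) ->
  exists l : U, forall e : R[i], 0 < e -> exists N, forall n,
     (N <= n)%N -> ip (u n - l) (u n - l) < e.

Definition bounded_linear U V (S : U -> V) :=
  linear S /\ exists M : R[i], forall u, ip (S u) (S u) <= M * ip u u.

Definition unitary U V (S : U -> V) :=
  [/\ linear S, forall u v, ip (S u) (S v) = ip u v
    & forall v, exists u, S u = v].

Definition dense_span U (A : set U) := forall (u : U) (e : R[i]), 0 < e ->
  exists (n : nat) (a : 'I_n -> R[i]) (v : 'I_n -> U), (forall k, A (v k)) /\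
    ip (u - \sum_k a k *: v k) (u - \sum_k a k *: v k) < e.

(* [amplify1 D t t' f S]: if [t] and [t'] are the elementary tensor maps of two
   relative tensor products whose left bounded vectors contain [D] and [f D],
   S is the operator "f tensor 1".  [amplify2] is "1 tensor g". *)
Definition amplify1 U U' V T T' (D : set U) (t : U -> V -> T)
    (t' : U' -> V -> T') (f : U -> U') (S : T -> T') :=
  bounded_linear S /\ forall u v, D u -> S (t u v) = t' (f u) v.

Definition amplify2 U V V' T T' (D : set U) (t : U -> V -> T)
    (t' : U -> V' -> T') (g : V -> V') (S : T -> T') :=
  bounded_linear S /\ forall u v, D u -> S (t u v) = t' u (g v).

End Hilbert.

Section L2.
Context d (T : measurableType d) (R : realType) (mu : {measure set T -> \bar R}).
Implicit Types f g : T -> R[i].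

Definition cint (f : T -> R[i]) : R[i] :=
  (\int[mu]_x re (f x)) +i* (\int[mu]_x im (f x)).

(* Borel functions T -> C with square-integrable modulus. *)
Definition sqint : {pred T -> R[i]} :=
  [pred f | (re \o f \in Lfun mu 2%:E) && (im \o f \in Lfun mu 2%:E)].

Let two : (1 <= 2%:E :> \bar R)%E := lee1n 2.

Lemma sqint_submod : submod_closed sqint.
Proof.
have [Z L] := Lfun_submod_closed mu two.
split.
  by apply/andP; split; rewrite [X in X \in _](_ : _ = 0).
move=> [a b] f g /andP[f1 f2] /andP[g1 g2].
have S c h : h \in Lfun mu 2%:E -> c *: h \in Lfun mu 2%:E.
  by move=> hL; have := L c h 0 hL Z; rewrite addr0.
have D h k : h \in Lfun mu 2%:E -> k \in Lfun mu 2%:E -> h + k \in Lfun mu 2%:E.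
  by move=> hL kL; have := L 1 h k hL kL; rewrite scale1r.
apply/andP; split => /=.
- rewrite (_ : _ \o _ = (a *: (re \o f) + (- b) *: (im \o f)) + (re \o g)).
    by apply: (D) => //; apply: (D); exact: S.
  by apply/funext => x; rewrite !fctE /=; case: (f x) (g x) => [u v] [w z] /=; rewrite scaleNr.
- rewrite (_ : _ \o _ = (a *: (im \o f) + b *: (re \o f)) + (im \o g)).
    by apply: (D) => //; apply: (D); exact: S.
  by apply/funext => x; rewrite !fctE /=; case: (f x) (g x) => [u v] [w z] /=.
Qed.

HB.instance Definition _ := GRing.isSubmodClosed.Build _ _ sqint sqint_submod.

Record sqint_fun := SqintFun { sqint_val :> T -> R[i]; _ : sqint_val \in sqint }.
HB.instance Definition _ := [isSub for sqint_val].
HB.instance Definition _ := [Choice of sqint_fun by <:].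
HB.instance Definition _ := [SubChoice_isSubLmodule of sqint_fun by <:].


Definition null_sqint : {pred sqint_fun} :=
  [pred f : sqint_fun | `[< {ae mu, forall x, f x = 0} >]].

Lemma null_submod : submod_closed null_sqint.
Proof.
split; first by apply/asboolP; exact/aeW.
move=> a f g /asboolP f0 /asboolP g0; apply/asboolP.
by apply: filterS2 f0 g0 => x fx gx; rewrite /= !fctE fx gx scaler0 addr0.
Qed.
HB.instance Definition _ :=
  GRing.isSubmodClosed.Build _ _ null_sqint null_submod.

Definition L2quot : Type := Quotient.quot null_sqint.
HB.instance Definition _ := GRing.Zmodule.on L2quot.
HB.instance Definition _ := EqQuotient.on L2quot.

Local Open Scope quotient_scope.

Lemma L2_eqP (f g : sqint_fun) :
  reflect {ae mu, forall x, f x = g x} (f == g %[mod L2quot]).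
Proof.
rewrite -[_ == _](Quotient.idealrBE null_sqint).
apply: (iffP (asboolP _)); apply: filterS => x /=.
  by rewrite !fctE => /eqP; rewrite subr_eq0 => /eqP.
by rewrite !fctE => ->; rewrite subrr.
Qed.

Lemma L2_reprD (xi eta : L2quot) :
  {ae mu, forall x, repr (xi + eta) x = repr xi x + repr eta x}.
Proof.
apply: (elimT (L2_eqP (repr (xi + eta)) (repr xi + repr eta))).
have -> : xi + eta = \pi_L2quot (repr xi + repr eta).
  by rewrite (Quotient.pi_add null_sqint) !reprK.
by rewrite reprK.
Qed.

Definition L2scale (a : R[i]) (xi : L2quot) : L2quot := \pi_L2quot (a *: repr xi).

Lemma L2_reprZ a (xi : L2quot) :
  {ae mu, forall x, repr (L2scale a xi) x = a * repr xi x}.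
Proof. by apply: (elimT (L2_eqP (repr (L2scale a xi)) (a *: repr xi))); rewrite reprK. Qed.

Lemma L2_ext (xi eta : L2quot) :
  {ae mu, forall x, repr xi x = repr eta x} -> xi = eta.
Proof. by move/L2_eqP; rewrite !reprK => /eqP. Qed.

Lemma L2scaleA a b xi : L2scale a (L2scale b xi) = L2scale (a * b) xi.
Proof.
apply: L2_ext; move: (L2_reprZ a (L2scale b xi)) (L2_reprZ b xi) (L2_reprZ (a * b) xi).
by apply: filterS3 => x -> -> ->; rewrite mulrA.
Qed.

Lemma L2scale1 : left_id 1 L2scale.
Proof. by move=> xi; apply: L2_ext; move: (L2_reprZ 1 xi); apply: filterS => x ->; rewrite mul1r. Qed.

Lemma L2scaleDr : right_distributive L2scale +%R.
Proof.
move=> a xi eta; apply: L2_ext.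
have [A B] := (L2_reprD xi eta, L2_reprZ a (xi + eta)).
have [C D] := (L2_reprD (L2scale a xi) (L2scale a eta), L2_reprZ a xi).
have E := L2_reprZ a eta.
near=> x.
have -> : repr (L2scale a (xi + eta)) x = a * repr (xi + eta) x by near: x.
have -> : repr (xi + eta) x = repr xi x + repr eta x by near: x.
have -> : repr (L2scale a xi + L2scale a eta) x =
  repr (L2scale a xi) x + repr (L2scale a eta) x by near: x.
have -> : repr (L2scale a xi) x = a * repr xi x by near: x.
have -> : repr (L2scale a eta) x = a * repr eta x by near: x.
by rewrite mulrDr.
Unshelve. all: by end_near. Qed.

Lemma L2scaleDl (xi : L2quot) : {morph L2scale^~ xi : a b / a + b}.
Proof.
move=> a b; apply: L2_ext.
have [A B] := (L2_reprZ (a + b) xi, L2_reprD (L2scale a xi) (L2scale b xi)).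
have [C D] := (L2_reprZ a xi, L2_reprZ b xi).
near=> x.
have -> : repr (L2scale (a + b) xi) x = (a + b) * repr xi x by near: x.
have -> : repr (L2scale a xi + L2scale b xi) x =
  repr (L2scale a xi) x + repr (L2scale b xi) x by near: x.
have -> : repr (L2scale a xi) x = a * repr xi x by near: x.
have -> : repr (L2scale b xi) x = b * repr xi x by near: x.
by rewrite mulrDl.
Unshelve. all: by end_near. Qed.

HB.instance Definition _ :=
  GRing.Zmodule_isLmodule.Build R[i] L2quot L2scaleA L2scale1 L2scaleDr L2scaleDl.

Lemma sqint_mul (f g : sqint_fun) :
  [/\ mu.-integrable setT (EFin \o (fun x => re (f x) * re (g x))),
      mu.-integrable setT (EFin \o (fun x => im (f x) * im (g x))),
      mu.-integrable setT (EFin \o (fun x => re (f x) * im (g x))) &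
      mu.-integrable setT (EFin \o (fun x => im (f x) * re (g x)))].
Proof.
have /andP[f1 f2] := valP f; have /andP[g1 g2] := valP g.
by split; apply/Lfun1_integrable; exact: Lfun2_mul_Lfun1.
Qed.

Lemma sqint_mul_re (f g : sqint_fun) :
  mu.-integrable setT (EFin \o (fun x => re (f x * (g x)^*))).
Proof.
have [A B _ _] := sqint_mul f g.
rewrite (_ : _ \o _ = (EFin \o (fun x => re (f x) * re (g x))%R) \+
  (EFin \o (fun x => im (f x) * im (g x))%R))%E; last first.
  apply/funext => x /=; case: (f x) (g x) => [a b] [c e] /=.
  by rewrite mulrN opprK EFinD.
exact: integrableD.
Qed.

Lemma sqint_mul_im (f g : sqint_fun) :
  mu.-integrable setT (EFin \o (fun x => im (f x * (g x)^*))).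
Proof.
have [_ _ A B] := sqint_mul f g.
rewrite (_ : _ \o _ = (EFin \o (fun x => im (f x) * re (g x))%R) \-
  (EFin \o (fun x => re (f x) * im (g x))%R))%E; last first.
  apply/funext => x /=; case: (f x) (g x) => [a b] [c e] /=.
  by rewrite mulrN addrC -EFinB.
exact: integrableB.
Qed.

Definition L2dot (xi eta : L2quot) : R[i] :=
  cint (fun x => repr xi x * (repr eta x)^*).

Lemma ae_eq_cint (f g : T -> R[i]) :
  mu.-integrable setT (EFin \o (re \o f)) -> mu.-integrable setT (EFin \o (im \o f)) ->
  mu.-integrable setT (EFin \o (re \o g)) -> mu.-integrable setT (EFin \o (im \o g)) ->
  {ae mu, forall x, f x = g x} -> cint f = cint g.
Proof.
move=> /integrableP[f1 _] /integrableP[f2 _] /integrableP[g1 _] /integrableP[g2 _] fg.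
rewrite /cint /Rintegral; congr (fine _ +i* fine _).
  by apply: ae_eq_integral => //; apply: filterS fg => x /= ->.
by apply: ae_eq_integral => //; apply: filterS fg => x /= ->.
Qed.

Lemma cintD (f g : T -> R[i]) :
  mu.-integrable setT (EFin \o (re \o f)) -> mu.-integrable setT (EFin \o (im \o f)) ->
  mu.-integrable setT (EFin \o (re \o g)) -> mu.-integrable setT (EFin \o (im \o g)) ->
  cint (fun x => f x + g x) = cint f + cint g.
Proof.
move=> f1 f2 g1 g2; rewrite /cint; congr (_ +i* _).
  by rewrite -RintegralD//; apply: eq_Rintegral => x _; case: (f x) (g x) => [? ?] [].
by rewrite -RintegralD//; apply: eq_Rintegral => x _; case: (f x) (g x) => [? ?] [].
Qed.

Lemma cintZ a (f : T -> R[i]) :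
  mu.-integrable setT (EFin \o (re \o f)) -> mu.-integrable setT (EFin \o (im \o f)) ->
  cint (fun x => a * f x) = a * cint f.
Proof.
case: a => a b f1 f2; rewrite /cint.
have Z c h : mu.-integrable setT (EFin \o h) -> mu.-integrable setT (EFin \o (fun x => c * h x)).
  move=> H; rewrite (_ : _ \o _ = (fun x => c%:E * (EFin \o h) x)%E)//.
  exact: integrableZl.
congr (_ +i* _) => /=.
  rewrite -!RintegralZl// -RintegralB//; [|exact: Z|exact: Z].
  by apply: eq_Rintegral => x _; case: (f x).
rewrite -!RintegralZl// -RintegralD//; [|exact: Z|exact: Z].
by apply: eq_Rintegral => x _; case: (f x).
Qed.

Lemma L2dot_linear eta : GRing.linear_for *%R (L2dot^~ eta).
Proof.
move=> a xi xi' /=; rewrite /L2dot.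
pose F (x : L2quot) := sqint_mul_re (repr x) (repr eta).
pose G (x : L2quot) := sqint_mul_im (repr x) (repr eta).
transitivity (cint (fun x => (a *: repr xi + repr xi') x * (repr eta x)^*)).
  apply: ae_eq_cint; [exact: F|exact: G|exact: sqint_mul_re|exact: sqint_mul_im|].
  have [A B] := (L2_reprZ a xi, L2_reprD (a *: xi) xi').
  near=> x; congr (_ * _).
  have -> : repr (a *: xi + xi') x = repr (a *: xi) x + repr xi' x by near: x.
  by have -> : repr (a *: xi) x = a * repr xi x by near: x.
rewrite -cintZ; [|exact: F|exact: G].
rewrite (_ : (fun x => a * (repr xi x * (repr eta x)^*)) =
  (fun x => (a *: repr xi) x * (repr eta x)^*)); last first.
  by apply/funext => x; rewrite mulrA.
rewrite -cintD; [|exact: sqint_mul_re|exact: sqint_mul_im|exact: F|exact: G].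
by congr cint; apply/funext => x; rewrite -mulrDl.
Unshelve. all: by end_near. Qed.

Lemma L2dot_conj xi eta : L2dot xi eta = Num.conj (L2dot eta xi).
Proof.
rewrite /L2dot /cint /Num.conj /=; congr (_ +i* _).
  apply: eq_Rintegral => x _; case: (repr xi x) (repr eta x) => [a b] [c e] /=.
  by rewrite !mulrN !opprK mulrC (mulrC b).
rewrite -[in RHS]mulN1r -RintegralZl//; last exact: sqint_mul_im.
apply: eq_Rintegral => x _; case: (repr xi x) (repr eta x) => [a b] [c e] /=.
by rewrite mulN1r !mulrN opprD opprK addrC (mulrC a) (mulrC b).
Qed.

Lemma L2dot_linearr xi : GRing.linear_for (Num.conj \; *%R) (L2dot xi).
Proof.
move=> a eta eta'; rewrite L2dot_conj L2dot_linear rmorphD rmorphM /=.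
by rewrite -!L2dot_conj.
Qed.

Lemma L2dot_gt0 xi : xi != 0 -> 0 < L2dot xi xi.
Proof.
move=> xi0; have R1 := sqint_mul_re (repr xi) (repr xi).
have sq x : re (repr xi x * (repr xi x)^*) = re (repr xi x) ^+ 2 + im (repr xi x) ^+ 2.
  by case: (repr xi x) => a b /=; rewrite mulrN opprK.
have dE : L2dot xi xi = (\int[mu]_x re (repr xi x * (repr xi x)^*))%:C.
  rewrite /L2dot /cint; congr (_ +i* _).
  under eq_Rintegral => x _.
    rewrite (_ : im _ = 0); last first.
      by case: (repr xi x) => a b /=; rewrite mulrN mulrC addNr.
    over.
  by rewrite Rintegral_cst// mul0r.
rewrite dE ltcR lt_def; apply/andP; split; last first.
  by apply: Rintegral_ge0 => x _; rewrite sq addr_ge0 ?sqr_ge0.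
apply: contraNN xi0 => /eqP I0; apply/eqP; apply: L2_ext.
have : (\int[mu]_x `|(re (repr xi x * (repr xi x)^*))%:E| = 0)%E.
  under eq_integral => x _ do rewrite gee0_abs ?lee_fin ?sq ?addr_ge0 ?sqr_ge0// -sq.
  have fn := integrable_fin_num measurableT R1.
  by rewrite -(fineK fn); congr _%:E; exact: I0.
move/ae_eq_integral_abs => /(_ measurableT).
have [mR _] := integrableP _ _ _ R1.
move=> /(_ mR).
have Z : {ae mu, forall x, repr (0 : L2quot) x = 0}.
  have := L2_reprD 0 0; rewrite addr0; apply: filterS => x.
  by move/eqP; rewrite -subr_eq0 opprD addNKr oppr_eq0 => /eqP.
apply: filterS2 Z => x -> /(_ I) [].
rewrite sq => /eqP; rewrite paddr_eq0 ?sqr_ge0// !sqrf_eq0.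
by case: (repr xi x) => a b /= /andP[/eqP -> /eqP ->].
Qed.

HB.instance Definition _ := bilinear_isBilinear.Build R[i] L2quot L2quot R[i]
  *%R (Num.conj \; *%R) L2dot (conj L2dot_linear L2dot_linearr).

Let L2dot_herm (xi eta : L2quot) :
  L2dot xi eta = (-1) ^+ false * Num.conj (L2dot eta xi).
Proof. by rewrite expr0 mul1r L2dot_conj. Qed.

HB.instance Definition _ := isHermitianSesquilinear.Build R[i] L2quot false
  Num.conj L2dot L2dot_herm.
HB.instance Definition _ := isDotProduct.Build R[i] L2quot L2dot L2dot_gt0.

Definition L2 : ipspace R := @IPSpace R L2quot L2dot.

(* The class in L^2 of a function (0 when it is not square-integrable). *)
Definition L2cls (f : T -> R[i]) : L2 :=
  if @idP (f \in sqint) is ReflectT fP then \pi_L2quot (SqintFun fP) else 0.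

Definition L2fun (xi : L2) : T -> R[i] := repr (xi : L2quot).

End L2.

(* The base of the relative tensor products is the commutative von Neumann
   algebra N = L^infty(X, nu), for a sigma-finite nu, with the n.s.f. weight
   f |-> \int f dnu, whose GNS space is L^2(X, nu).  Elements of N are handled
   through representatives; representations do not depend on them. *)
Section Base.
Context d (X : measurableType d) (R : realType) (nu : {measure set X -> \bar R}).
Implicit Types (n h : X -> R[i]) (U V T : ipspace R).

Definition Linf : set (X -> R[i]) :=
  [set n : X -> R[i] | [/\ measurable_fun setT (re \o n), measurable_fun setT (im \o n) &
    exists M : R[i], {ae nu, forall x, `|n x| <= M}]].

(* The n in N with nu(n^* n) finite. *)
Definition Linf2 : set (X -> R[i]) := [set n : X -> R[i] | Linf n /\ n \in sqint nu].

Definition rep U := (X -> R[i]) -> U -> U.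

Definition representation U (a : rep U) :=
  (forall n, Linf n -> bounded_linear (a n)) /\
  [/\ forall n n', Linf n -> Linf n' -> {ae nu, forall x, n x = n' x} ->
        forall u, a n u = a n' u,
      forall k n n', Linf n -> Linf n' ->
        forall u, a (fun x => k * n x + n' x) u = k *: a n u + a n' u,
      forall n n', Linf n -> Linf n' ->
        forall u, a (fun x => n x * n' x) u = a n (a n' u)
    & forall n, Linf n ->
        forall u v, ip (a n u) v = ip u (a (fun x => (n x)^*) v)].

Definition faithful U (a : rep U) := forall n, Linf n ->
  (forall u, a n u = 0) -> {ae nu, forall x, n x = 0}.

Definition nondegenerate U (a : rep U) := forall u : U,
  (forall n, Linf n -> a n u = 0) -> u = 0.

(* sigma-weak continuity: the coefficients of [a] lie in the predual L^1. *)
Definition normal_rep U (a : rep U) := forall u v : U, exists h,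
  [/\ nu.-integrable setT (EFin \o (re \o h)),
      nu.-integrable setT (EFin \o (im \o h))
    & forall n, Linf n -> ip (a n u) v = cint nu (fun x => n x * h x)].

Definition commuting U (a b : rep U) := forall n n', Linf n -> Linf n' ->
  forall u, a n (b n' u) = b n' (a n u).

Definition basis_rep U (a : rep U) :=
  [/\ representation a, faithful a, normal_rep a & nondegenerate a].

(* D(U_b, nu): the xi such that n |-> b n xi extends to a bounded operator
   R(xi) from L^2(X, nu) to U. *)
Definition bounded_vector U (b : rep U) : set U :=
  [set xi | exists M : R[i], forall n, Linf2 n ->
     ip (b n xi) (b n xi) <= M * cint nu (fun x => n x * (n x)^*)].

(* [h] is R(xi')^* R(xi), i.e. the bracket <xi', xi>_(b, nu) in N. *)
Definition bracket U (b : rep U) (xi xi' : U) h :=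
  Linf h /\ forall n n', Linf2 n -> Linf2 n' ->
    ip (b n xi) (b n' xi') = cint nu (fun x => h x * n x * (n' x)^*).

(* [T] with the elementary tensors [t xi eta], for xi in D(U_b, nu) and eta in
   V, is the relative tensor product of U and V over nu along [b] and [a]: the
   Hilbert completion of the algebraic tensor product for Sauvageot's inner
   product.  Values of [t] at other xi are irrelevant. *)
Definition relative_tensor U V T (b : rep U) (a : rep V) (t : U -> V -> T) :=
  let D := bounded_vector b in
  [/\ hilbert T,
      forall k xi xi' eta, D xi -> D xi' ->
        t (k *: xi + xi') eta = k *: t xi eta + t xi' eta,
      forall k xi eta eta', D xi ->
        t xi (k *: eta + eta') = k *: t xi eta + t xi eta',
      forall xi xi' eta eta' h, D xi -> D xi' -> bracket b xi xi' h ->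
        ip (t xi eta) (t xi' eta') = ip (a h eta) eta'
    & dense_span [set t xi eta | xi in D & eta in setT]].

(* Here T is the relative tensor product along b, a and T' the one along a, c.
   The arguments [aN], [bN], [cN] are the representations a, b, c of N acting
   on the N-th leg of T, and [aN'], [bN'], [cN'] those acting on the N-th leg
   of T'.

   A, B, C, D, E are the threefold relative tensor products through which both
   sides of the equation pass; i:p-q:j means that the representation i on leg
   p is tensored with j on leg q:
     A = b:1-2:a, b:2-3:a      B = a:1-2:c, b:2-3:a      E = a:1-2:c, a:2-3:c
     C = b:1-3:a, a:2-3:c      D = a:1-3:c, b:1-2:a
   Each of them is presented as a twofold relative tensor product in the two
   ways required by the operators into and out of it; in [tB (t' xi eta) zeta]
   and [sB xi (t eta zeta)] the parenthesised legs were tensored first.  For C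
   and D one presentation tensors legs 1 and 3 first and has leg 2 as its first
   argument, which accounts for the flips in the definition of W13.  Two
   presentations are identified by their values on elementary tensors. *)
Definition pentagonal H T T' (a b c : rep H) (t : H -> H -> T) (t' : H -> H -> T')
    (W : T -> T') (a1 b2 c1 c2 : rep T) (a2' b2' c1' b1' : rep T') :=
  let Da := bounded_vector a in let Db := bounded_vector b in
  exists (A B C D E : ipspace R)
    (tA : T -> H -> A) (sA : H -> T -> A) (tB : T' -> H -> B) (sB : H -> T -> B)
    (tE : T' -> H -> E) (sE : H -> T' -> E)
    (sC : H -> T' -> C) (fC : H -> T -> C) (fD : H -> T' -> D) (tD : T -> H -> D),
  [/\ [/\ relative_tensor b2 a tA, relative_tensor b a1 sA
        & forall xi eta zeta, Db xi -> Db eta ->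
            tA (t xi eta) zeta = sA xi (t eta zeta)],
      [/\ relative_tensor b2' a tB, relative_tensor a c1 sB
        & forall xi eta zeta, Da xi -> Db eta ->
            tB (t' xi eta) zeta = sB xi (t eta zeta)],
      [/\ relative_tensor a2' c tE, relative_tensor a c1' sE
        & forall xi eta zeta, Da xi -> Da eta ->
            tE (t' xi eta) zeta = sE xi (t' eta zeta)],
      [/\ relative_tensor b a2' sC, relative_tensor a c2 fC
        & forall xi eta zeta, Db xi -> Da eta ->
            sC xi (t' eta zeta) = fC eta (t xi zeta)]
    & [/\ relative_tensor a b1' fD, relative_tensor a1 c tD
        & forall xi eta zeta, Da xi -> Db xi -> Da eta ->
            fD eta (t' xi zeta) = tD (t xi eta) zeta]] /\
  exists (W12_AB : A -> B) (W23_BE : B -> E)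
         (W23_AC : A -> C) (W13_CD : C -> D) (W12_DE : D -> E),
  [/\ amplify1 (bounded_vector b2) tA tB W W12_AB,
      amplify2 Da sB sE W W23_BE,
      amplify2 Db sA sC W W23_AC &
  [/\ amplify2 Da fC fD W W13_CD,
      amplify1 (bounded_vector a1) tD tE W W12_DE
    & forall u, W23_BE (W12_AB u) = W12_DE (W13_CD (W23_AC u))]].

Definition pseudo_multiplicative_unitary H T T' (a b c : rep H)
    (t : H -> H -> T) (t' : H -> H -> T') (W : T -> T') :=
  let Da := bounded_vector a in let Db := bounded_vector b in
  [/\ hilbert H,
      [/\ basis_rep a, basis_rep b & basis_rep c],
      [/\ commuting a b, commuting a c & commuting b c],
      relative_tensor b a t /\ relative_tensor a c t' &
  unitary W /\
  exists (a1 b2 c1 c2 : rep T) (a2' b2' c1' b1' : rep T'),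
  [/\ forall n, Linf n ->
        [/\ amplify1 Db t t (a n) (a1 n), amplify2 Db t t (b n) (b2 n),
            amplify1 Db t t (c n) (c1 n) & amplify2 Db t t (c n) (c2 n)],
      forall n, Linf n ->
        [/\ amplify2 Da t' t' (a n) (a2' n), amplify2 Da t' t' (b n) (b2' n),
            amplify1 Da t' t' (c n) (c1' n) & amplify1 Da t' t' (b n) (b1' n)],
      forall n, Linf n -> forall u,
        [/\ W (a1 n u) = a2' n (W u), W (b2 n u) = b2' n (W u),
            W (c1 n u) = c1' n (W u) & W (c2 n u) = b1' n (W u)]
    & pentagonal a b c t t' W a1 b2 c1 c2 a2' b2' c1' b1']].

End Base.

Definition mult_rep d d' (G : measurableType d) (X : measurableType d')
    (R : realType) (mu : {measure set G -> \bar R}) (i : G -> X)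
    (n : X -> R[i]) (xi : L2 mu) : L2 mu :=
  L2cls mu (fun x => n (i x) * L2fun xi x).
Arguments mult_rep {d d' G X R} mu i.

(* The identification of L^2(mu2), for mu2 carried by a fibre product of G with
   itself, with a relative tensor product of L^2(mu) with itself is given by
   these elementary tensors. *)
Definition L2tensor d (G : measurableType d) (R : realType)
    (mu : {measure set G -> \bar R}) (mu2 : {measure set (G * G) -> \bar R})
    (xi eta : L2 mu) : L2 mu2 :=
  L2cls mu2 (fun xy => L2fun xi xy.1 * L2fun eta xy.2).
Arguments L2tensor {d G R mu} mu2.

(* The product of x and y is meaningful only when grs x = grr y. *)
Record groupoid (G : Type) := Groupoid {
  gmul : G -> G -> G;
  ginv : G -> G;
  grr : G -> G := fun x => gmul x (ginv x);
  grs : G -> G := fun x => gmul (ginv x) x;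
  ginvK : involutive ginv;
  gmulA : forall x y z, grs x = grr y -> grs y = grr z ->
    [/\ grs (gmul x y) = grr z, grs x = grr (gmul y z)
      & gmul (gmul x y) z = gmul x (gmul y z)];
  gmulKV : forall x y, grs x = grr y -> gmul (ginv x) (gmul x y) = y;
  gmulVK : forall x y, grs x = grr y -> gmul (gmul x y) (ginv y) = x }.

Notation borel G := (g_sigma_algebraType (@open G)).

Section Groupoid.
Context (R : realType) (G : ptopologicalType) (g : groupoid G).
Local Notation measureG := {measure set (borel G) -> \bar R}.
Local Notation r := (grr g).
Local Notation s := (grs g).
Implicit Types (nu mu : measureG) (lam : G -> measureG) (H A B : set G).

Definition units : set G := range r.

Definition sigma_compact := exists K : nat -> set G,
  (forall n, compact (K n)) /\ \bigcup_n K n = setT.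

Definition lc_groupoid :=
  [/\ hausdorff_space G, sigma_compact, @second_countable G
    & locally_compact [set: G]] /\
  continuous (ginv g) /\
  {within [set p | s p.1 = r p.2], continuous (fun p : G * G => gmul g p.1 p.2)}.

Definition radon mu :=
  (forall K : set G, compact K -> (mu K < +oo)%E) /\
  forall E : set (borel G), measurable E ->
    mu E = ereal_sup [set mu K | K in [set K : set G | compact K /\ K `<=` E]].

Definition msupport mu : set G :=
  [set x | forall U : set G, open U -> U x -> (0 < mu U)%E].

(* Cc(H), for a closed subset H; values outside of H are irrelevant. *)
Definition Cc_on H (f : G -> R) := {within H, continuous f} /\
  exists K, [/\ compact K, K `<=` H & forall x, H x -> ~ K x -> f x = 0].

(* [lam] is a left Haar system on the closed subgroupoid H, whose unit space is
   that of G; only the [lam u] with u a unit are meaningful. *)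
Definition haar_system H lam :=
  [/\ forall u, units u -> radon (lam u),
      forall u, units u -> msupport (lam u) = H `&` r @^-1` [set u],
      forall f, Cc_on H f ->
        {within units, continuous (fun u => \int[lam u]_(x in H) f x)}
    & forall f x, Cc_on H f -> H x ->
        \int[lam (s x)]_(y in H `&` r @^-1` [set s x]) f (gmul g x y) =
        \int[lam (r x)]_(y in H `&` r @^-1` [set r x]) f y].

(* \int kap u dnu(u).  Measures on the closed set of units are measures on G
   that vanish outside of it. *)
Definition mixture nu (kap : G -> set (borel G) -> \bar R) (E : set (borel G)) :=
  (\int[nu]_(u in units) kap u E)%E.

Definition quasi_invariant lam nu := forall E : set (borel G), measurable E ->
  mixture nu lam E = 0%E <-> mixture nu lam (ginv g @^-1` E) = 0%E.

Definition measured_groupoid lam nu :=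
  [/\ lc_groupoid, haar_system setT lam, radon nu, nu (~` units) = 0%E
    & quasi_invariant lam nu].

Definition closed_subgroupoid H :=
  [/\ closed H, forall x, H x -> H (ginv g x)
    & forall x y, H x -> H y -> s x = r y -> H (gmul g x y)].

Definition gprod A B : set G :=
  [set x | exists a b, [/\ A a, B b, s a = r b & x = gmul g a b]].

Definition matched_pair nu mu H1 lam1 H2 lam2 :=
  [/\ closed_subgroupoid H1 /\ haar_system H1 lam1,
      closed_subgroupoid H2 /\ haar_system H2 lam2,
      H1 `&` H2 = units,
      mu.-negligible (~` gprod H1 H2)
    & quasi_invariant lam1 nu /\ quasi_invariant lam2 nu].

Section Factorization.
Context (H1 H2 : set G).

(* On gprod H1 H2, the factors (p1 x, p2 x) of x, unique when H1 and H2 only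
   share units; elsewhere the junk value (x, s x). *)
Definition factors (x : G) : G * G :=
  xget (x, s x) [set ab | [/\ H1 ab.1, H2 ab.2, s ab.1 = r ab.2 &
                              gmul g ab.1 ab.2 = x]].
Definition p1 x := (factors x).1.
Definition p2 x := (factors x).2.
Definition mid x := s (p1 x).

Definition theta (xy : G * G) : G * G :=
  let z := gmul g (ginv g (p2 xy.1)) xy.2 in (gmul g xy.1 (p1 z), z).

Definition theta_dom : set (G * G) :=
  [set xy | [/\ mid xy.1 = r xy.2, gprod H1 H2 xy.1
    & gprod H1 H2 (gmul g (ginv g (p2 xy.1)) xy.2)]].

(* D = d(M o theta)/dM'.  As theta is injective on its domain, with a Borel
   inverse, the sets theta(E) are Borel; the complement of the domain is
   M'-negligible for the measures at hand. *)
Definition RN_theta (M M' : {measure set (borel G * borel G) -> \bar R})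
    (D : G * G -> R) :=
  [/\ measurable_fun setT (D : borel G * borel G -> R), forall xy, 0 <= D xy
    & forall E : set (borel G * borel G), measurable E -> E `<=` theta_dom ->
        M (theta @` E) = (\int[M']_(xy in E) (D xy)%:E)%E].

End Factorization.

(* [kap] is a disintegration mu = \int kap u dnu(u) along i : G -> units, with
   respect to the pseudo-image nu of mu: the image of mu by i has the same null
   sets as nu. *)
Definition disintegration nu mu (i : G -> G) (kap : G -> measureG) :=
  [/\ forall A : set (borel G), measurable A ->
        nu A = 0%E <-> mu (i @^-1` A) = 0%E,
      forall u, units u -> radon (kap u),
      forall u, units u -> kap u (~` (i @^-1` [set u])) = 0%E,
      forall E : set (borel G), measurable E ->
        measurable_fun (units : set (borel G)) (fun u => kap u E)
    & forall E : set (borel G), measurable E -> mu E = mixture nu kap E].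

(* M = \int kap u \x kap' u dnu(u). *)
Definition fiber_product_measure nu (kap kap' : G -> measureG)
    (M : {measure set (borel G * borel G) -> \bar R}) :=
  forall E : set (borel G * borel G), measurable E ->
    M E = (\int[nu]_(u in units) (kap u \x kap' u) E)%E.

End Groupoid.

(* Main.v *)
From HB Require Import structures.
From mathcomp Require Import all_boot all_order all_algebra.
From mathcomp Require Import complex finmap.
From mathcomp Require Import all_classical all_reals all_analysis.
From mathcomp Require Import measurable_realfun ring lra.
Require Import Defs.

(* If th carries the measure D.M' to M, then xi |-> D^(1/2) (xi o th) is an
   isometry from L^2(M) to L^2(M'), and it is onto as soon as D > 0 and th has a
   measurable left inverse almost everywhere.

   The fibre product measures are iterated integrals mu(dx) k_(i x)(dy), whose L^2
   spaces are relative tensor products, and such weighted compositions amplify to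
   them.  The five threefold products of the pentagon equation are iterated
   integrals with two kernels attached to a common middle variable, so that by
   Tonelli both presentations of each of them are the same measure.  The equation
   thus reduces to an identity between point maps, which follows from uniqueness
   of the factorization in G1 G2: the weights on both sides then agree because the
   common point map is almost everywhere injective.

   To see that theta carries mu2_(m,r) to mu2_(s,m) up to a density, write
   z = p2(x)^-1 y.  Left invariance turns mu(dx) lam^(m x)(dy) into
   mu(dx) lam^(s x)(dz); by quasi-invariance, mu = delta mu^-1 for some delta > 0,
   which allows one to exchange the roles of x and z, and left invariance by
   p1(z)^-1 then yields D(x, y) = delta(x p1(z)) / delta(x). *)

Set Implicit Arguments.
Unset Strict Implicit.
Unset Printing Implicit Defensive.
Import Order.TTheory GRing.Theory Num.Theory.
Import numFieldNormedType.Exports.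
Local Open Scope classical_set_scope.
Local Open Scope ring_scope.
Local Open Scope complex_scope.

(** * Nonnegative integrals and mixtures of measures *)

Section NNMeas.
Import HBNNSimple.
Context d (T : measurableType d) (R : realType).
Implicit Types f g : T -> \bar R.

(** The given measures are bare: none comes with sigma-finiteness, which Radon-Nikodym and Tonelli
    require. It is drawn from sigma-compactness of [G]: one increasing sequence of sets has finite
    measure for all members of a family at once. This is what [skernel] records, and from there
    sigma-finiteness passes to [mu] and to the fibre products. A relative tensor product is
    symmetric in its factors, but usually only one of them comes with a disintegration. Hence the
    symmetric notion [fibprod], in terms of densities over [nu]; kernels serve to construct the
    measures and to compute with them. Along [r], [mu] has two disintegrations, [mur] and the Haar
    system. Uniqueness of disintegrations is not invoked: Fubini over the units exchanges one for
    the other. Partial operations are made total ([cmul], [thetac], [unit_kernel]), so that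
    measurability holds on whole spaces and the defects lie in null sets. As the derivative [D] is
    arbitrary in the statement, the work is done with a strictly positive one, to which every other
    is almost everywhere equal. *)

Definition nnmeas f := measurable_fun setT f /\ forall x, (0 <= f x)%E.

Lemma nnmeas_indic (E : set T) : measurable E -> nnmeas (fun x => (\1_E x)%:E).
Proof.
by move=> mE; split=> [|x]; [exact/measurable_EFinP|rewrite lee_fin].
Qed.

Lemma nnmeasD f g : nnmeas f -> nnmeas g -> nnmeas (f \+ g)%E.
Proof.
by move=> [mf f0] [mg g0]; split=> [|x]; [exact: emeasurable_funD|exact: adde_ge0].
Qed.

Lemma nnmeasM f g : nnmeas f -> nnmeas g -> nnmeas (fun x => f x * g x)%E.
Proof.
by move=> [mf f0] [mg g0]; split=> [|x]; [exact: emeasurable_funM|exact: mule_ge0].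
Qed.

Lemma nnmeas_cst (c : \bar R) : (0 <= c)%E -> nnmeas (fun=> c).
Proof. by move=> c0; split=> //; exact: measurable_cst. Qed.

Lemma nnmeas_EFin (h : T -> R) : measurable_fun setT h -> (forall x, 0 <= h x) ->
  nnmeas (EFin \o h).
Proof.
by move=> mh h0; split=> [|x]; [exact/measurable_EFinP|rewrite /= lee_fin].
Qed.

Lemma le_nnmeas_integral (mu : {measure set T -> \bar R}) f g : nnmeas f -> nnmeas g ->
  (forall x, f x <= g x)%E -> (\int[mu]_x f x <= \int[mu]_x g x)%E.
Proof. by move=> [mf f0] [mg g0] fg; apply: ge0_le_integral. Qed.

Lemma nnmeas_sqr (h : T -> R) : measurable_fun setT h -> nnmeas (fun x => (h x ^+ 2)%:E).
Proof.
move=> mh; apply: nnmeas_EFin => [|x]; last exact: sqr_ge0.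
exact: measurable_funX.
Qed.

(** Every such function is the increasing limit of the simple functions [nnsfun_approx], and each of
    these is a finite sum over its range, handled by induction on the list of values. *)
Lemma nnmeas_ind (P : (T -> \bar R) -> Prop) :
  (forall E, measurable E -> P (fun x => (\1_E x)%:E)) ->
  (forall f g, nnmeas f -> nnmeas g -> P f -> P g -> P (f \+ g)%E) ->
  (forall (r : R) f, 0 <= r -> nnmeas f -> P f -> P (fun x => r%:E * f x)%E) ->
  (forall f_ : (T -> \bar R)^nat, (forall n, nnmeas (f_ n)) -> (forall n, P (f_ n)) ->
    (forall x, nondecreasing_seq (f_ ^~ x)) -> P (fun x => limn (f_ ^~ x))) ->
  forall f, nnmeas f -> P f.
Proof.
move=> P1 PD PZ PL f [mf f0].
pose h := nnsfun_approx measurableT mf.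
rewrite (_ : f = fun x => limn (fun n => (h n x)%:E)); last first.
  by apply/funext => x; apply/esym/cvg_lim => //; exact: cvg_nnsfun_approx.
have hsum n : (fun x => (h n x)%:E) =
    (fun x => \sum_(y <- fset_set (range (h n))) (y%:E * (\1_(h n @^-1` [set y]) x)%:E))%E.
  apply/funext => x; rewrite {1}(fimfunE (h n) x) fsbig_finite// -sumEFin.
  by apply: eq_bigr.
apply: (PL (fun n x => (h n x)%:E)) => [n|n|x a b ab].
- by apply: nnmeas_EFin.
- rewrite hsum.
  have : {subset fset_set (range (h n)) <= [pred y : R | 0 <= y]}.
    by move=> y; rewrite in_fset_set// inE => -[t _ <-]; rewrite inE.
  move: (fset_set _) => s; rewrite /=.
  suff : forall s : seq R, {subset s <= [pred y : R | 0 <= y]} ->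
    nnmeas (fun x => \sum_(y <- s) y%:E * (\1_(h n @^-1` [set y]) x)%:E)%E /\
    P (fun x => \sum_(y <- s) y%:E * (\1_(h n @^-1` [set y]) x)%:E)%E.
    move=> H Hs; exact: (H (enum_fset s) Hs).2.
  elim=> [_|a s' IH Hs].
    rewrite (_ : (fun _ => _) = fun=> 0%E); last by apply/funext => x; rewrite big_nil.
    split; first exact: nnmeas_cst.
    (* The empty sum counts as the indicator function of the empty set, so [P] of the zero function
       is no separate case. *)
    have := P1 set0 measurable0; congr P; apply/funext => x.
    by rewrite indic0.
  have a0 : 0 <= a by have := Hs a; rewrite !inE eqxx => /(_ isT).
  have ma : measurable (h n @^-1` [set a]) by [].
  have [|n1 p1] := IH; first by move=> y ys; apply: Hs; rewrite inE ys orbT.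
  have n2 := nnmeas_indic ma.
  have n3 : nnmeas (fun x => a%:E * (\1_(h n @^-1` [set a]) x)%:E)%E.
    exact: nnmeasM (nnmeas_cst _) n2.
  rewrite (_ : (fun _ => _) = (fun x => a%:E * (\1_(h n @^-1` [set a]) x)%:E) \+
    (fun x => \sum_(y <- s') y%:E * (\1_(h n @^-1` [set y]) x)%:E))%E; last first.
    by apply/funext => x; rewrite big_cons.
  split; first exact: nnmeasD.
  by apply: (PD) => //; apply: (PZ) => //; exact: P1.
- by rewrite lee_fin; exact/lefP/nd_nnsfun_approx.
Qed.

End NNMeas.

Lemma nnmeas_comp d d' (T : measurableType d) (Y : measurableType d') (R : realType)
  (q : T -> Y) (f : Y -> \bar R) : measurable_fun setT q -> nnmeas f -> nnmeas (f \o q).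
Proof. by move=> mq [mf f0]; split=> [|x /=]; [exact: measurableT_comp|]. Qed.

Section Mix.
Context d d' (A : measurableType d) (Z : measurableType d') (R : realType).
Variables (rho : {measure set A -> \bar R}) (K : A -> {measure set Z -> \bar R}).

Definition measurable_family := forall F : Z -> \bar R, nnmeas F ->
  measurable_fun setT (fun a => \int[K a]_z F z)%E.

Hypothesis mK : measurable_family.

Definition mix (E : set Z) : \bar R := (\int[rho]_a K a E)%E.

Lemma measurable_mix_kernel E : measurable E -> measurable_fun setT (fun a => K a E).
Proof.
move=> mE; have := mK (nnmeas_indic R mE); congr measurable_fun.
by apply/funext => a; rewrite integral_indic// setIT.
Qed.

Let mix0 : mix set0 = 0%E.
Proof. by rewrite /mix integral0_eq// => a _; rewrite measure0. Qed.

Let mix_ge0 E : (0 <= mix E)%E. Proof. by apply: integral_ge0. Qed.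

Let mix_sigma_additive : semi_sigma_additive mix.
Proof.
move=> F mF tF mUF; rewrite [X in _ --> X](_ : _ = (\sum_(n <oo) mix (F n))%E).
  by apply: is_cvg_nneseries => n _ _; exact: mix_ge0.
rewrite /mix -integral_nneseries//; last by move=> n; exact: measurable_mix_kernel.
apply: eq_integral => a _; exact: measure_semi_bigcup.
Qed.

HB.instance Definition _ := isMeasure.Build _ _ _ mix mix0 mix_ge0 mix_sigma_additive.

Definition mixm : {measure set Z -> \bar R} := mix.

(** Stated for any measure that agrees with the mixture on measurable sets, so that it also applies
    to measures given in advance, such as one that comes with a disintegration. *)
Lemma integral_mix (M : {measure set Z -> \bar R}) :
  (forall E, measurable E -> M E = \int[rho]_a K a E)%E ->
  forall F, nnmeas F -> (\int[M]_z F z = \int[rho]_a \int[K a]_z F z)%E.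
Proof.
move=> ME; have i0 h : (forall z, 0 <= h z)%E -> forall a, setT a -> (0 <= \int[K a]_z h z)%E.
  by move=> h0 a _; exact: integral_ge0.
apply: nnmeas_ind.
- move=> E mE; rewrite integral_indic// setIT ME//; apply: eq_integral => a _.
  by rewrite integral_indic// setIT.
- move=> f g nf ng fE gE; have [[mf f0] [mg g0]] := (nf, ng).
  rewrite ge0_integralD// fE gE.
  transitivity (\int[rho]_a (\int[K a]_z f z + \int[K a]_z g z))%E.
    by rewrite (ge0_integralD _ _ (i0 f f0) (mK nf) (i0 g g0) (mK ng)).
  by apply: eq_integral => a _; rewrite ge0_integralD.
- move=> c f c0 nf fE; have [mf f0] := nf.
  rewrite ge0_integralZl// fE.
  transitivity (\int[rho]_a (c%:E * \int[K a]_z f z))%E.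
    by rewrite (ge0_integralZl rho measurableT (mK nf) (i0 f f0)).
  by apply: eq_integral => a _; rewrite ge0_integralZl.
- move=> f_ nf fE nd.
  have m n := (nf n).1; have p n := (nf n).2.
  rewrite monotone_convergence//.
  have -> : (fun n => \int[M]_x f_ n x)%E = (fun n => \int[rho]_a \int[K a]_z f_ n z)%E.
    by apply/funext.
  transitivity (\int[rho]_a limn (fun n => \int[K a]_z f_ n z))%E.
    rewrite monotone_convergence//.
    + by move=> n; exact: mK.
    + by move=> n a _; exact: integral_ge0.
    + by move=> a _ n k nk; apply: ge0_le_integral => // x _; exact: nd.
  by apply: eq_integral => a _; rewrite monotone_convergence.
Qed.

Lemma integral_mixm F : nnmeas F ->
  (\int[mixm]_z F z = \int[rho]_a \int[K a]_z F z)%E.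
Proof. exact: integral_mix. Qed.

End Mix.

(** * Square-integrable functions *)

Notation re := (@complex.Re _).
Notation im := (@complex.Im _).

Section Complex.
Context (R : realType).
Implicit Types z w : R[i].

(** The squared modulus as an element of [R]; the norm of the library takes values in [R[i]]. *)
Definition csq z : R := re z ^+ 2 + im z ^+ 2.

Lemma csq_ge0 z : 0 <= csq z. Proof. by rewrite addr_ge0 ?sqr_ge0. Qed.

Lemma csqM z w : csq (z * w) = csq z * csq w.
Proof. by case: z w => a b [c e]; rewrite /csq /=; ring. Qed.

Lemma csq_conj z : csq z^* = csq z.
Proof. by case: z => a b; rewrite /csq /= sqrrN. Qed.

Lemma csqR (a : R) : csq a%:C = a ^+ 2.
Proof. by rewrite /csq /= expr0n addr0. Qed.

Lemma mulz_conj z : z * z^* = (csq z)%:C.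
Proof. by case: z => a b; rewrite /csq; congr (_ +i* _) => /=; ring. Qed.

Lemma csq_eq0 z : (csq z == 0) = (z == 0).
Proof. by case: z => a b; rewrite /csq paddr_eq0 ?sqr_ge0// !sqrf_eq0 eq_complex. Qed.

Lemma csqD_le z w : csq (z + w) <= 2 * csq z + 2 * csq w.
Proof.
case: z w => a b [c e]; rewrite /csq /= -subr_ge0.
rewrite (_ : _ - _ = (a - c) ^+ 2 + (b - e) ^+ 2); last by ring.
by rewrite addr_ge0 ?sqr_ge0.
Qed.

Lemma csqN z : csq (- z) = csq z.
Proof. by case: z => a b; rewrite /csq /= !sqrrN. Qed.

Lemma norm_re z : `|re z| <= Num.sqrt (csq z).
Proof. by rewrite -sqrtr_sqr ler_sqrt ?lerDl ?sqr_ge0// csq_ge0. Qed.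

Lemma norm_im z : `|im z| <= Num.sqrt (csq z).
Proof. by rewrite -sqrtr_sqr ler_sqrt ?lerDr ?sqr_ge0// csq_ge0. Qed.

Lemma normc_csq z : `|z| = (Num.sqrt (csq z))%:C.
Proof. by case: z. Qed.

(* AM-GM: |z w^*| <= (|z|^2 + |w|^2) / 2 <= |z|^2 + |w|^2 *)
Lemma norm_re_mul z w : `|re (z * w^*)| <= csq z + csq w.
Proof.
have : csq (z * w^*) <= (csq z + csq w) ^+ 2.
  rewrite csqM csq_conj sqrrD -addrA ler_wpDl ?sqr_ge0//.
  have := mulr_ge0 (csq_ge0 z) (csq_ge0 w); have := sqr_ge0 (csq w).
  by move: (csq z * csq w) => a; rewrite mulr2n; lra.
move=> /ler_wsqrtr; rewrite sqrtr_sqr ger0_norm ?(addr_ge0 (csq_ge0 _) (csq_ge0 _))//.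
exact: le_trans (norm_re _).
Qed.

Lemma norm_im_mul z w : `|im (z * w^*)| <= csq z + csq w.
Proof.
rewrite (_ : im (z * w^*) = re ((- 'i * z) * w^*)); last first.
  by case: z w => a b [c e] /=; ring.
apply: le_trans (norm_re_mul _ _) _; rewrite csqM csqN /csq /=.
by rewrite expr0n expr1n add0r mul1r.
Qed.

End Complex.

Arguments csq {R} z.

Lemma measurable_sqrtr (R : realType) : measurable_fun setT (@Num.sqrt R).
Proof. by apply: continuous_measurable_fun; exact: sqrt_continuous. Qed.

Lemma measurable_fun_inv d (T : measurableType d) (R : realType) (h : T -> R) :
  measurable_fun setT h -> (forall x, 0 <= h x) -> measurable_fun setT (fun x => (h x)^-1).
Proof.
move=> mh h0; rewrite (_ : (fun _ => _) = (fun x => h x `^ (-1))).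
  exact: measurableT_comp (measurable_powR _) mh.
by apply/funext => x; rewrite powRN powRr1.
Qed.

Section CMeas.
Context d (T : measurableType d) (R : realType).
Implicit Types f g : T -> R[i].

Definition cmeas f := measurable_fun setT (re \o f) /\ measurable_fun setT (im \o f).

Lemma cmeasD f g : cmeas f -> cmeas g -> cmeas (fun x => f x + g x).
Proof.
move=> [f1 f2] [g1 g2]; split.
  rewrite (_ : _ \o _ = (re \o f) \+ (re \o g)); first exact: measurable_funD.
  by apply/funext => x /=; case: (f x) (g x) => ? ? [].
rewrite (_ : _ \o _ = (im \o f) \+ (im \o g)); first exact: measurable_funD.
by apply/funext => x /=; case: (f x) (g x) => ? ? [].
Qed.

Lemma cmeasM f g : cmeas f -> cmeas g -> cmeas (fun x => f x * g x).
Proof.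
move=> [f1 f2] [g1 g2]; split.
  rewrite (_ : _ \o _ = ((re \o f) \* (re \o g)) \- ((im \o f) \* (im \o g))).
    by apply: measurable_funB; exact: measurable_funM.
  by apply/funext => x /=; case: (f x) (g x) => ? ? [].
rewrite (_ : _ \o _ = ((re \o f) \* (im \o g)) \+ ((im \o f) \* (re \o g))).
  by apply: measurable_funD; exact: measurable_funM.
by apply/funext => x /=; case: (f x) (g x) => ? ? [].
Qed.

Lemma cmeas_cst (c : R[i]) : cmeas (fun=> c).
Proof. by split; exact: measurable_cst. Qed.

Lemma cmeas_conj f : cmeas f -> cmeas (fun x => (f x)^*).
Proof.
move=> [f1 f2]; split.
  by rewrite (_ : _ \o _ = re \o f)//; apply/funext => x /=; case: (f x).
rewrite (_ : _ \o _ = \- (im \o f)); first exact: measurable_funN.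
by apply/funext => x /=; case: (f x).
Qed.

Lemma cmeas_real (h : T -> R) : measurable_fun setT h -> cmeas (fun x => (h x)%:C).
Proof. by move=> mh; split => //; exact: measurable_cst. Qed.

Lemma cmeas_csq f : cmeas f -> measurable_fun setT (csq \o f).
Proof. by move=> [f1 f2]; apply: measurable_funD; exact: measurable_funX. Qed.

Lemma nnmeas_csq f : cmeas f -> nnmeas (fun x => (csq (f x))%:E).
Proof. by move=> /cmeas_csq mf; apply: nnmeas_EFin => // x; exact: csq_ge0. Qed.

End CMeas.

Lemma cmeas_comp d d' (T : measurableType d) (Y : measurableType d') (R : realType)
  (q : T -> Y) (f : Y -> R[i]) : measurable_fun setT q -> cmeas f -> cmeas (fun x => f (q x)).
Proof. by move=> mq [f1 f2]; split; [exact: measurableT_comp f1 mq|exact: measurableT_comp f2 mq]. Qed.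

Section Integrable.
Context d (T : measurableType d) (R : realType) (mu : {measure set T -> \bar R}).
Implicit Types f g : T -> R[i].

Definition cintegrable f :=
  mu.-integrable setT (EFin \o (re \o f)) /\ mu.-integrable setT (EFin \o (im \o f)).

Lemma cintegrable_meas f : cintegrable f -> cmeas f.
Proof.
by move=> [/integrableP[+ _] /integrableP[+ _]] => /measurable_EFinP ? /measurable_EFinP.
Qed.

Lemma le_cintegrable f (h : T -> R) : cmeas f -> mu.-integrable setT (EFin \o h) ->
  (forall x, `|re (f x)| <= h x) -> (forall x, `|im (f x)| <= h x) -> cintegrable f.
Proof.
move=> [f1 f2] ih rh jh; split; apply: (le_integrable measurableT _ _ ih).
- exact/measurable_EFinP.
- by move=> x _; rewrite /= lee_fin (le_trans (rh x))// ler_norm.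
- exact/measurable_EFinP.
- by move=> x _; rewrite /= lee_fin (le_trans (jh x))// ler_norm.
Qed.

Lemma integrable_EFin (h : T -> R) : measurable_fun setT h -> (forall x, 0 <= h x) ->
  (\int[mu]_x (h x)%:E < +oo)%E -> mu.-integrable setT (EFin \o h).
Proof.
move=> mh h0 hoo; apply/integrableP; split; first exact/measurable_EFinP.
by under eq_integral => x _ do rewrite gee0_abs ?lee_fin//.
Qed.

Lemma in_Lfun2 (h : T -> R) : h \in Lfun mu 2%:E <->
  measurable_fun setT h /\ (\int[mu]_x (h x ^+ 2)%:E < +oo)%E.
Proof.
split=> [hL|[mh hoo]].
  have /integrableP[_] := Lfun2_integrable_sqr hL.
  under eq_integral => x _ do rewrite /= ger0_norm ?sqr_ge0//.
  by split=> //; move: hL; rewrite inE => /andP[+ _]; rewrite inE.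
rewrite inE; apply/andP; split; rewrite inE//=.
rewrite /finite_norm unlock /= poweR_lty//.
under eq_integral => x _ do rewrite /= powR_mulrn// real_normK ?num_real//.
exact: hoo.
Qed.

Lemma sqintP f : f \in sqint mu <-> cmeas f /\ (\int[mu]_x (csq (f x))%:E < +oo)%E.
Proof.
split.
  move=> /andP[/in_Lfun2[f1 h1] /in_Lfun2[f2 h2]]; split; first by split.
  under eq_integral => x _ do rewrite EFinD.
  rewrite ge0_integralD//.
  - exact: lte_add_pinfty.
  - by move=> x _; rewrite lee_fin sqr_ge0.
  - exact: (nnmeas_sqr f1).1.
  - by move=> x _; rewrite lee_fin sqr_ge0.
  - exact: (nnmeas_sqr f2).1.
move=> [mf h]; have [f1 f2] := mf.
apply/andP; split; apply/in_Lfun2; split=> //; apply: le_lt_trans h.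
  apply: le_nnmeas_integral; [exact: nnmeas_sqr|exact: nnmeas_csq|move=> x].
  by rewrite lee_fin lerDl sqr_ge0.
apply: le_nnmeas_integral; [exact: nnmeas_sqr|exact: nnmeas_csq|move=> x].
by rewrite lee_fin lerDr sqr_ge0.
Qed.

Lemma sqint_csq_integrable f : f \in sqint mu ->
  mu.-integrable setT (EFin \o (csq \o f)).
Proof.
move=> /sqintP[mf foo]; apply: integrable_EFin => //; first exact: cmeas_csq.
by move=> x; exact: csq_ge0.
Qed.

Lemma sqint_cintegrable f g : f \in sqint mu -> g \in sqint mu ->
  cintegrable (fun x => f x * (g x)^*).
Proof.
move=> sf sg; have [/sqintP[mf _] /sqintP[mg _]] := (sf, sg).
apply: (@le_cintegrable _ (fun x => csq (f x) + csq (g x))).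
- by apply: cmeasM => //; exact: cmeas_conj.
- rewrite (_ : _ \o _ = (EFin \o (csq \o f)) \+ (EFin \o (csq \o g)))%E//.
  by apply: integrableD => //; exact: sqint_csq_integrable.
- by move=> x; exact: norm_re_mul.
- by move=> x; exact: norm_im_mul.
Qed.

Lemma eq_cint f g : cintegrable f -> cintegrable g ->
  {ae mu, forall x, f x = g x} -> cint mu f = cint mu g.
Proof. by move=> [? ?] [? ?]; exact: ae_eq_cint. Qed.

Lemma eq_sqint f g : cmeas g -> {ae mu, forall x, f x = g x} ->
  f \in sqint mu -> g \in sqint mu.
Proof.
move=> mg fg /sqintP[mf h]; apply/sqintP; split=> //.
rewrite (ae_eq_integral (fun x => (csq (f x))%:E))//.
- by apply/measurable_EFinP; exact: cmeas_csq.
- by apply/measurable_EFinP; exact: cmeas_csq.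
- by apply: filterS fg => x ->.
Qed.

Lemma sqint_le f (h : T -> R[i]) : cmeas f -> h \in sqint mu ->
  (forall x, csq (f x) <= csq (h x)) -> f \in sqint mu.
Proof.
move=> mf /sqintP[mh hoo] fh; apply/sqintP; split=> //.
apply: le_lt_trans hoo; have [m1 p1] := nnmeas_csq mf; have [m2 p2] := nnmeas_csq mh.
by apply: ge0_le_integral => // x _; rewrite lee_fin.
Qed.

End Integrable.

(* The image under q of the measure with density w with respect to M has density
   w' with respect to N. *)
Definition chg d d' (Z : measurableType d) (Y : measurableType d') (R : realType)
    (M : {measure set Z -> \bar R}) (w : Z -> R) (q : Z -> Y)
    (N : {measure set Y -> \bar R}) (w' : Y -> R) :=
  forall F : Y -> \bar R, nnmeas F ->
    (\int[M]_z (F (q z) * (w z)%:E) = \int[N]_y (F y * (w' y)%:E))%E.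

Section Chg.
Context d d' (Z : measurableType d) (Y : measurableType d') (R : realType).
Variables (M : {measure set Z -> \bar R}) (w : Z -> R) (q : Z -> Y).
Variables (N : {measure set Y -> \bar R}) (w' : Y -> R).
Hypotheses (mw : measurable_fun setT w) (w0 : forall z, 0 <= w z).
Hypotheses (mw' : measurable_fun setT w') (w'0 : forall y, 0 <= w' y).
Hypothesis mq : measurable_fun setT q.

Let nw : nnmeas (EFin \o w). Proof. exact: nnmeas_EFin. Qed.
Let nw' : nnmeas (EFin \o w'). Proof. exact: nnmeas_EFin. Qed.

(** Intersecting with the sets [S n] allows the hypothesis to be checked where the measure on the
    target is finite, hence where a Radon-Nikodym density is at hand. The limit in [n] is monotone
    convergence on both sides. *)
Lemma chg_set (S : (set Y)^nat) : (forall n, measurable (S n)) -> nondecreasing_seq S ->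
  \bigcup_n S n = setT ->
  (forall n B, measurable B ->
    (\int[M]_z ((\1_(B `&` S n) (q z))%:E * (w z)%:E) =
     \int[N]_y ((\1_(B `&` S n) y)%:E * (w' y)%:E))%E) ->
  chg M w q N w'.
Proof.
have nq F : nnmeas F -> nnmeas (fun z => F (q z) * (w z)%:E)%E.
  by move=> nF; apply: nnmeasM nw; exact: nnmeas_comp nF.
have nq' F : nnmeas F -> nnmeas (fun y => F y * (w' y)%:E)%E.
  by move=> nF; exact: nnmeasM nF nw'.
move=> mS ndS ST H.
have PL (f_ : (Y -> \bar R)^nat) : (forall n, nnmeas (f_ n)) ->
    (forall n, \int[M]_z (f_ n (q z) * (w z)%:E) = \int[N]_y (f_ n y * (w' y)%:E))%E ->
    (forall y, nondecreasing_seq (f_ ^~ y)) ->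
  (\int[M]_z (limn (f_ ^~ (q z)) * (w z)%:E) = \int[N]_y (limn (f_ ^~ y) * (w' y)%:E))%E.
  move=> nf fE nd.
  have lim_mul (c : R) y : (limn (f_ ^~ y) * c%:E = limn (fun n => f_ n y * c%:E))%E.
    apply/esym/cvg_lim => //; apply: cvgeZr => //.
    exact: ereal_nondecreasing_is_cvgn.
  under eq_integral do rewrite lim_mul.
  under [RHS]eq_integral do rewrite lim_mul.
  have ndM (c : R) y : 0 <= c -> nondecreasing_seq (fun n => f_ n y * c%:E)%E.
    by move=> c0 m n mn; rewrite lee_wpmul2r ?lee_fin//; exact: nd.
  rewrite !monotone_convergence//.
  + by congr (limn _); apply/funext => n.
  + by move=> n; exact: (nq' _ (nf n)).1.
  + by move=> n y _; exact: (nq' _ (nf n)).2.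
  + by move=> y _; exact: ndM.
  + by move=> n; exact: (nq _ (nf n)).1.
  + by move=> n y _; exact: (nq _ (nf n)).2.
  + by move=> y _; exact: ndM.
apply: nnmeas_ind => //.
- move=> B mB.
  have limB y : (\1_B y)%:E = limn (fun n => (\1_(B `&` S n) y : R)%:E).
    apply/esym/cvg_lim => //; apply: cvg_near_cst.
    have [n _ Sn] : (\bigcup_n S n) y by rewrite ST.
    exists n => // k /= nk; rewrite !indicE in_setI.
    suff -> : y \in S k by rewrite andbT.
    by rewrite inE; move: Sn; apply/subsetPset; exact: ndS.
  under eq_integral do rewrite limB.
  under [RHS]eq_integral do rewrite limB.
  apply: (PL (fun n y => (\1_(B `&` S n) y)%:E)).
  + by move=> n; apply: nnmeas_indic; exact: measurableI.
  + by move=> n; exact: H.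
  + move=> y m n mn; rewrite lee_fin ler_nat !in_setI.
    case: (y \in B) => //=; case: (boolP (y \in S m)) => //=; rewrite !inE => Sm.
    by rewrite mem_set//; move: Sm; apply/subsetPset; exact: ndS.
- move=> f g nf ng fE gE.
  have [f1 f2] := nq _ nf; have [g1 g2] := nq _ ng.
  have [h1 h2] := nq' _ nf; have [k1 k2] := nq' _ ng.
  under eq_integral do rewrite ge0_muleDl ?nf.2 ?ng.2//.
  under [RHS]eq_integral do rewrite ge0_muleDl ?nf.2 ?ng.2//.
  by rewrite !ge0_integralD// fE gE.
- move=> c f c0 nf fE; have [f1 f2] := nq _ nf; have [h1 h2] := nq' _ nf.
  under eq_integral do rewrite -muleA.
  under [RHS]eq_integral do rewrite -muleA.
  by rewrite !ge0_integralZl// fE.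
Qed.

Hypothesis H : chg M w q N w'.

Let real_case (f : Y -> R) : measurable_fun setT f ->
  N.-integrable setT (fun y => (f y * w' y)%:E) ->
  M.-integrable setT (fun z => (f (q z) * w z)%:E) /\
  \int[M]_z (f (q z) * w z) = \int[N]_y (f y * w' y).
Proof.
move=> mf /integrableP[_ foo].
have part (h : Y -> R) : measurable_fun setT h -> (forall y, 0 <= h y) ->
    (\int[M]_z (h (q z) * w z)%:E = \int[N]_y (h y * w' y)%:E)%E.
  by move=> mh h0; have := H (nnmeas_EFin mh h0).
have mfq : measurable_fun setT (f \o q) by exact: measurableT_comp.
split.
  apply/integrableP; split; first by apply/measurable_EFinP; exact: measurable_funM.
  rewrite (_ : (\int[M]_x _)%E = \int[M]_z (`|f (q z)| * w z)%:E)%E; last first.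
    by apply: eq_integral => z _; rewrite /= normrM (ger0_norm (w0 z)).
  rewrite (part (fun y => `|f y|))//; last exact: measurableT_comp.
  apply: le_lt_trans foo; apply: ge0_le_integral => //.
  - by move=> y _; rewrite lee_fin mulr_ge0.
  - by apply/measurable_EFinP; apply: measurable_funM => //; exact: measurableT_comp.
  - apply/measurable_EFinP; apply: measurableT_comp => //; exact: measurable_funM.
  - by move=> y _; rewrite /= normrM (ger0_norm (w'0 y)).
have pos_part (h k : R) : 0 <= k -> maxe (h * k)%:E 0%E = (Num.max h 0 * k)%:E.
  by move=> k0; rewrite -EFin_max maxr_pMl// mul0r.
have neg_part (h k : R) : 0 <= k -> maxe (- (h * k)%:E)%E 0%E = (Num.max (- h) 0 * k)%:E.
  by move=> k0; rewrite -EFinN -mulNr pos_part.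
(* As the weights are nonnegative, the positive and negative parts of a weighted function are the
   weighted parts of the function, to which the hypothesis applies. *)
rewrite /Rintegral; congr fine; rewrite integralE [RHS]integralE; congr (_ - _)%E.
  rewrite (_ : (\int[M]_x _)%E = \int[M]_z (Num.max (f (q z)) 0 * w z)%:E)%E; last first.
    by apply: eq_integral => z _; rewrite funeposE pos_part.
  rewrite (part (fun y => Num.max (f y) 0)).
  - by apply: eq_integral => z _; rewrite funeposE pos_part.
  - exact: measurable_maxr.
  - by move=> y; rewrite le_max lexx orbT.
rewrite (_ : (\int[M]_x _)%E = \int[M]_z (Num.max (- f (q z)) 0 * w z)%:E)%E; last first.
  by apply: eq_integral => z _; rewrite funenegE neg_part.
rewrite (part (fun y => Num.max (- f y) 0)).
- by apply: eq_integral => z _; rewrite funenegE neg_part.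
- by apply: measurable_maxr => //; exact: measurable_funN.
- by move=> y; rewrite le_max lexx orbT.
Qed.

Lemma chg_cint (F : Y -> R[i]) : cmeas F ->
  cintegrable N (fun y => F y * (w' y)%:C) ->
  cintegrable M (fun z => F (q z) * (w z)%:C) /\
  cint M (fun z => F (q z) * (w z)%:C) = cint N (fun y => F y * (w' y)%:C).
Proof.
have reM (z : R[i]) (c : R) : re (z * c%:C) = re z * c.
  by case: z => a b /=; rewrite mulr0 subr0.
have imM (z : R[i]) (c : R) : im (z * c%:C) = im z * c.
  by case: z => a b /=; rewrite mulr0 add0r.
move=> [F1 F2] [i1 i2].
have [] := real_case F1; first by move: i1; congr integrable; apply/funext => y /=; rewrite reM.
move=> j1 e1.
have [] := real_case F2; first by move: i2; congr integrable; apply/funext => y /=; rewrite imM.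
move=> j2 e2.
split.
  split; [move: j1|move: j2]; congr integrable; apply/funext => y /=; by rewrite ?reM ?imM.
rewrite /cint; congr (_ +i* _).
  transitivity (\int[M]_z (re (F (q z)) * w z)); last rewrite e1;
    by apply: eq_Rintegral => z _; rewrite reM.
transitivity (\int[M]_z (im (F (q z)) * w z)); last rewrite e2;
  by apply: eq_Rintegral => z _; rewrite imM.
Qed.

End Chg.

Section Weights.
Context d (Z : measurableType d) (R : realType) (M : {measure set Z -> \bar R}).

(** On the sets [E n k], where [M] is finite and [D] bounded, [D] is integrable and its integrals
    over subsets determine it almost everywhere; these sets cover the space. *)
Lemma ae_eq_weights (D D' : Z -> R) : sigma_finite setT M ->
  measurable_fun setT D -> (forall z, 0 <= D z) ->
  measurable_fun setT D' ->
  (forall E, measurable E -> \int[M]_(z in E) (D z)%:E = \int[M]_(z in E) (D' z)%:E)%E ->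
  {ae M, forall z, D z = D' z}.
Proof.
move=> [S ST mS] mD D0 mD' DD'.
pose E n k := S n `&` [set z | D z <= k%:R].
have mE n k : measurable (E n k).
  apply: measurableI; first by case: (mS n).
  by rewrite -[X in measurable X]setTI; exact: measurable_fun_le.
have aeE n k : ae_eq M (E n k) (EFin \o D) (EFin \o D').
  apply: integral_ae_eq => //.
  - apply/integrableP; split; first by apply/measurable_EFinP; exact: measurable_funTS.
    apply: (@le_lt_trans _ _ (\int[M]_(z in E n k) k%:R%:E)%E).
      apply: ge0_le_integral => //.
      + by apply/measurable_EFinP; apply: measurableT_comp => //; exact: measurable_funTS.
      + by move=> z [_ /= Dn]; rewrite ger0_norm// lee_fin.
    rewrite integral_cst// lte_mul_pinfty// ?lee_fin//.
    apply: (@le_lt_trans _ _ (M (S n))); last by case: (mS n).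
    by apply: le_measure; rewrite ?inE//; [case: (mS n)|exact: subIsetl].
  - by apply/measurable_EFinP; exact: measurable_funTS.
  - by move=> B _ mB; exact: DD'.
have aeE' n k : M.-negligible [set z | E n k z /\ D z <> D' z].
  apply: negligibleS (aeE n k) => z [Ez Dz] /=; apply: contra_not Dz => /(_ Ez).
  by case.
have := negligible_bigcup (fun n => negligible_bigcup (aeE' n)).
apply: negligibleS => z /= Dz.
have [n _ Sn] : (\bigcup_n S n) z by rewrite -ST.
exists n => //; exists (Num.truncn (D z)).+1 => //; split => //; split => //=.
by rewrite ltW// truncnS_gt.
Qed.

End Weights.

(** * Completeness of the space of square-integrable functions *)

Section L2Theory.
Context d (T : measurableType d) (R : realType) (mu : {measure set T -> \bar R}).
Implicit Types (f g : T -> R[i]) (xi eta : L2 mu).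
Local Open Scope quotient_scope.

Lemma L2fun_sqint xi : L2fun xi \in sqint mu.
Proof. exact: valP. Qed.

Lemma L2fun_meas xi : cmeas (L2fun xi).
Proof. by have /sqintP[] := L2fun_sqint xi. Qed.

Lemma L2cls_sqint f (fP : f \in sqint mu) :
  L2cls mu f = \pi_(L2quot mu) (SqintFun fP).
Proof.
(* [L2cls] matches on [idP], whose boolean cannot be rewritten in place; the claim is generalized to
   an arbitrary [reflect] proof. *)
suff H b (p : reflect (f \in sqint mu) b) :
    (if p is ReflectT fP' then \pi_(L2quot mu) (SqintFun fP') : L2 mu else 0) =
    \pi_(L2quot mu) (SqintFun fP) by exact: H.
by case: p => [fP'|/(_ fP)//]; congr (\pi _); apply/val_inj.
Qed.

Lemma L2cls_notin f : f \notin sqint mu -> L2cls mu f = 0.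
Proof.
move=> /negP fP.
suff H b (p : reflect (f \in sqint mu) b) :
    (if p is ReflectT fP' then \pi_(L2quot mu) (SqintFun fP') : L2 mu else 0) = 0
  by exact: H.
by case: p.
Qed.

Lemma L2fun_cls f : f \in sqint mu -> {ae mu, forall x, L2fun (L2cls mu f) x = f x}.
Proof.
move=> fP; rewrite (L2cls_sqint fP).
by apply: (elimT (L2_eqP (repr (\pi_(L2quot mu) (SqintFun fP))) (SqintFun fP))); rewrite reprK.
Qed.

Lemma L2_eq xi eta : {ae mu, forall x, L2fun xi x = L2fun eta x} -> xi = eta.
Proof. exact: L2_ext. Qed.

Lemma L2cls_fun xi : L2cls mu (L2fun xi) = xi.
Proof. by apply: L2_eq; apply: L2fun_cls; exact: L2fun_sqint. Qed.

Lemma L2cls_eq f g : cmeas f -> cmeas g -> {ae mu, forall x, f x = g x} ->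
  L2cls mu f = L2cls mu g.
Proof.
move=> mf mg fg; have [fP|fP] := boolP (f \in sqint mu).
  have gP := eq_sqint mg fg fP.
  by apply: L2_eq; apply: filterS3 (L2fun_cls fP) (L2fun_cls gP) fg => x -> -> ->.
have [gP|gP] := boolP (g \in sqint mu); last by rewrite !L2cls_notin.
by move: fP; rewrite (eq_sqint mf _ gP)//; apply: filterS fg => x ->.
Qed.

Lemma L2ipE xi eta : ip xi eta = cint mu (fun x => L2fun xi x * (L2fun eta x)^*).
Proof. by []. Qed.

Lemma L2funD xi eta : {ae mu, forall x, L2fun (xi + eta) x = L2fun xi x + L2fun eta x}.
Proof. exact: L2_reprD. Qed.

Lemma L2funZ a xi : {ae mu, forall x, L2fun (a *: xi) x = a * L2fun xi x}.
Proof. exact: L2_reprZ. Qed.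

Lemma L2funB xi eta : {ae mu, forall x, L2fun (xi - eta) x = L2fun xi x - L2fun eta x}.
Proof.
rewrite -scaleN1r.
by apply: filterS2 (L2funD xi (-1 *: eta)) (L2funZ (-1) eta) => x -> ->; rewrite mulN1r.
Qed.

Definition nrm2 xi : R := \int[mu]_x csq (L2fun xi x).

Lemma nrm2_fin xi : (\int[mu]_x (csq (L2fun xi x))%:E < +oo)%E.
Proof. by have /sqintP[] := L2fun_sqint xi. Qed.

Lemma nrm2E xi : (nrm2 xi)%:E = (\int[mu]_x (csq (L2fun xi x))%:E)%E.
Proof.
rewrite /nrm2 /Rintegral fineK// ge0_fin_numE; first exact: nrm2_fin.
by apply: integral_ge0 => x _; rewrite lee_fin csq_ge0.
Qed.

Lemma nrm2_ge0 xi : 0 <= nrm2 xi.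
Proof. by apply: Rintegral_ge0 => x _; exact: csq_ge0. Qed.

Lemma ip_nrm2 xi : ip xi xi = (nrm2 xi)%:C.
Proof.
rewrite L2ipE /cint; congr (_ +i* _); first by apply: eq_Rintegral => x _; rewrite mulz_conj.
under eq_Rintegral do rewrite mulz_conj /=.
by rewrite Rintegral_cst// mul0r.
Qed.

Lemma nrm2_cls f : f \in sqint mu ->
  (nrm2 (L2cls mu f))%:E = (\int[mu]_x (csq (f x))%:E)%E.
Proof.
move=> fP; have /sqintP[mf _] := fP; rewrite nrm2E; apply: ae_eq_integral => //.
- by have [] := nnmeas_csq (L2fun_meas (L2cls mu f)).
- by have [] := nnmeas_csq mf.
- by apply: filterS (L2fun_cls fP) => x ->.
Qed.

Lemma nrm2B f xi : f \in sqint mu ->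
  (nrm2 (L2cls mu f - xi))%:E = (\int[mu]_x (csq (f x - L2fun xi x))%:E)%E.
Proof.
move=> fP; have /sqintP[mf _] := fP; rewrite nrm2E; apply: ae_eq_integral => //.
- by have [] := nnmeas_csq (L2fun_meas (L2cls mu f - xi)).
- have := cmeasD mf (cmeasM (cmeas_cst _ (-1)) (L2fun_meas xi)).
  by move=> /nnmeas_csq[+ _]; congr measurable_fun; apply/funext => x; rewrite mulN1r.
- by apply: filterS2 (L2fun_cls fP) (L2funB (L2cls mu f) xi) => x <- ->.
Qed.

Lemma nrm2_sym xi eta : nrm2 (xi - eta) = nrm2 (eta - xi).
Proof.
apply: EFin_inj; rewrite !nrm2E; apply: ae_eq_integral => //.
- by have [] := nnmeas_csq (L2fun_meas (xi - eta)).
- by have [] := nnmeas_csq (L2fun_meas (eta - xi)).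
- by apply: filterS2 (L2funB xi eta) (L2funB eta xi) => x -> ->; rewrite -csqN opprB.
Qed.

(** Riesz-Fischer: a rapidly convergent subsequence converges almost everywhere, and Fatou's lemma
    bounds the distance of the whole sequence to its limit. *)
Lemma L2_complete (u : nat -> L2 mu) :
  (forall e : R, 0 < e -> exists N, forall m n, (N <= m)%N -> (N <= n)%N ->
     nrm2 (u m - u n) < e) ->
  exists l : L2 mu, forall e : R, 0 < e -> exists N, forall n, (N <= n)%N ->
     nrm2 (u n - l) < e.
Proof.
move=> cau.
(* The ratio 1/8 leaves room for the factor 4 ^ k below: the products 4 ^ k / 8 ^ k = 2 ^ - k are
   still summable. *)
have /choice[N NP] : forall k, exists N, forall m n, (N <= m)%N -> (N <= n)%N ->
    nrm2 (u m - u n) < 8^-1 ^+ k.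
  by move=> k; apply: cau; rewrite exprn_gt0.
(* The sum of the [N j] makes [a] nondecreasing and larger than [N k]; the extra term [k] makes it
   unbounded. *)
pose a k := (k + \sum_(j < k.+1) N j)%N.
have aS k : (a k <= a k.+1)%N by rewrite /a [X in (_ <= _ + X)%N]big_ord_recr leq_add// leq_addr.
have aN k : (N k <= a k)%N by rewrite /a big_ord_recr addnA leq_addl.
have amono : {homo a : m n / (m <= n)%N >-> (m <= n)%N}.
  by apply: homo_leq aS => [x|y x z]; [exact: leqnn|exact: leq_trans].
pose g k := L2fun (u (a k)).
have mg k : cmeas (g k) by exact: L2fun_meas.
pose dd k x := csq (g k.+1 x - g k x).
have msub f h : cmeas f -> cmeas h -> cmeas (fun x => f x - h x).
  move=> mf mh; have := cmeasD mf (cmeasM (cmeas_cst _ (-1)) mh).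
  by congr cmeas; apply/funext => x; rewrite mulN1r.
have ndd k : nnmeas (fun x => (dd k x)%:E) by apply: nnmeas_csq; exact: msub.
have ndd4 k : nnmeas (fun x => (4 ^+ k)%:E * (dd k x)%:E)%E.
  by apply: nnmeasM => //; apply: nnmeas_cst; rewrite lee_fin exprn_ge0.
have intB m n : (\int[mu]_x (csq (g m x - g n x))%:E = (nrm2 (u (a m) - u (a n)))%:E)%E.
  by rewrite -[in RHS](L2cls_fun (u (a m))) nrm2B//; exact: L2fun_sqint.
(* If [S x] is finite, the increments of [g] at [x] are of order 2 ^ - k, so [g k x] converges. The
   integral of [S] is at most 2. *)
pose S x := (\sum_(k <oo) (4 ^+ k)%:E * (dd k x)%:E)%E.
have Soo : {ae mu, forall x, (S x < +oo)%E}.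
  have nS : nnmeas S.
    split; last by move=> x; apply: nneseries_ge0 => k _ _; exact: (ndd4 k).2.
    by apply: ge0_emeasurable_sum => [k x _ _|k _]; [exact: (ndd4 k).2|exact: (ndd4 k).1].
  have : mu.-integrable setT S.
    apply/integrableP; split; first exact: nS.1.
    under eq_integral do rewrite gee0_abs ?nS.2//.
    rewrite integral_nneseries//; last by move=> k x _; exact: (ndd4 k).2.
      apply: (@le_lt_trans _ _ 2%:E); last exact: ltry.
      apply: lime_le; first by apply: is_cvg_nneseries => k _ _;
        apply: integral_ge0 => x _; exact: (ndd4 k).2.
      near=> n; apply: (@le_trans _ _ (\sum_(0 <= k < n) (2^-1 ^+ k)%:E)%E).
        apply: lee_sum => k _.
        rewrite (ge0_integralZl mu measurableT (ndd k).1 (fun x _ => (ndd k).2 x));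
          last by rewrite lee_fin exprn_ge0.
        rewrite intB -EFinM lee_fin.
        apply: (@le_trans _ _ (4 ^+ k * 8^-1 ^+ k)).
          rewrite ler_wpM2l ?exprn_ge0// ltW// NP//.
          exact: leq_trans (aN k) (aS k).
        by rewrite -exprMn (_ : 4 * 8^-1 = 2^-1)//; field.
      rewrite sumEFin lee_fin.
      have := @geometric_le_lim R n 1 2^-1 ler01.
      rewrite /series /geometric /=; under eq_bigr do rewrite mul1r.
      rewrite ger0_norm// => /(_ _ _)/le_trans; apply; rewrite ?invf_lt1 ?ltr1n//.
      by rewrite mul1r (_ : 1 - 2^-1 = 2^-1) ?invrK//; field.
    by move=> k; exact: (ndd4 k).1.
  by move=> /(integrable_ae measurableT); apply: filterS => x /(_ I); rewrite ge0_fin_numE// nS.2.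
have cvg_part (h : R[i] -> R) x : (forall z w, h (z - w) = h z - h w) ->
    (forall z, h z ^+ 2 <= csq z) -> (S x < +oo)%E -> cvgn (fun k => h (g k x)).
  move=> hB hsq Sx.
  have Sfin : S x \is a fin_num.
    by rewrite ge0_fin_numE//; apply: nneseries_ge0 => k _ _; exact: (ndd4 k).2.
  have S0 : 0 <= fine (S x).
    by apply: fine_ge0; apply: nneseries_ge0 => k _ _; exact: (ndd4 k).2.
  have bnd k : 4 ^+ k * dd k x <= fine (S x).
    rewrite -lee_fin fineK// EFinM.
    apply: le_trans (@nneseries_lim_ge _ _ xpredT 0 k.+1 _); last first.
      by move=> j _ _; exact: (ndd4 j).2.
    rewrite big_nat_recr//= leeDr//; apply: sume_ge0 => j _; exact: (ndd4 j).2.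
  (* The constant is c + 1 with c = [fine (S x)], because c <= (c + 1) ^ 2 dispenses with a square
     root. *)
  have bnd' k : `|h (g k.+1 x) - h (g k x)| <= (fine (S x) + 1) * 2^-1 ^+ k.
    rewrite -(@ler_pXn2r _ 2)// ?nnegrE ?mulr_ge0 ?exprn_ge0 ?addr_ge0//.
    rewrite real_normK ?num_real// -hB (le_trans (hsq _))// exprMn.
    rewrite -[_ ^+ k ^+ 2]exprM mulnC exprM.
    have -> : (2^-1 : R) ^+ 2 = 4^-1 by field.
    rewrite -(@ler_pM2l _ (4 ^+ k)) ?exprn_gt0// (le_trans (bnd k))//.
    rewrite mulrCA -exprMn divff ?expr1n ?mulr1//.
    by move: (fine (S x)) S0 => c c0; nra.
  have : cvgn (series (telescope (fun k => h (g k x)))).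
    apply: normed_cvg.
    have v0 k : 0 <= geometric (fine (S x) + 1) 2^-1 k.
      by rewrite /= mulr_ge0 ?exprn_ge0 ?addr_ge0.
    apply: (series_le_cvg (fun=> normr_ge0 _) v0 bnd').
    by apply: is_cvg_geometric_series; rewrite ger0_norm// invf_lt1 ?ltr1n.
  rewrite telescopeK => /cvg_ex[l hl].
  apply/cvg_ex; exists (l + h (g 0%N x)).
  have -> : (fun k => h (g k x)) = (fun k => h (g k x) - h (g 0%N x) + h (g 0%N x)).
    by apply/funext => k; rewrite subrK.
  exact: cvgD hl (cvg_cst _).
(* An upper limit exists everywhere and is measurable; it is the limit wherever the sequence
   converges, and its value elsewhere does not matter. *)
pose lm (h : R[i] -> R) x := fine (limn_esup (fun k => (h (g k x))%:E)).
have mlm h : (forall k, measurable_fun setT (h \o g k)) -> measurable_fun setT (lm h).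
  move=> mh; apply: measurableT_comp; first exact: fine_measurable.
  by apply: measurable_fun_limn_esup => k; apply/measurable_EFinP; exact: mh.
have lmE (h : R[i] -> R) x : cvgn (fun k => h (g k x)) -> h (g k x) @[k --> \oo] --> lm h x.
  move=> /cvg_ex[/= l hl]; rewrite /lm.
  have : (h (g k x))%:E @[k --> \oo] --> l%:E.
    by apply: cvg_EFin; [exact: nearW|exact: hl].
  by move=> /cvg_limn_einf_sup[_ ->]; exact: hl.
pose f x := lm re x +i* lm im x.
have mf : cmeas f.
  by split; apply: mlm => k; [exact: (mg k).1|exact: (mg k).2].
have fcvg v x : (S x < +oo)%E ->
    csq (g k x - v) @[k --> \oo] --> csq (f x - v).
  move=> Sx.
  have c1 : re (g k x) @[k --> \oo] --> re (f x).
    by apply: lmE; apply: cvg_part => // [[a1 b1] []//|z]; rewrite lerDl sqr_ge0.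
  have c2 : im (g k x) @[k --> \oo] --> im (f x).
    by apply: lmE; apply: cvg_part => // [[a1 b1] []//|z]; rewrite lerDr sqr_ge0.
  have csqB z w : csq (z - w) = (re z - re w) * (re z - re w) + (im z - im w) * (im z - im w).
    by case: z w => a1 b1 [a2 b2]; rewrite /csq /= !expr2.
  rewrite csqB; under eq_fun do rewrite csqB.
  have d1 : re (g k x) - re v @[k --> \oo] --> re (f x) - re v.
    by apply: cvgB => //; exact: cvg_cst.
  have d2 : im (g k x) - im v @[k --> \oo] --> im (f x) - im v.
    by apply: cvgB => //; exact: cvg_cst.
  by apply: cvgD; [exact: (cvgM d1 d1)|exact: (cvgM d2 d2)].
have small e : 0 < e -> exists M, forall n, (M <= n)%N ->
    (\int[mu]_x (csq (f x - L2fun (u n) x))%:E <= e%:E)%E.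
  move=> /cau[M HM]; exists M => n Mn.
  have nk k : nnmeas (fun x => (csq (g k x - L2fun (u n) x))%:E).
    by apply: nnmeas_csq; apply: msub => //; exact: L2fun_meas.
  have nf : nnmeas (fun x => (csq (f x - L2fun (u n) x))%:E).
    by apply: nnmeas_csq; apply: msub => //; exact: L2fun_meas.
  (* Almost everywhere the lower limit is the value at the limit function, which puts the integral
     in the form of Fatou's lemma. *)
  apply: (@le_trans _ _ (\int[mu]_x limn_einf (fun k => (csq (g k x - L2fun (u n) x))%:E))%E).
    rewrite (ae_eq_integral (fun x => limn_einf (fun k => (csq (g k x - L2fun (u n) x))%:E)))//.
    - exact: nf.1.
    - rewrite (_ : (fun x => _) = (fun x => - limn_esup (fun k => - (csq (g k x - L2fun (u n) x))%:E))%E).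
        apply: measurableT_comp => //; apply: measurable_fun_limn_esup => k.
        by apply: measurableT_comp => //; exact: (nk k).1.
      apply/funext => x; rewrite -limn_einfN; congr limn_einf.
      by apply/funext => k /=; rewrite opprK.
    - apply: filterS Soo => x Sx _.
      have : (csq (g k x - L2fun (u n) x))%:E @[k --> \oo] --> (csq (f x - L2fun (u n) x))%:E.
        by apply: cvg_EFin; [exact: nearW|exact: fcvg].
      by move=> /cvg_limn_einf_sup[-> _].
  apply: (le_trans (fatou mu measurableT (fun k => (nk k).1) (fun k x _ => (nk k).2 x))).
  rewrite limn_einf_lim; apply: lime_le; first exact: is_cvg_einfs.
  near=> k; apply: (@le_trans _ _ (nrm2 (u (a (maxn k M)) - u n))%:E).
    apply: ereal_inf_lbound; exists (maxn k M); first exact: leq_maxl.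
    by rewrite -[in RHS](L2cls_fun (u (a _))) nrm2B//; exact: L2fun_sqint.
  rewrite lee_fin ltW// HM//.
  by rewrite (@leq_trans (maxn k M)) ?leq_maxr// leq_addr.
have fP : f \in sqint mu.
  apply/sqintP; split=> //.
  have [M /(_ _ (leqnn M)) HM] := small 1 ltr01.
  apply: (@le_lt_trans _ _ (\int[mu]_x (2%:E * (csq (f x - L2fun (u M) x))%:E +
      2%:E * (csq (L2fun (u M) x))%:E))%E).
    apply: le_nnmeas_integral; first exact: nnmeas_csq.
      apply: nnmeasD; apply: nnmeasM; try exact: nnmeas_cst.
        by apply: nnmeas_csq; apply: msub => //; exact: L2fun_meas.
      by apply: nnmeas_csq; exact: L2fun_meas.
    by move=> x; rewrite -!EFinM -EFinD lee_fin -{1}(subrK (L2fun (u M) x) (f x)) csqD_le.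
  have [n1 p1] : nnmeas (fun x => (csq (f x - L2fun (u M) x))%:E).
    by apply: nnmeas_csq; apply: msub => //; exact: L2fun_meas.
  have [n2 p2] := nnmeas_csq (L2fun_meas (u M)).
  rewrite ge0_integralD//; last first.
  - by apply: emeasurable_funM => //; exact: measurable_cst.
  - by move=> x _; rewrite mule_ge0.
  - by apply: emeasurable_funM => //; exact: measurable_cst.
  - by move=> x _; rewrite mule_ge0.
  rewrite !ge0_integralZl// lte_add_pinfty// lte_mul_pinfty//.
    exact: le_lt_trans HM (ltry _).
  exact: nrm2_fin.
exists (L2cls mu f) => e e0.
have [|M HM] := small (e / 2); first by rewrite divr_gt0.
exists M => n Mn; rewrite -lte_fin.
rewrite nrm2_sym nrm2B//; apply: le_lt_trans (HM n Mn) _.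
by rewrite lte_fin; lra.
Unshelve. all: by end_near. Qed.

Lemma hilbert_L2 : hilbert (L2 mu).
Proof.
move=> u cau.
have reE (e : R[i]) : 0 < e -> e = (re e)%:C /\ 0 < re e.
  by case: e => a b; rewrite ltcE /= => /andP[/eqP -> a0]; split.
have [e e0|l lP] := @L2_complete u.
  have [|N HN] := cau e%:C; first by rewrite ltcR.
  exists N => m n Nm Nn; have := HN m n Nm Nn.
  by rewrite ip_nrm2 ltcR.
exists l => e /reE[-> e0]; have [N HN] := lP _ e0.
by exists N => n Nn; rewrite ip_nrm2 ltcR; exact: HN.
Qed.

End L2Theory.

(** * Weighted composition operators *)

Section WeightedComposition.
Context d d' (Z : measurableType d) (Z' : measurableType d') (R : realType).
Variables (M : {measure set Z -> \bar R}) (M' : {measure set Z' -> \bar R}).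
Variables (th : Z' -> Z) (D : Z' -> R).

Definition wcomp (xi : L2 M) : L2 M' :=
  L2cls M' (fun z => (Num.sqrt (D z))%:C * L2fun xi (th z)).

Definition transports := [/\ measurable_fun setT th, measurable_fun setT D,
  forall z, 0 <= D z & chg M' D th M (cst 1)].

Hypothesis T : transports.

Let mth : measurable_fun setT th. Proof. by case: T. Qed.
Let mD : measurable_fun setT D. Proof. by case: T. Qed.
Let D0 z : 0 <= D z. Proof. by case: T. Qed.

Lemma transports_integral F : nnmeas F ->
  (\int[M']_z (F (th z) * (D z)%:E) = \int[M]_z F z)%E.
Proof. by case: T => _ _ _ H /H ->; apply: eq_integral => z _; rewrite mule1. Qed.

Lemma wcomp_meas (f : Z -> R[i]) : cmeas f ->
  cmeas (fun z => (Num.sqrt (D z))%:C * f (th z)).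
Proof.
move=> mf; apply: cmeasM; last exact: cmeas_comp.
by apply: cmeas_real; apply: measurableT_comp => //; exact: measurable_sqrtr.
Qed.

Lemma csq_sqrtM (c : R) (z : R[i]) : 0 <= c -> csq ((Num.sqrt c)%:C * z) = csq z * c.
Proof. by move=> c0; rewrite csqM csqR sqr_sqrtr// mulrC. Qed.

Lemma wcomp_sqint f : f \in sqint M ->
  (fun z => (Num.sqrt (D z))%:C * f (th z)) \in sqint M'.
Proof.
move=> /sqintP[mf foo]; apply/sqintP; split; first exact: wcomp_meas.
under eq_integral do rewrite csq_sqrtM// EFinM.
by rewrite (transports_integral (nnmeas_csq mf)).
Qed.

(** Where the weight vanishes, [th] may send a set of positive measure into a null set. The
    alternative is harmless for [wcomp], since the factor [Num.sqrt (D z)] is then zero. *)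
Lemma transports_ae (P : set Z) : {ae M, forall z, P z} ->
  {ae M', forall z, D z = 0 \/ P (th z)}.
Proof.
move=> [N [mN N0 PN]].
have nN := nnmeas_indic R mN.
have : (\int[M']_z ((\1_N (th z))%:E * (D z)%:E) = 0)%E.
  by rewrite (transports_integral nN) integral_indic// setIT.
have [m1 p1] : nnmeas (fun z => (\1_N (th z))%:E * (D z)%:E)%E.
  by apply: nnmeasM; [exact: nnmeas_comp mth nN|exact: nnmeas_EFin].
rewrite (eq_integral (fun z => `|(\1_N (th z))%:E * (D z)%:E|%E)); last first.
  by move=> z _; rewrite gee0_abs.
move=> /(ae_eq_integral_abs M' measurableT m1).
apply: filterS => z /(_ I) /=; rewrite indicE.
have [Nz|Nz] := boolP (th z \in N); first by rewrite mul1e => -[]; left.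
move=> _; right; apply: contrapT => nP; move/negP: Nz; apply; rewrite inE; exact: PN.
Qed.

Lemma wcomp_ae (f g : Z -> R[i]) : {ae M, forall z, f z = g z} ->
  {ae M', forall z, (Num.sqrt (D z))%:C * f (th z) = (Num.sqrt (D z))%:C * g (th z)}.
Proof.
by move=> /transports_ae; apply: filterS => z [->|->//]; rewrite sqrtr0 !mul0r.
Qed.

Lemma wcomp_fun xi :
  {ae M', forall z, L2fun (wcomp xi) z = (Num.sqrt (D z))%:C * L2fun xi (th z)}.
Proof. by apply: L2fun_cls; apply: wcomp_sqint; exact: L2fun_sqint. Qed.

Lemma wcomp_cls f : f \in sqint M ->
  {ae M', forall z, L2fun (wcomp (L2cls M f)) z = (Num.sqrt (D z))%:C * f (th z)}.
Proof.
move=> fP; have := wcomp_ae (L2fun_cls fP).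
by apply: filterS2 (wcomp_fun (L2cls M f)) => z -> ->.
Qed.

Lemma wcomp_linear : linear wcomp.
Proof.
move=> a xi eta; apply: L2_eq.
have A := wcomp_ae (L2funD (a *: xi) eta); have B := wcomp_ae (L2funZ a xi).
have C := L2funD (a *: wcomp xi) (wcomp eta); have E := L2funZ a (wcomp xi).
have F := wcomp_fun xi; have G := wcomp_fun eta; have H := wcomp_fun (a *: xi + eta).
near=> z.
have -> : L2fun (wcomp (a *: xi + eta)) z = (Num.sqrt (D z))%:C * L2fun (a *: xi + eta) (th z).
  by near: z.
have -> : (Num.sqrt (D z))%:C * L2fun (a *: xi + eta) (th z) =
  (Num.sqrt (D z))%:C * (L2fun (a *: xi) (th z) + L2fun eta (th z)) by near: z.
have -> : L2fun (a *: wcomp xi + wcomp eta) z = L2fun (a *: wcomp xi) z + L2fun (wcomp eta) z.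
  by near: z.
have -> : L2fun (a *: wcomp xi) z = a * L2fun (wcomp xi) z by near: z.
have -> : L2fun (wcomp xi) z = (Num.sqrt (D z))%:C * L2fun xi (th z) by near: z.
have -> : L2fun (wcomp eta) z = (Num.sqrt (D z))%:C * L2fun eta (th z) by near: z.
rewrite mulrDr mulrCA; congr (_ + _).
by near: z.
Unshelve. all: by end_near. Qed.

Lemma wcomp_ip xi eta : ip (wcomp xi) (wcomp eta) = ip xi eta.
Proof.
have cE : cmeas (fun x => L2fun xi x * (L2fun eta x)^*).
  by apply: cmeasM; [|apply: cmeas_conj]; exact: L2fun_meas.
have ci := sqint_cintegrable (L2fun_sqint xi) (L2fun_sqint eta).
have Tc : chg M' D th M (cst 1) by case: T.
have eE : (fun y => L2fun xi y * (L2fun eta y)^* * (cst 1 y)%:C) =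
   (fun x => L2fun xi x * (L2fun eta x)^*) by apply/funext => y; rewrite mulr1.
have [|ci' E] := chg_cint mD D0 (measurable_cst (1 : R)) (fun=> ler01) mth Tc cE.
  by rewrite eE.
rewrite eE in E.
rewrite !L2ipE -E; apply: eq_cint => //.
  by apply: sqint_cintegrable; exact: L2fun_sqint.
apply: filterS2 (wcomp_fun xi) (wcomp_fun eta) => z -> ->.
rewrite -[in RHS](sqr_sqrtr (D0 z)) expr2 rmorphM.
move: (Num.sqrt (D z)) (L2fun xi (th z)) (L2fun eta (th z)) => c [a1 b1] [a2 b2].
by congr (_ +i* _) => /=; ring.
Qed.

Lemma wcomp_bounded : bounded_linear wcomp.
Proof.
by split; [exact: wcomp_linear|exists 1 => u; rewrite wcomp_ip mul1r].
Qed.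

Lemma wcomp_unitary (thi : Z -> Z') : measurable_fun setT thi ->
  {ae M', forall z, thi (th z) = z} -> {ae M', forall z, 0 < D z} -> unitary wcomp.
Proof.
move=> mthi thiK Dgt0; split; [exact: wcomp_linear|exact: wcomp_ip|move=> v].
(* The preimage of [v]: composition with the left inverse, divided by the square root of the weight.
   It is square-integrable because its norm, transported by [th], is that of [v]. *)
pose f z := (Num.sqrt (D (thi z)))^-1%:C * L2fun v (thi z).
have mf : cmeas f.
  apply: (cmeas_comp mthi (f := fun z => (Num.sqrt (D z))^-1%:C * L2fun v z)).
  apply: cmeasM; last exact: L2fun_meas.
  apply: cmeas_real; apply: measurable_fun_inv => [|z]; last exact: sqrtr_ge0.
  by apply: measurableT_comp => //; exact: measurable_sqrtr.
have fv : {ae M', forall z, (Num.sqrt (D z))%:C * f (th z) = L2fun v z}.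
  apply: filterS2 thiK Dgt0 => z zK Dz; rewrite /f zK mulrA -rmorphM /= divff ?mul1r//.
  by rewrite gt_eqF// sqrtr_gt0.
have fP : f \in sqint M.
  apply/sqintP; split=> //; rewrite -(transports_integral (nnmeas_csq mf)).
  apply: le_lt_trans (nrm2_fin v); rewrite le_eqVlt; apply/orP; left; apply/eqP.
  apply: ae_eq_integral => //.
  - have [] // : nnmeas (fun z => (csq (f (th z)))%:E * (D z)%:E)%E.
    apply: nnmeasM; last exact: nnmeas_EFin.
    by apply: (nnmeas_csq (f := f \o th)); exact: cmeas_comp.
  - by have [] := nnmeas_csq (L2fun_meas v).
  - by apply: filterS fv => z <- _; rewrite csq_sqrtM// EFinM.
exists (L2cls M f); apply: L2_eq.
by apply: filterS2 (wcomp_cls fP) fv => z -> ->.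
Qed.

End WeightedComposition.

(** * Multiplication by essentially bounded functions *)

Section Multiplication.
Context d (T : measurableType d) (R : realType) (mu : {measure set T -> \bar R}).
Implicit Types (h : T -> R[i]) (xi : L2 mu).

Definition mulop h xi : L2 mu := L2cls mu (fun x => h x * L2fun xi x).

Definition essbounded h := cmeas h /\ exists C : R, {ae mu, forall x, csq (h x) <= C}.

Lemma essbounded_sqint h f : essbounded h -> f \in sqint mu ->
  (fun x => h x * f x) \in sqint mu.
Proof.
move=> [mh [C hC]] /sqintP[mf foo]; apply/sqintP; split; first exact: cmeasM.
apply: (@le_lt_trans _ _ (\int[mu]_x (`|C|%:E * (csq (f x))%:E))%E).
  apply: ae_ge0_le_integral => //.
  - by move=> x _; rewrite lee_fin csq_ge0.
  - by have [] := nnmeas_csq (cmeasM mh mf).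
  - by move=> x _; rewrite mule_ge0 ?lee_fin ?csq_ge0.
  - by apply: emeasurable_funM; [exact: measurable_cst|have [] := nnmeas_csq mf].
  - apply: filterS hC => x hC _; rewrite -EFinM lee_fin csqM ler_wpM2r ?csq_ge0//.
    by rewrite (le_trans hC)// ler_norm.
have [n1 p1] := nnmeas_csq mf.
by rewrite ge0_integralZl ?lee_fin// lte_mul_pinfty ?lee_fin.
Qed.

Lemma mulop_fun h xi : essbounded h ->
  {ae mu, forall x, L2fun (mulop h xi) x = h x * L2fun xi x}.
Proof. by move=> hb; apply: L2fun_cls; apply: essbounded_sqint => //; exact: L2fun_sqint. Qed.

Lemma mulop_linear h : essbounded h -> linear (mulop h).
Proof.
move=> hb a xi eta; apply: L2_eq.
have A := L2funD (a *: xi) eta; have B := L2funZ a xi.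
have C := L2funD (a *: mulop h xi) (mulop h eta); have E := L2funZ a (mulop h xi).
have F := mulop_fun xi hb; have G := mulop_fun eta hb; have H := mulop_fun (a *: xi + eta) hb.
near=> z.
have -> : L2fun (mulop h (a *: xi + eta)) z = h z * L2fun (a *: xi + eta) z by near: z.
have -> : L2fun (a *: xi + eta) z = L2fun (a *: xi) z + L2fun eta z by near: z.
have -> : L2fun (a *: mulop h xi + mulop h eta) z =
  L2fun (a *: mulop h xi) z + L2fun (mulop h eta) z by near: z.
have -> : L2fun (a *: mulop h xi) z = a * L2fun (mulop h xi) z by near: z.
have -> : L2fun (mulop h xi) z = h z * L2fun xi z by near: z.
have -> : L2fun (mulop h eta) z = h z * L2fun eta z by near: z.
have -> : L2fun (a *: xi) z = a * L2fun xi z by near: z.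
by rewrite mulrDr mulrCA.
Unshelve. all: by end_near. Qed.

Lemma mulop_bounded h : essbounded h -> bounded_linear (mulop h).
Proof.
move=> hb; split; first exact: mulop_linear.
have [mh [C hC]] := hb; exists `|C|%:C => xi.
rewrite !ip_nrm2 -rmorphM lecR -lee_fin EFinM !nrm2E.
have [n1 p1] := nnmeas_csq (L2fun_meas xi).
rewrite -ge0_integralZl ?lee_fin//.
apply: ae_ge0_le_integral => //.
- by move=> x _; rewrite lee_fin csq_ge0.
- by have [] := nnmeas_csq (L2fun_meas (mulop h xi)).
- by move=> x _; rewrite mule_ge0 ?lee_fin ?csq_ge0.
- by apply: emeasurable_funM => //; exact: measurable_cst.
- apply: filterS2 hC (mulop_fun xi hb) => x hC -> _.
  by rewrite -EFinM lee_fin csqM ler_wpM2r ?csq_ge0// (le_trans hC)// ler_norm.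
Qed.

End Multiplication.

(** * Densities and fibre products of measures *)

(** The bare measures are repackaged with the finiteness structures that the library theorem
    expects; the derivative is finite everywhere and can be taken with real values. *)
Lemma radon_nikodym_real d (T : measurableType d) (R : realType)
    (mu nu : {measure set T -> \bar R}) :
  sigma_finite setT mu -> (nu setT < +oo)%E ->
  (forall A, measurable A -> mu A = 0%E -> nu A = 0%E) ->
  exists f : T -> R, [/\ measurable_fun setT f, forall x, 0 <= f x &
    forall A, measurable A -> nu A = (\int[mu]_(x in A) (f x)%:E)%E].
Proof.
move=> smu fnu ac.
have fnu' : fin_num_fun nu.
  move=> A mA; rewrite ge0_fin_numE//; apply: le_lt_trans fnu.
  by apply: le_measure; rewrite ?inE.
have snu : sigma_finite setT nu by apply: fin_num_fun_sigma_finite => //; rewrite measure0.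
pose mu' := HB.pack_for (SigmaFiniteMeasure.type T R) (Measure.sort mu)
  (isSFinite.Build _ _ _ _ (sfinite_measure_sigma_finite smu))
  (isSigmaFinite.Build _ _ _ _ smu).
pose nu' := HB.pack_for (FiniteMeasure.type T R) (Measure.sort nu)
  (isFinite.Build _ _ _ _ fnu')
  (isSFinite.Build _ _ _ _ (sfinite_measure_sigma_finite snu))
  (isSigmaFinite.Build _ _ _ _ snu).
have numu : nu' `<< mu'.
  by move=> A A0 B mB BA; apply: (ac _ mB); exact: (A0 B mB BA).
have [f [f0 ffin /integrableP[mf _] fE]] := radon_nikodym_sigma_finite numu.
exists (fine \o f); split.
- by apply: measurableT_comp mf; exact: fine_measurable.
- by move=> x; exact: fine_ge0.
- by move=> A mA; rewrite [LHS]fE//; apply: eq_integral => x _ /=; rewrite fineK.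
Qed.

Section Legs.
Context d (X : measurableType d) (R : realType) (nu : {measure set X -> \bar R}).
Hypothesis snu : sigma_finite setT nu.

(** The last clause says that [i] is nonsingular, so that functions on [X] defined up to null sets
    can be composed with [i]; this is what makes [L^infty(X, nu)] act. *)
Definition leg dY (Y : measurableType dY) (rho : {measure set Y -> \bar R}) (i : Y -> X) :=
  [/\ measurable_fun setT i, sigma_finite setT rho
    & forall A, measurable A -> nu A = 0%E -> rho (i @^-1` A) = 0%E].

Definition density dY (Y : measurableType dY) (rho : {measure set Y -> \bar R})
    (i : Y -> X) (f : Y -> R) (phi : X -> R) :=
  [/\ measurable_fun setT phi, forall x, 0 <= phi x & chg rho f i nu phi].

(* The image under i of f.rho is at most k.nu. *)
Definition bounded_density dY (Y : measurableType dY) (rho : {measure set Y -> \bar R})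
    (i : Y -> X) (f : Y -> R) (k : R) :=
  forall F, nnmeas F -> (\int[rho]_y (F (i y) * (f y)%:E) <= k%:E * \int[nu]_x F x)%E.

Section OneLeg.
Context dY (Y : measurableType dY) (rho : {measure set Y -> \bar R}) (i : Y -> X).
Hypothesis L : leg rho i.

Let mi : measurable_fun setT i. Proof. by case: L. Qed.

Lemma leg_ae (P : set X) : {ae nu, forall x, P x} -> {ae rho, forall y, P (i y)}.
Proof.
move=> [N [mN N0 PN]]; exists (i @^-1` N); split.
- by rewrite -[X in measurable X]setTI; exact: mi.
- by case: L => _ _; apply.
- by move=> y; apply: PN.
Qed.

(** The image under [i] of the measure with density [f] is realised as a mixture of Dirac masses at
    [i y] with weight [f y]; it is finite, and absolutely continuous because [i] is a leg. *)
Lemma density_ex (f : Y -> R) : measurable_fun setT f -> (forall y, 0 <= f y) ->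
  (\int[rho]_y (f y)%:E < +oo)%E -> exists phi, density rho i f phi.
Proof.
move=> mf f0 foo.
pose K y : {measure set X -> \bar R} := mscale (NngNum (f0 y)) (dirac (i y)).
have KE y F : nnmeas F -> (\int[K y]_x F x = F (i y) * (f y)%:E)%E.
  move=> [mF F0]; rewrite ge0_integral_mscale//= integral_dirac// diracT mul1e.
  by rewrite muleC.
have mK : measurable_family K.
  move=> F nF; under eq_fun do rewrite KE//.
  have [] // := nnmeasM (nnmeas_comp mi nF) (nnmeas_EFin mf f0).
have mE A : measurable A -> (mixm rho mK A = \int[rho]_y ((\1_A (i y))%:E * (f y)%:E))%E.
  move=> mA; apply: eq_integral => y _.
  by rewrite -(KE _ _ (nnmeas_indic R mA)) integral_indic// setIT.
have [||phi [mphi phi0 phiE]] := radon_nikodym_real snu _ _ (nu := mixm rho mK).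
- rewrite mE//; apply: le_lt_trans foo; apply: le_nnmeas_integral.
  + apply: nnmeasM; last exact: nnmeas_EFin.
    exact: nnmeas_comp mi (nnmeas_indic R measurableT).
  + exact: nnmeas_EFin.
  + by move=> y; rewrite indicT mul1e.
- move=> A mA A0; rewrite mE//; transitivity (\int[rho]_y (0 : \bar R))%E; last by rewrite integral0.
  have [m1 _] := nnmeasM (nnmeas_comp mi (nnmeas_indic R mA)) (nnmeas_EFin mf f0).
  apply: ae_eq_integral => //; exists (i @^-1` A); split.
  + by rewrite -[X in measurable X]setTI; exact: mi.
  + by case: L => _ _; apply.
  + move=> y /= nA; apply: contrapT => Ay; apply: nA => _.
    by rewrite indicE memNset ?mul0e.
exists phi; split=> //.
apply: (@chg_set _ _ _ _ _ _ _ _ _ _ mf f0 mphi phi0 mi (fun=> setT)) => //.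
- by rewrite bigcup_const//; exists 0%N.
- move=> _ B mB; rewrite setIT -mE// phiE//.
  by rewrite integral_mkcond; apply: eq_integral => x _; rewrite epatch_indic muleC.
Qed.

Lemma density_indic (B : set Y) : measurable B -> (rho B < +oo)%E ->
  exists phi, density rho i \1_B phi.
Proof. by move=> mB Boo; apply: density_ex => //; rewrite integral_indic// setIT. Qed.

(** The supply of left bounded vectors: the indicator functions of subsets of the [A n] are
    square-integrable and have bounded density, which is what the density of elementary tensors
    rests on. *)
Lemma leg_cover : exists (A : (set Y)^nat) (k : nat -> R),
  [/\ forall n, measurable (A n), nondecreasing_seq A, \bigcup_n A n = setT,
      forall n, (rho (A n) < +oo)%E
    & forall n, 0 <= k n /\ bounded_density rho i \1_(A n) (k n)].
Proof.
have [_ /sigma_finiteP[S [ST ndS /all_and2[mS Soo]]] _] := L.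
have /choice[phi phiP] : forall j, exists phi, density rho i \1_(S j) phi.
  by move=> j; exact: (density_indic (mS j) (Soo j)).
pose T j n : set X := [set x | phi j x <= n%:R].
have mT j n : measurable (T j n).
  by rewrite -[X in measurable X]setTI; apply: measurable_fun_le => //; case: (phiP j).
(* The density [phi j] depends on [j], so cutting only [S n] where [phi n] is at most [n] would not
   be monotone in [n]; the union over j <= n is. It has n + 1 pieces of density at most [n] each,
   whence the bound [k n]. *)
pose A n := \bigcup_(j in `I_n.+1) (S j `&` i @^-1` T j n).
have mA n : measurable (A n).
  apply: bigcup_measurable => j _; apply: measurableI => //.
  by rewrite -[X in measurable X]setTI; exact: mi.
exists A, (fun n => \sum_(j < n.+1) n%:R); split => //.
- move=> m n mn; apply/subsetPset => y [j /= jm [Sy Ty]].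
  exists j; first by rewrite /= (leq_trans jm).
  by split => //; rewrite /T /= (le_trans Ty)// ler_nat.
- rewrite -subTset => y _; have [j _ Sj] : (\bigcup_j S j) y by rewrite -ST.
  pose n := maxn j (Num.truncn (phi j (i y))).+1.
  exists n => //; exists j; first by rewrite /= ltnS leq_maxl.
  by split => //; rewrite /T /= (le_trans (ltW (truncnS_gt _)))// ler_nat leq_maxr.
- move=> n; apply: le_lt_trans (Soo n); apply: le_measure; rewrite ?inE//.
  move=> y [j /= jn [Sy _]]; move: Sy; apply/subsetPset; exact: ndS.
- move=> n; split; first exact: sumr_ge0.
  move=> F nF; have F0 := nF.2.
  have n1 j : nnmeas (fun x => (F x * (\1_(T j n) x)%:E)%E).
    by apply: nnmeasM => //; exact: nnmeas_indic.
  have n2 j : nnmeas (fun y => F (i y) * (\1_(T j n) (i y))%:E * (\1_(S j) y)%:E)%E.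
    by apply: nnmeasM; [exact: nnmeas_comp mi (n1 j)|exact: nnmeas_indic].
  apply: (@le_trans _ _ (\int[rho]_y \sum_(j < n.+1)
      (F (i y) * (\1_(T j n) (i y))%:E * (\1_(S j) y)%:E))%E).
    apply: ge0_le_integral => //.
    + by move=> y _; rewrite mule_ge0 ?lee_fin.
    + by have [] := nnmeasM (nnmeas_comp mi nF) (nnmeas_indic R (mA n)).
    + by apply: emeasurable_sum => j _; exact: (n2 j).1.
    + move=> y _; have [Ay|Ay] := boolP (y \in A n); last first.
        rewrite indicE (negbTE Ay) mule0; apply: sume_ge0 => j _; exact: (n2 j).2.
      move: (Ay); rewrite inE => -[j /= jn [Sy Ty]].
      rewrite (bigD1 (Ordinal jn))//= !indicE Ay !mem_set//= !mule1 leeDl//.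
      by apply: sume_ge0 => l _; exact: (n2 l).2.
  rewrite ge0_integral_sum//; last 2 first.
  + by move=> j; exact: (n2 j).1.
  + by move=> j y _; exact: (n2 j).2.
  rewrite -sumEFin ge0_sume_distrl => [|j _]; last by rewrite lee_fin.
  apply: lee_sum => j _; have [mphi phi0 phiE] := phiP j.
  rewrite (phiE _ (n1 j)) -(ge0_integralZl nu measurableT nF.1 (fun x _ => F0 x)) ?lee_fin//.
  apply: le_nnmeas_integral.
  + by apply: nnmeasM => //; exact: nnmeas_EFin.
  + by apply: nnmeasM => //; apply: nnmeas_cst; rewrite lee_fin.
  move=> x; rewrite indicE; have [Tx|_] := boolP (x \in T j n); last first.
    by rewrite mule0 mul0e mule_ge0 ?lee_fin.
  by rewrite mule1 muleC lee_wpmul2r ?lee_fin//; move: Tx; rewrite inE.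
Qed.

End OneLeg.
End Legs.

Section FibreProduct.
Context d (X : measurableType d) (R : realType) (nu : {measure set X -> \bar R}).

(* M is the fibre product of rho1 and rho2 over (X, nu); it is described by
   densities because rho1 and rho2 need not be given by disintegrations. *)
Definition fibprod d1 d2 dZ (Y1 : measurableType d1) (Y2 : measurableType d2)
    (Z : measurableType dZ) (rho1 : {measure set Y1 -> \bar R}) (i1 : Y1 -> X)
    (rho2 : {measure set Y2 -> \bar R}) (i2 : Y2 -> X)
    (M : {measure set Z -> \bar R}) (q1 : Z -> Y1) (q2 : Z -> Y2) :=
  [/\ measurable_fun setT q1, measurable_fun setT q2,
      exists q : Y1 * Y2 -> Z, measurable_fun setT q /\ forall z, q (q1 z, q2 z) = z
    & forall (f1 : Y1 -> R) (f2 : Y2 -> R) (phi1 phi2 : X -> R),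
        measurable_fun setT f1 -> (forall y, 0 <= f1 y) ->
        measurable_fun setT f2 -> (forall y, 0 <= f2 y) ->
        density nu rho1 i1 f1 phi1 -> density nu rho2 i2 f2 phi2 ->
        (\int[M]_z (f1 (q1 z) * f2 (q2 z))%:E = \int[nu]_x (phi1 x * phi2 x)%:E)%E].

Lemma fibprod_sym d1 d2 dZ (Y1 : measurableType d1) (Y2 : measurableType d2)
    (Z : measurableType dZ) (rho1 : {measure set Y1 -> \bar R}) (i1 : Y1 -> X)
    (rho2 : {measure set Y2 -> \bar R}) (i2 : Y2 -> X)
    (M : {measure set Z -> \bar R}) (q1 : Z -> Y1) (q2 : Z -> Y2) :
  fibprod rho1 i1 rho2 i2 M q1 q2 -> fibprod rho2 i2 rho1 i1 M q2 q1.
Proof.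
move=> [mq1 mq2 [q [mq qK]] H]; split => //.
  exists (q \o (fun y => (y.2, y.1))); split; last by move=> z; rewrite /= qK.
  apply: measurableT_comp => //; by apply: measurable_fun_pair; [exact: measurable_snd|exact: measurable_fst].
move=> f1 f2 phi1 phi2 mf1 f10 mf2 f20 d1' d2'.
under eq_integral do rewrite mulrC.
by under [RHS]eq_integral do rewrite mulrC; exact: H.
Qed.

Hypothesis snu : sigma_finite setT nu.
Context d1 d2 dZ (Y1 : measurableType d1) (Y2 : measurableType d2) (Z : measurableType dZ).
Context (rho1 : {measure set Y1 -> \bar R}) (i1 : Y1 -> X).
Context (rho2 : {measure set Y2 -> \bar R}) (i2 : Y2 -> X).
Context (M : {measure set Z -> \bar R}) (q1 : Z -> Y1) (q2 : Z -> Y2).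
Hypotheses (lg1 : leg nu rho1 i1) (lg2 : leg nu rho2 i2).
Hypothesis P : fibprod rho1 i1 rho2 i2 M q1 q2.

Let mq1 : measurable_fun setT q1. Proof. by case: P. Qed.
Let mq2 : measurable_fun setT q2. Proof. by case: P. Qed.
Let mi1 : measurable_fun setT i1. Proof. by case: lg1. Qed.
Let mi2 : measurable_fun setT i2. Proof. by case: lg2. Qed.

(** Weighting the second leg by [f2] and projecting to the first leaves the density of [f2] over
    [nu], read through [i1]. The definition only compares pairs with densities, so it is applied to
    indicator functions of sets of finite measure. *)
Lemma fibprod_chg (f2 : Y2 -> R) (psi : X -> R) : measurable_fun setT f2 -> (forall y, 0 <= f2 y) ->
  density nu rho2 i2 f2 psi -> chg M (f2 \o q2) q1 rho1 (psi \o i1).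
Proof.
move=> mf2 f20 D2; have [mpsi psi0 _] := D2.
have [_ /sigma_finiteP[S [ST ndS /all_and2[mS Soo]]] _] := lg1.
have f2q0 z : 0 <= (f2 \o q2) z by exact: f20.
have psi1 y : 0 <= (psi \o i1) y by exact: psi0.
apply: (chg_set (measurableT_comp mf2 mq2) f2q0 (measurableT_comp mpsi mi1) psi1 mq1 mS) => //.
move=> n B mB; have mBS : measurable (B `&` S n) by exact: measurableI.
have [|phi1 D1] := density_indic snu lg1 mBS.
  apply: le_lt_trans (Soo n).
  by apply: le_measure; rewrite ?inE//; exact: subIsetr.
have [_ _ _ H] := P.
under eq_integral do rewrite -EFinM /=.
rewrite (H _ _ _ _ _ _ mf2 f20 D1 D2)//.
have [_ _ C1] := D1.
have := C1 _ (nnmeas_EFin mpsi psi0).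
under [RHS]eq_integral do rewrite /= -EFinM mulrC.
by move=> <-; apply: eq_integral => y _; rewrite muleC.
Qed.

(** Cut by a set of finite measure on the second leg, the preimage of [N] has as measure the
    integral over [N] of a density, hence zero; countably many such pieces cover it. *)
Lemma fibprod_null1 N : measurable N -> rho1 N = 0%E -> M (q1 @^-1` N) = 0%E.
Proof.
move=> mN N0; have [_ /sigma_finiteP[S [ST ndS /all_and2[mS Soo]]] _] := lg2.
have mqN : measurable (q1 @^-1` N) by rewrite -[X in measurable X]setTI; exact: mq1.
have mqS n : measurable (q2 @^-1` S n) by rewrite -[X in measurable X]setTI; exact: mq2.
have SN n : M (q1 @^-1` N `&` q2 @^-1` S n) = 0%E.
  have [psi D2] := density_indic snu lg2 (mS n) (Soo n).
  have := @fibprod_chg \1_(S n) psi _ _ D2 _ (nnmeas_indic R mN).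
  rewrite (_ : (\int[M]_z _)%E = M (q1 @^-1` N `&` q2 @^-1` S n)).
    move=> -> //.
    have [mpsi psi0 _] := D2.
    have [m1 p1] := nnmeasM (nnmeas_indic R mN) (nnmeas_comp mi1 (nnmeas_EFin mpsi psi0)).
    transitivity (\int[rho1]_y (0 : \bar R))%E; last by rewrite integral0.
    apply: ae_eq_integral => //; exists N; split => //.
    move=> y /= nA; apply: contrapT => Ny; apply: nA => _.
    by rewrite indicE memNset ?mul0e.
  rewrite -[X in _ = M X]setIT -integral_indic//; last exact: measurableI.
  apply: eq_integral => z _; rewrite -EFinM; congr EFin.
  by rewrite !indicE in_setI /= -natrM mulnb.
apply/eqP; rewrite eq_le measure_ge0 andbT.
have -> : q1 @^-1` N = \bigcup_n (q1 @^-1` N `&` q2 @^-1` S n).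
  rewrite -setI_bigcupr -preimage_bigcup -ST.
  by rewrite preimage_setT setIT.
apply: (@le_trans _ _ (\sum_(n <oo) M (q1 @^-1` N `&` q2 @^-1` S n))%E).
  apply: generalized_Boole_inequality => [n|]; first exact: measurableI.
  by apply: bigcup_measurable => n _; exact: measurableI.
by rewrite eseries0.
Qed.

(** On a product of [A n] and [S n], the measure is at most [k n] times the measure of [S n]. Finite
    measure on both factors would not suffice, hence the bounded densities of [leg_cover]. *)
Lemma fibprod_sigma_finite : sigma_finite setT M.
Proof.
have [A [k [mA ndA AT Aoo /all_and2[k0 Ak]]]] := leg_cover snu lg1.
have [_ /sigma_finiteP[S [ST ndS /all_and2[mS Soo]]] _] := lg2.
exists (fun n => q1 @^-1` A n `&` q2 @^-1` S n).
  apply/esym; rewrite -subTset => z _.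
  have [n _ An] : (\bigcup_n A n) (q1 z) by rewrite AT.
  have [l _ Sl] : (\bigcup_n S n) (q2 z) by rewrite -ST.
  exists (maxn n l) => //; split.
    have /subsetPset := ndA _ _ (leq_maxl n l); exact.
  have /subsetPset := ndS _ _ (leq_maxr n l); exact.
have mqA n : measurable (q1 @^-1` A n) by rewrite -[X in measurable X]setTI; exact: mq1.
have mqS n : measurable (q2 @^-1` S n) by rewrite -[X in measurable X]setTI; exact: mq2.
move=> n; split; first exact: measurableI.
have [psi D2] := density_indic snu lg2 (mS n) (Soo n).
have [mpsi psi0 C2] := D2.
have := @fibprod_chg \1_(S n) psi _ _ D2 _ (nnmeas_indic R (mA n)).
rewrite (_ : (\int[M]_z _)%E = M (q1 @^-1` A n `&` q2 @^-1` S n)).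
  move=> -> //.
  have := Ak n _ (nnmeas_EFin mpsi psi0).
  under eq_integral do rewrite muleC /=.
  move=> /le_lt_trans; apply.
  rewrite lte_mul_pinfty ?lee_fin//.
  have := C2 _ (nnmeas_cst _ (@lee01 R)).
  under [RHS]eq_integral do rewrite mul1e.
  move=> <-; under eq_integral do rewrite mul1e.
  by rewrite integral_indic// setIT; exact: Soo.
rewrite -[X in _ = M X]setIT -integral_indic//; last exact: measurableI.
apply: eq_integral => z _; rewrite -EFinM; congr EFin.
by rewrite !indicE in_setI /= -natrM mulnb.
Qed.

End FibreProduct.

(** * Density in square-integrable functions *)

Section Closure.
Context d (Z : measurableType d) (R : realType) (M : {measure set Z -> \bar R}).
Implicit Types (A : set (L2 M)) (u v : L2 M).

Lemma nrm2Z a u : nrm2 (a *: u) = csq a * nrm2 u.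
Proof.
apply: EFin_inj; rewrite EFinM !nrm2E.
have [m1 p1] := nnmeas_csq (L2fun_meas u).
rewrite -ge0_integralZl ?lee_fin ?csq_ge0//; apply: ae_eq_integral => //.
- by have [] := nnmeas_csq (L2fun_meas (a *: u)).
- by apply: emeasurable_funM => //; exact: measurable_cst.
- by apply: filterS (L2funZ a u) => z -> _; rewrite csqM.
Qed.

Lemma nrm2D_le u v : nrm2 (u + v) <= 2 * nrm2 u + 2 * nrm2 v.
Proof.
rewrite -lee_fin EFinD !EFinM !nrm2E.
have n1 := nnmeas_csq (L2fun_meas u); have n2 := nnmeas_csq (L2fun_meas v).
have two : nnmeas (fun _ : Z => (2%:E : \bar R)) by exact: nnmeas_cst.
have [[m1 p1] [m2 p2]] := (nnmeasM two n1, nnmeasM two n2).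
rewrite -!ge0_integralZl ?n1.1 ?n2.1//; [|exact: n2.1|by move=> x _; exact: n2.2|exact: n1.1|by move=> x _; exact: n1.2].
rewrite -ge0_integralD//; apply: ae_ge0_le_integral => //.
- by move=> x _; rewrite lee_fin csq_ge0.
- by have [] := nnmeas_csq (L2fun_meas (u + v)).
- by move=> x _; exact: adde_ge0.
- exact: emeasurable_funD.
- by apply: filterS (L2funD u v) => z -> _; rewrite -!EFinM -EFinD lee_fin csqD_le.
Qed.

Definition lincomb A : set (L2 M) := [set v | exists n (a : 'I_n -> R[i]) (w : 'I_n -> L2 M),
  (forall k, A (w k)) /\ v = \sum_k a k *: w k].

Definition l2closure A : set (L2 M) :=
  [set u | forall e : R, 0 < e -> exists2 v, lincomb A v & nrm2 (u - v) < e].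

Lemma lincombD A u v : lincomb A u -> lincomb A v -> lincomb A (u + v).
Proof.
move=> [n [a [w [Aw ->]]]] [m [b [x [Ax ->]]]].
exists (n + m)%N, (fun k => match fintype.split k with inl i => a i | inr j => b j end),
  (fun k => match fintype.split k with inl i => w i | inr j => x j end).
split; first by move=> k; case: (fintype.split k).
rewrite big_split_ord; congr (_ + _); apply: eq_bigr => k _ /=.
  by rewrite (unsplitK (inl k)).
by rewrite (unsplitK (inr k)).
Qed.

Lemma lincombZ A c u : lincomb A u -> lincomb A (c *: u).
Proof.
move=> [n [a [w [Aw ->]]]]; exists n, (fun k => c * a k), w; split => //.
by rewrite scaler_sumr; apply: eq_bigr => k _; rewrite scalerA.
Qed.

Lemma l2closure_lim A u :
  (forall e : R, 0 < e -> exists2 v, l2closure A v & nrm2 (u - v) < e) -> l2closure A u.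
Proof.
move=> H e e0; have [|v Av uv] := H (e / 4); first by rewrite divr_gt0.
have [|w Aw vw] := Av (e / 4); first by rewrite divr_gt0.
exists w => //; rewrite (_ : u - w = (u - v) + (v - w)); last by rewrite addrA subrK.
by apply: le_lt_trans (nrm2D_le _ _) _; lra.
Qed.

Lemma l2closureD A u v : l2closure A u -> l2closure A v -> l2closure A (u + v).
Proof.
move=> Au Av e e0; have [|w Aw uw] := Au (e / 4); first by rewrite divr_gt0.
have [|x Ax vx] := Av (e / 4); first by rewrite divr_gt0.
exists (w + x); first exact: lincombD.
rewrite (_ : _ - _ = (u - w) + (v - x)); last by rewrite opprD addrACA.
by apply: le_lt_trans (nrm2D_le _ _) _; lra.
Qed.

Lemma l2closureZ A c u : l2closure A u -> l2closure A (c *: u).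
Proof.
move=> Au e e0; have c0 : 0 < csq c + 1 by rewrite ltr_wpDl ?csq_ge0.
have [|w Aw uw] := Au (e / (csq c + 1)); first by rewrite divr_gt0.
exists (c *: w); first exact: lincombZ.
rewrite -scalerBr nrm2Z; apply: (@le_lt_trans _ _ ((csq c + 1) * nrm2 (u - w))).
  by rewrite ler_wpM2r ?nrm2_ge0// lerDl.
by rewrite mulrC -ltr_pdivlMr.
Qed.

Lemma sub_l2closure A : A `<=` l2closure A.
Proof.
move=> u Au e e0; exists u; last first.
  rewrite subrr -(scale0r (0 : L2 M)) nrm2Z /csq /= expr0n addr0 mul0r//.
exists 1%N, (fun=> 1), (fun=> u); split => //.
by rewrite big_ord1 scale1r.
Qed.

Lemma dense_span_l2closure A : (forall u, l2closure A u) -> dense_span A.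
Proof.
move=> H u e e0.
have [eE e0'] : e = (re e)%:C /\ 0 < re e.
  by move: e0; case: e => a b; rewrite ltcE /= => /andP[/eqP -> a0]; split.
have [_ [n [a [w [Aw ->]]]] uw] := H u _ e0'.
by exists n, a, w; split => //; rewrite ip_nrm2 eE ltcR.
Qed.

Definition rcls (h : Z -> R) : L2 M := L2cls M (fun z => (h z)%:C).

Lemma real_sqint (h : Z -> R) : measurable_fun setT h ->
  (\int[M]_z (h z ^+ 2)%:E < +oo)%E -> (fun z => (h z)%:C) \in sqint M.
Proof.
move=> mh hoo; apply/sqintP; split; first exact: cmeas_real.
by under eq_integral do rewrite csqR.
Qed.

Lemma indic_sqint (E : set Z) : measurable E -> (M E < +oo)%E ->
  (fun z => (\1_E z)%:C) \in sqint M.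
Proof.
move=> mE Eoo; apply: real_sqint => //.
have sq1 z : (\1_E z : R) ^+ 2 = \1_E z.
  by rewrite indicE; case: (z \in E); rewrite ?expr1n ?expr0n.
by under eq_integral do rewrite sq1; rewrite integral_indic// setIT.
Qed.

Lemma rcls_lin (h k : Z -> R) (c : R) :
  (fun z => (h z)%:C) \in sqint M -> (fun z => (k z)%:C) \in sqint M ->
  rcls (fun z => h z + c * k z) = rcls h + c%:C *: rcls k.
Proof.
move=> hP kP; have [/sqintP[mh _] /sqintP[mk _]] := (hP, kP).
rewrite -[RHS]L2cls_fun; apply: L2cls_eq.
- by apply: cmeas_real; apply: measurable_funD; [exact: mh.1|apply: measurable_funM => //; exact: mk.1].
- exact: L2fun_meas.
have A := L2funD (rcls h) (c%:C *: rcls k); have B := L2funZ c%:C (rcls k).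
have C := L2fun_cls hP; have E := L2fun_cls kP.
near=> z.
have -> : L2fun (rcls h + c%:C *: rcls k) z = L2fun (rcls h) z + L2fun (c%:C *: rcls k) z by near: z.
have -> : L2fun (c%:C *: rcls k) z = c%:C * L2fun (rcls k) z by near: z.
have -> : L2fun (rcls h) z = (h z)%:C by near: z.
have -> : L2fun (rcls k) z = (k z)%:C by near: z.
by rewrite rmorphD rmorphM.
Unshelve. all: by end_near. Qed.

Lemma nrm2_rclsB (h k : Z -> R) :
  (fun z => (h z)%:C) \in sqint M -> (fun z => (k z)%:C) \in sqint M ->
  (nrm2 (rcls h - rcls k))%:E = (\int[M]_z ((h z - k z) ^+ 2)%:E)%E.
Proof.
move=> hP kP; rewrite nrm2B//; have [/sqintP[mh _] /sqintP[mk _]] := (hP, kP).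
apply: ae_eq_integral => //.
- have := cmeasD mh (cmeasM (cmeas_cst _ (-1)) (L2fun_meas (rcls k))).
  by move=> /nnmeas_csq[+ _]; congr measurable_fun; apply/funext => x; rewrite mulN1r.
- apply: (nnmeas_sqr _).1; apply: measurable_funB; [exact: mh.1|exact: mk.1].
- by apply: filterS (L2fun_cls kP) => z -> _; rewrite -rmorphB csqR.
Qed.

Lemma rcls_cvg (h : Z -> R) (h_ : nat -> Z -> R) :
  (fun z => (h z)%:C) \in sqint M -> (forall n, measurable_fun setT (h_ n)) ->
  (forall n z, 0 <= h_ n z <= h z) ->
  (forall z, h_ n z @[n --> \oo] --> h z) ->
  (forall n, (fun z => (h_ n z)%:C) \in sqint M) /\
  forall e : R, 0 < e -> exists n, nrm2 (rcls h - rcls (h_ n)) < e.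
Proof.
move=> hP mh_ h_h cvgh; have /sqintP[[mh _] hoo] := hP.
have h_P n : (fun z => (h_ n z)%:C) \in sqint M.
  apply: sqint_le hP _; first exact: cmeas_real.
  move=> z; have /andP[h0 hh] := h_h n z; rewrite !csqR.
  by rewrite ler_pXn2r// ?nnegrE// (le_trans h0).
split => // e e0.
have ndom : M.-integrable setT (EFin \o (csq \o (fun z => (h z)%:C))).
  exact: sqint_csq_integrable.
have mB n : measurable_fun setT (fun z => ((h z - h_ n z) ^+ 2)%:E).
  by apply: (nnmeas_sqr _).1; apply: measurable_funB.
have cvg0 : (\int[M]_z ((h z - h_ n z) ^+ 2)%:E)%E @[n --> \oo] --> (\int[M]_z (0 : \bar R))%E.
  apply: (dominated_cvg measurableT mB _ _ ndom) => //.
  - move=> z _; apply: cvg_EFin; first exact: nearW.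
    have : h z - h_ n z @[n --> \oo] --> 0.
      by rewrite -(subrr (h z)); apply: cvgB => //; exact: cvg_cst.
    move=> c0; rewrite -(mulr0 (0 : R)).
    rewrite (_ : _ \o _ = (fun n => (h z - h_ n z) * (h z - h_ n z))).
      exact: (cvgM c0 c0).
    by apply/funext => n; rewrite /= expr2.
  - move=> n z _; have /andP[h0 hh] := h_h n z.
    rewrite gee0_abs ?lee_fin ?sqr_ge0//= csqR ler_pXn2r// ?nnegrE ?subr_ge0//.
      by rewrite lerBlDr lerDl.
    exact: le_trans hh.
move: cvg0; rewrite integral0 => /fine_cvgP[_] /cvgrPdist_lt /(_ e e0)[n _ /(_ n (leqnn n))].
rewrite /= sub0r normrN => hn; exists n; rewrite -lte_fin nrm2_rclsB//.
move: hn; rewrite -(nrm2_rclsB hP (h_P n)) /= ger0_norm ?nrm2_ge0//.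
Qed.

Lemma rcls_decomp (f : Z -> R[i]) : f \in sqint M ->
  let p (h : R -> R) := rcls (fun z => Num.max (h (re (f z))) 0) in
  let q (h : R -> R) := rcls (fun z => Num.max (h (im (f z))) 0) in
  [/\ (fun z => (Num.max (re (f z)) 0)%:C) \in sqint M,
      (fun z => (Num.max (- re (f z)) 0)%:C) \in sqint M,
      (fun z => (Num.max (im (f z)) 0)%:C) \in sqint M,
      (fun z => (Num.max (- im (f z)) 0)%:C) \in sqint M &
  L2cls M f = (p id + (-1) *: p -%R) + 'i *: (q id + (-1) *: q -%R)].
Proof.
move=> fP p q; have /sqintP[mf _] := fP.
have sq0 (a : R) : Num.max a 0 ^+ 2 <= a ^+ 2.
  by have [a0|a0] := leP a 0; rewrite ?expr0n ?sqr_ge0.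
have P1 : (fun z => (Num.max (re (f z)) 0)%:C) \in sqint M.
  apply: sqint_le fP _ => [|z]; first exact/cmeas_real/measurable_maxr/measurable_cst/(mf.1).
  by rewrite csqR (le_trans (sq0 _))// lerDl sqr_ge0.
have P2 : (fun z => (Num.max (- re (f z)) 0)%:C) \in sqint M.
  apply: sqint_le fP _ => [|z].
    by apply/cmeas_real/measurable_maxr/measurable_cst; apply: measurable_funN; exact: mf.1.
  by rewrite csqR (le_trans (sq0 _))// sqrrN lerDl sqr_ge0.
have P3 : (fun z => (Num.max (im (f z)) 0)%:C) \in sqint M.
  apply: sqint_le fP _ => [|z]; first exact/cmeas_real/measurable_maxr/measurable_cst/(mf.2).
  by rewrite csqR (le_trans (sq0 _))// lerDr sqr_ge0.
have P4 : (fun z => (Num.max (- im (f z)) 0)%:C) \in sqint M.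
  apply: sqint_le fP _ => [|z].
    by apply/cmeas_real/measurable_maxr/measurable_cst; apply: measurable_funN; exact: mf.2.
  by rewrite csqR (le_trans (sq0 _))// sqrrN lerDr sqr_ge0.
split => //; apply: L2_eq.
have A := L2funD (p id + (-1) *: p -%R) ('i *: (q id + (-1) *: q -%R)).
have B := L2funD (p id) ((-1) *: p -%R).
have C := L2funZ 'i (q id + (-1) *: q -%R).
have D := L2funD (q id) ((-1) *: q -%R).
have E := L2funZ (-1) (p -%R); have F := L2funZ (-1) (q -%R).
have G1 := L2fun_cls P1; have G2 := L2fun_cls P2.
have G3 := L2fun_cls P3; have G4 := L2fun_cls P4; have H := L2fun_cls fP.
near=> z.
have -> : L2fun (L2cls M f) z = f z by near: z.
have -> : L2fun (p id + (-1) *: p -%R + 'i *: (q id + (-1) *: q -%R)) z =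
  L2fun (p id + (-1) *: p -%R) z + L2fun ('i *: (q id + (-1) *: q -%R)) z by near: z.
have -> : L2fun (p id + (-1) *: p -%R) z = L2fun (p id) z + L2fun ((-1) *: p -%R) z by near: z.
have -> : L2fun ((-1) *: p -%R) z = -1 * L2fun (p -%R) z by near: z.
have -> : L2fun ('i *: (q id + (-1) *: q -%R)) z = 'i * L2fun (q id + (-1) *: q -%R) z by near: z.
have -> : L2fun (q id + (-1) *: q -%R) z = L2fun (q id) z + L2fun ((-1) *: q -%R) z by near: z.
have -> : L2fun ((-1) *: q -%R) z = -1 * L2fun (q -%R) z by near: z.
have -> : L2fun (p id) z = (Num.max (re (f z)) 0)%:C by near: z.
have -> : L2fun (p -%R) z = (Num.max (- re (f z)) 0)%:C by near: z.
have -> : L2fun (q id) z = (Num.max (im (f z)) 0)%:C by near: z.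
have -> : L2fun (q -%R) z = (Num.max (- im (f z)) 0)%:C by near: z.
have mx (a : R) : Num.max a 0 - Num.max (- a) 0 = a.
  by have [a0|a0] := leP a 0; have [b0|b0] := leP (- a) 0; lra.
rewrite !mulN1r -!rmorphB /= !mx; case: (f z) => a b /=.
by congr (_ +i* _) => /=; ring.
Unshelve. all: by end_near. Qed.

(** The induction on nonnegative functions is run inside the closed span; all intermediate functions
    are dominated by a square-integrable one, so that [rcls_cvg] turns pointwise limits into limits
    in norm. *)
Lemma l2closure_total A (S : (set Z)^nat) : (forall n, measurable (S n)) ->
  nondecreasing_seq S -> \bigcup_n S n = setT ->
  (forall n E, measurable E -> l2closure A (rcls \1_(E `&` S n))) ->
  forall u, l2closure A u.
Proof.
move=> mS ndS ST H.
have clim (h : Z -> R) (h_ : nat -> Z -> R) :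
  (fun z => (h z)%:C) \in sqint M -> (forall n, measurable_fun setT (h_ n)) ->
  (forall n z, 0 <= h_ n z <= h z) -> (forall z, h_ n z @[n --> \oo] --> h z) ->
  (forall n, (fun z => (h_ n z)%:C) \in sqint M -> l2closure A (rcls (h_ n))) ->
  l2closure A (rcls h).
  move=> hP mh_ h_h ch clh; have [h_P conv] := rcls_cvg hP mh_ h_h ch.
  apply: l2closure_lim => e e0; have [n hn] := conv e e0.
  by exists (rcls (h_ n)) => //; exact: clh.
(* [nnmeas_ind] ranges over extended real functions, so the claim is made for every [F] that happens
   to come from a real square-integrable [h]. *)
have posP : forall F, nnmeas F -> forall h : Z -> R, F = EFin \o h ->
    (fun z => (h z)%:C) \in sqint M -> l2closure A (rcls h).
  have ext (F : Z -> \bar R) h z : F = EFin \o h -> F z = (h z)%:E by move=> ->.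
  apply: nnmeas_ind.
  - move=> E mE h hE hP.
    have -> : h = \1_E.
      by apply/funext => z; apply: EFin_inj; by rewrite -(ext _ _ z hE).
    apply: (clim _ (fun n => \1_(E `&` S n))) => //.
    + rewrite (_ : (fun _ => _) = (fun z => (h z)%:C))//; apply/funext => z.
      by congr (_%:C); apply: EFin_inj; by rewrite -(ext _ _ z hE).
    + by move=> n; apply: measurable_indic; exact: measurableI.
    + move=> n z; rewrite !indicE in_setI ler0n ler_nat.
      by case: (z \in E); case: (z \in S n).
    + move=> z; apply: cvg_near_cst.
      have [n _ Sn] : (\bigcup_n S n) z by rewrite ST.
      exists n => // k /= nk; rewrite !indicE in_setI.
      suff -> : z \in S k by rewrite andbT.
      by rewrite inE; have /subsetPset := ndS _ _ nk; exact.
    + by move=> n _; exact: H.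
  - move=> f g nf ng Hf Hg h hE hP.
    have fg z : (f z + g z = (h z)%:E)%E := ext _ _ z hE.
    have ffin z : f z \is a fin_num.
      rewrite ge0_fin_numE ?nf.2//; apply: le_lt_trans (ltry (h z)).
      by rewrite -fg leeDl// ng.2.
    have gfin z : g z \is a fin_num.
      rewrite ge0_fin_numE ?ng.2//; apply: le_lt_trans (ltry (h z)).
      by rewrite -fg leeDr// nf.2.
    have fgh z : fine (f z) + fine (g z) = h z.
      by rewrite -fineD// fg.
    have f0 z : 0 <= fine (f z) by apply: fine_ge0; exact: nf.2.
    have g0 z : 0 <= fine (g z) by apply: fine_ge0; exact: ng.2.
    have sub (k : Z -> \bar R) : nnmeas k -> (forall z, fine (k z) <= h z) ->
        (fun z => (fine (k z))%:C) \in sqint M.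
      move=> [mk k0] kh; apply: sqint_le hP _ => [|z].
        by apply: cmeas_real; apply: measurableT_comp mk; exact: fine_measurable.
      by rewrite !csqR ler_pXn2r ?nnegrE ?fine_ge0// (le_trans _ (kh z))// fine_ge0.
    have fP := sub f nf; have gP := sub g ng.
    have -> : rcls h = rcls (fine \o f) + rcls (fine \o g).
      apply: L2_eq.
      have hh := L2fun_cls hP.
      have ff : {ae M, forall z, L2fun (rcls (fine \o f)) z = (fine (f z))%:C}.
        by apply: L2fun_cls; apply: fP => z; rewrite -fgh lerDl.
      have gg : {ae M, forall z, L2fun (rcls (fine \o g)) z = (fine (g z))%:C}.
        by apply: L2fun_cls; apply: gP => z; rewrite -fgh lerDr.
      have sm := L2funD (rcls (fine \o f)) (rcls (fine \o g)).
      near=> z.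
      have -> : L2fun (rcls h) z = (h z)%:C by near: z.
      have -> : L2fun (rcls (fine \o f) + rcls (fine \o g)) z =
        L2fun (rcls (fine \o f)) z + L2fun (rcls (fine \o g)) z by near: z.
      have -> : L2fun (rcls (fine \o f)) z = (fine (f z))%:C by near: z.
      have -> : L2fun (rcls (fine \o g)) z = (fine (g z))%:C by near: z.
      by rewrite -rmorphD fgh.
    apply: l2closureD.
      apply: Hf; first by apply/funext => z /=; rewrite fineK.
      by apply: fP => z; rewrite -fgh lerDl.
    apply: Hg; first by apply/funext => z /=; rewrite fineK.
    by apply: gP => z; rewrite -fgh lerDr.
  - move=> r f r0 nf Hf h hE hP.
    (* If [r] is zero, nothing forces [f] to be finite or square-integrable and the induction
       hypothesis cannot be used; but then [h] vanishes. *)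
    have [r0'|rn0] := eqVneq r 0.
      have -> : rcls h = 0 *: rcls \1_(set0 `&` S 0%N).
        apply: L2_eq; rewrite scale0r.
        have z0 := L2funZ 0 (rcls h); rewrite scale0r in z0.
        apply: filterS2 (L2fun_cls hP) z0 => z -> ->; rewrite mul0r.
        by have := ext _ _ z hE; rewrite /= r0' mul0e => -[<-].
      by apply: l2closureZ; exact: H.
    have rgt0 : 0 < r by rewrite lt_neqAle eq_sym rn0.
    have fE z : f z = (r^-1 * h z)%:E.
      have := ext _ _ z hE => /= /(congr1 (mule r^-1%:E)).
      by rewrite muleA -EFinM mulVf// mul1e -EFinM.
    have kP : (fun z => (r^-1 * h z)%:C) \in sqint M.
      have := essbounded_sqint (mu := M) (h := fun=> r^-1%:C) _ hP.
      rewrite (_ : (fun x => _ * _) = (fun z => (r^-1 * h z)%:C)); last first.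
        by apply/funext => z; rewrite rmorphM.
      apply; split; first exact: cmeas_cst.
      by exists (csq (r^-1%:C : R[i])); exact: aeW.
    have -> : rcls h = r%:C *: rcls (fun z => r^-1 * h z).
      apply: L2_eq.
      apply: filterS3 (L2fun_cls hP) (L2funZ r%:C (rcls (fun z => r^-1 * h z))) (L2fun_cls kP).
      by move=> z -> -> ->; rewrite -rmorphM mulrA divff ?mul1r.
    by apply: l2closureZ; apply: Hf => //; apply/funext => z; rewrite fE.
  - move=> f_ nf Hf nd h hE hP.
    have fcvg z : f_ n z @[n --> \oo] --> (h z)%:E.
      rewrite -(ext _ _ z hE).
      exact: ereal_nondecreasing_is_cvgn.
    have fh n z : (f_ n z <= (h z)%:E)%E.
      rewrite -(ext _ _ z hE).
      apply: lime_ge; first exact: ereal_nondecreasing_is_cvgn.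
      by near=> k; apply: nd; near: k; exists n.
    have ffin n z : f_ n z \is a fin_num.
      by rewrite ge0_fin_numE ?(nf n).2//; apply: le_lt_trans (ltry (h z)); exact: fh.
    apply: (clim _ (fun n z => fine (f_ n z))) => //.
    + by move=> n; apply: measurableT_comp (nf n).1; exact: fine_measurable.
    + move=> n z; rewrite fine_ge0 ?(nf n).2//= -lee_fin fineK//.
    + by move=> z; apply: fine_cvg; exact: fcvg.
    + by move=> n nP; apply: Hf nP; apply/funext => z /=; rewrite fineK.
move=> u; rewrite -(L2cls_fun u).
have [P1 P2 P3 P4 ->] := rcls_decomp (L2fun_sqint u).
have pos (h : Z -> R) : (fun z => (Num.max (h z) 0)%:C) \in sqint M ->
    l2closure A (rcls (fun z => Num.max (h z) 0)).
  move=> hP; have /sqintP[[mh _] _] := hP.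
  apply: (posP (EFin \o (fun z => Num.max (h z) 0))) => //.
  by apply: nnmeas_EFin => // z; rewrite le_max lexx orbT.
by apply: l2closureD; [|apply: l2closureZ]; (apply: l2closureD; [|apply: l2closureZ]); exact: pos.
Unshelve. all: by end_near. Qed.

End Closure.

(** * Representations by multiplication operators *)

Section MultRep.
Context d (X : measurableType d) (R : realType) (nu : {measure set X -> \bar R}).
Context dY (Y : measurableType dY) (rho : {measure set Y -> \bar R}) (i : Y -> X).
Hypothesis lg : leg nu rho i.
Implicit Types (xi : L2 rho).

Let mi : measurable_fun setT i. Proof. by case: lg. Qed.

Lemma Linf_csq (n : X -> R[i]) : Linf nu n -> cmeas n /\ exists C : R, 0 <= C /\ {ae nu, forall x, csq (n x) <= C ^+ 2}.
Proof.
move=> [n1 n2 [[c e] nM]]; split => //; exists `|c|; split => //.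
apply: filterS nM => x; rewrite normc_csq lecE /= => /andP[_ h].
rewrite -[csq _]sqr_sqrtr ?csq_ge0// ler_pXn2r ?nnegrE ?sqrtr_ge0//.
by rewrite (le_trans h)// ler_norm.
Qed.

Lemma Linf_essbounded (n : X -> R[i]) : Linf nu n -> essbounded rho (fun y => n (i y)).
Proof.
move=> /Linf_csq[mn [C [C0 nC]]]; split; first exact: cmeas_comp mi mn.
by exists (C ^+ 2); exact: leg_ae nC.
Qed.

Lemma mult_repE (n : X -> R[i]) xi : mult_rep rho i n xi = mulop (fun y => n (i y)) xi.
Proof. by []. Qed.

Lemma nrm2_mult_rep (n : X -> R[i]) xi : Linf nu n -> (nrm2 (mult_rep rho i n xi))%:E =
  (\int[rho]_y ((csq (n (i y)))%:E * (csq (L2fun xi y))%:E))%E.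
Proof.
move=> nb; rewrite nrm2_cls; last first.
  by apply: essbounded_sqint (L2fun_sqint xi); exact: Linf_essbounded.
by apply: eq_integral => y _; rewrite csqM EFinM.
Qed.

Lemma cint_csq (n : X -> R[i]) : cmeas n -> cint nu (fun x => n x * (n x)^*) = (\int[nu]_x csq (n x))%:C.
Proof.
move=> mn; rewrite /cint; congr (_ +i* _); first by apply: eq_Rintegral => x _; rewrite mulz_conj.
under eq_Rintegral do rewrite mulz_conj /=.
by rewrite Rintegral_cst// mul0r.
Qed.

(** The squared norm of [b n xi] is the integral of |n o i|^2 |xi|^2. Left boundedness of [xi] thus
    compares the image of |xi|^2 with [nu] on the functions |n|^2; indicator functions are among
    them and suffice. *)
Lemma bounded_vector_density xi : bounded_vector nu (mult_rep rho i) xi <->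
  exists k : R, 0 <= k /\ bounded_density nu rho i (csq \o L2fun xi) k.
Proof.
have nxi := nnmeas_csq (L2fun_meas xi).
split=> [[M HM]|[k [k0 Hk]]]; last first.
  exists k%:C => n [nb nP]; have [mn _] := Linf_csq nb.
  rewrite ip_nrm2 cint_csq// -rmorphM lecR -lee_fin nrm2_mult_rep//.
  apply: le_trans (Hk _ (nnmeas_csq mn)) _; rewrite EFinM lee_wpmul2l ?lee_fin//.
  rewrite /Rintegral fineK// ge0_fin_numE; last by apply: integral_ge0 => x _; rewrite lee_fin csq_ge0.
  by have /sqintP[] := nP.
(* The maximum with 1 makes [k] positive, so that the bound is infinite for sets of infinite
   measure, which [Linf2] does not see. *)
pose k := Num.max (re M) 1; have k0 : 0 < k by rewrite lt_max ltr01 orbT.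
exists k; split; first exact: ltW.
have ng F : nnmeas F -> nnmeas (fun y => F (i y) * ((csq \o L2fun xi) y)%:E)%E.
  by move=> nF; apply: nnmeasM nxi; exact: nnmeas_comp mi nF.
apply: nnmeas_ind.
- move=> B mB; rewrite integral_indic// setIT.
  have [Boo|] := ltP (nu B) +oo%E; last first.
    by rewrite leye_eq => /eqP ->; rewrite gt0_muley ?lte_fin// leey.
  have mn : cmeas (fun x => (\1_B x)%:C : R[i]) by apply: cmeas_real; exact: measurable_indic.
  have csq1 x : csq ((\1_B x)%:C : R[i]) = \1_B x.
    by rewrite csqR indicE; case: (x \in B); rewrite ?expr1n ?expr0n.
  have n2 : Linf2 nu (fun x => (\1_B x)%:C).
    split; first split; [exact: mn.1|exact: mn.2|exists 1; apply: aeW => x|].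
      by rewrite normc_csq csq1 indicE; case: (x \in B); rewrite ?sqrtr1 ?sqrtr0//.
    apply/sqintP; split => //; under eq_integral do rewrite csq1.
    by rewrite integral_indic// setIT.
  have := HM _ n2; rewrite ip_nrm2 cint_csq// lecE => /andP[_].
  have reM (z : R[i]) (c : R) : re (z * c%:C) = re z * c.
    by case: z => a b /=; rewrite mulr0 subr0.
  rewrite reM -lee_fin nrm2_mult_rep; last by case: n2.
  under eq_integral do rewrite csq1.
  move=> /le_trans; apply.
  have -> : \int[nu]_x csq ((\1_B x)%:C : R[i]) = fine (nu B).
    by rewrite /Rintegral; under eq_integral do rewrite csq1; rewrite integral_indic// setIT.
  rewrite -[X in (_ <= _ * X)%E](@fineK _ (nu B)) ?ge0_fin_numE// -EFinM lee_fin.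
  by rewrite ler_wpM2r ?fine_ge0// le_max lexx.
- move=> f g nf ng' fE gE.
  have [[f1 f2] [g1 g2]] := (ng _ nf, ng _ ng').
  under eq_integral do rewrite ge0_muleDl ?nf.2 ?ng'.2//.
  rewrite !ge0_integralD ?nf.1 ?ng'.1//; [|by move=> ? _; exact: nf.2|exact: nf.1|by move=> ? _; exact: ng'.2|exact: ng'.1].
  by rewrite ge0_muleDr ?integral_ge0//; [exact: leeD|move=> ? _; exact: nf.2|move=> ? _; exact: ng'.2].
- move=> c f c0 nf fE; have [f1 f2] := ng _ nf; have [h1 h2] := nf.
  under eq_integral do rewrite -muleA.
  by rewrite !ge0_integralZl ?lee_fin// muleCA lee_wpmul2l ?lee_fin.
- move=> f_ nf fE nd.
  have lim_mul (c : R) y : (limn (f_ ^~ y) * c%:E = limn (fun n => f_ n y * c%:E))%E.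
    apply/esym/cvg_lim => //; apply: cvgeZr => //.
    exact: ereal_nondecreasing_is_cvgn.
  under eq_integral do rewrite lim_mul.
  have ndM y : nondecreasing_seq (fun n => f_ n (i y) * (csq (L2fun xi y))%:E)%E.
    by move=> m n mn; rewrite lee_wpmul2r ?lee_fin ?csq_ge0//; exact: nd.
  rewrite (monotone_convergence rho measurableT (fun n => (ng _ (nf n)).1)
    (fun n y _ => (ng _ (nf n)).2 y) (fun y _ => ndM y)).
  rewrite (monotone_convergence nu measurableT (fun n => (nf n).1)
    (fun n x _ => (nf n).2 x) (fun x _ => nd x)).
  have ndf : nondecreasing_seq (fun n => \int[nu]_x f_ n x)%E.
    by move=> m n mn; apply: le_nnmeas_integral => // x; exact: nd.
  apply: lime_le.
    apply: ereal_nondecreasing_is_cvgn => m n mn; apply: le_nnmeas_integral => [||y].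
    + exact: ng.
    + exact: ng.
    + exact: ndM.
  apply: nearW => n; apply: le_trans (fE n) _.
  apply: lee_wpmul2l; first by rewrite lee_fin ltW.
  apply: lime_ge; first exact: ereal_nondecreasing_is_cvgn.
  by near=> m; apply: ndf; near: m; exists n.
Unshelve. all: by end_near. Qed.

End MultRep.

Section CIntegrable.
Context d (T : measurableType d) (R : realType) (mu : {measure set T -> \bar R}).
Implicit Types f g h : T -> R[i].

Lemma ae_le_integrable (f h : T -> R) : measurable_fun setT f ->
  mu.-integrable setT (EFin \o h) -> {ae mu, forall x, `|f x| <= h x} ->
  mu.-integrable setT (EFin \o f).
Proof.
move=> mf ih fh; have /integrableP[mh hoo] := ih.
apply/integrableP; split; first exact/measurable_EFinP.
apply: le_lt_trans hoo; apply: ae_ge0_le_integral => //.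
- by apply: measurableT_comp => //; exact/measurable_EFinP.
- exact: measurableT_comp.
- by apply: filterS fh => x fh _; rewrite lee_fin (le_trans fh)// ler_norm.
Qed.

Lemma cintegrableD f g : cintegrable mu f -> cintegrable mu g ->
  cintegrable mu (fun x => f x + g x).
Proof.
move=> [f1 f2] [g1 g2]; split.
  rewrite (_ : _ \o _ = (EFin \o (re \o f)) \+ (EFin \o (re \o g)))%E; first exact: integrableD.
  by apply/funext => x /=; case: (f x) (g x) => ? ? [].
rewrite (_ : _ \o _ = (EFin \o (im \o f)) \+ (EFin \o (im \o g)))%E; first exact: integrableD.
by apply/funext => x /=; case: (f x) (g x) => ? ? [].
Qed.

Lemma cintegrable_mul f h : essbounded mu h -> cintegrable mu f ->
  cintegrable mu (fun x => h x * f x).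
Proof.
move=> [mh [C hC]] fi; have mf := cintegrable_meas fi; have [f1 f2] := fi.
have mhf := cmeasM mh mf.
pose k x := Num.sqrt `|C| * (`|re (f x)| + `|im (f x)|).
have ik : mu.-integrable setT (EFin \o k).
  rewrite (_ : _ \o _ = fun x => ((Num.sqrt `|C|)%:E *
    ((abse \o (EFin \o (re \o f))) x + (abse \o (EFin \o (im \o f))) x))%E)//.
  apply: integrableZl => //; apply: integrableD => //; exact: integrable_abse.
have hk : {ae mu, forall x, Num.sqrt (csq (h x * f x)) <= k x}.
  apply: filterS hC => x hC; rewrite csqM sqrtrM ?csq_ge0// ler_pM ?sqrtr_ge0//.
    by rewrite ler_sqrt// (le_trans hC)// ler_norm.
  rewrite -[leRHS]ger0_norm ?addr_ge0// -sqrtr_sqr ler_sqrt ?sqr_ge0//.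
  rewrite sqrrD !real_normK ?num_real// /csq addrAC lerDl.
  by rewrite pmulrn_lge0// mulr_ge0.
split; apply: ae_le_integrable ik _.
- exact: mhf.1.
- by apply: filterS hk => x; apply: le_trans; exact: norm_re.
- exact: mhf.2.
- by apply: filterS hk => x; apply: le_trans; exact: norm_im.
Qed.

Lemma essbounded_cst (c : R[i]) : essbounded mu (fun=> c).
Proof. by split; [exact: cmeas_cst|exists (csq c); exact: aeW]. Qed.

Lemma cintegrableZ (c : R[i]) f : cintegrable mu f -> cintegrable mu (fun x => c * f x).
Proof. exact/cintegrable_mul/essbounded_cst. Qed.

Lemma essboundedM f g : essbounded mu f -> essbounded mu g ->
  essbounded mu (fun x => f x * g x).
Proof.
move=> [mf [C fC]] [mg [E gE]]; split; first exact: cmeasM.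
exists (C * E); apply: filterS2 fC gE => x fC gE.
by rewrite csqM ler_pM ?csq_ge0.
Qed.

Lemma essboundedD f g : essbounded mu f -> essbounded mu g ->
  essbounded mu (fun x => f x + g x).
Proof.
move=> [mf [C fC]] [mg [E gE]]; split; first exact: cmeasD.
exists (2 * C + 2 * E); apply: filterS2 fC gE => x fC gE.
by apply: le_trans (csqD_le _ _) _; lra.
Qed.

Lemma essbounded_conj f : essbounded mu f -> essbounded mu (fun x => (f x)^*).
Proof.
move=> [mf [C fC]]; split; first exact: cmeas_conj.
by exists C; apply: filterS fC => x; rewrite csq_conj.
Qed.

Lemma mulop_eq h g xi : cmeas h -> cmeas g -> {ae mu, forall x, h x = g x} ->
  mulop h xi = mulop g xi :> L2 mu.
Proof.
move=> mh mg hg; apply: L2cls_eq.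
- by apply: cmeasM => //; exact: L2fun_meas.
- by apply: cmeasM => //; exact: L2fun_meas.
- by apply: filterS hg => x ->.
Qed.

Lemma mulopM h g (xi : L2 mu) : essbounded mu h -> essbounded mu g ->
  mulop h (mulop g xi) = mulop (fun x => h x * g x) xi.
Proof.
move=> bh bg; apply: L2cls_eq.
- by apply: cmeasM; [case: bh|exact: L2fun_meas].
- by apply: cmeasM; [apply: cmeasM; [case: bh|case: bg]|exact: L2fun_meas].
- by apply: filterS (mulop_fun xi bg) => x ->; rewrite mulrA.
Qed.

Lemma mulop_ip h (xi eta : L2 mu) : essbounded mu h ->
  ip (mulop h xi) eta = ip xi (mulop (fun x => (h x)^*) eta).
Proof.
move=> bh; rewrite !L2ipE; apply: eq_cint.
- by apply: sqint_cintegrable; exact: L2fun_sqint.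
- by apply: sqint_cintegrable; exact: L2fun_sqint.
- apply: filterS2 (mulop_fun xi bh) (mulop_fun eta (essbounded_conj bh)) => x -> ->.
  move: (h x) (L2fun xi x) (L2fun eta x) => [a b] [c e] [k l].
  by congr (_ +i* _) => /=; ring.
Qed.

End CIntegrable.

Section Basis.
Context d (X : measurableType d) (R : realType) (nu : {measure set X -> \bar R}).
Hypothesis snu : sigma_finite setT nu.

Section OneLeg.
Context dY (Y : measurableType dY) (rho : {measure set Y -> \bar R}) (i : Y -> X).
Hypothesis lg : leg nu rho i.

Let mi : measurable_fun setT i. Proof. by case: lg. Qed.

Lemma mult_rep_representation : representation nu (mult_rep rho i).
Proof.
split; first by move=> n nb; apply: mulop_bounded; exact: (Linf_essbounded lg nb).
split.
- move=> n n' nb nb' nn' u; apply: mulop_eq.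
  + by case: (Linf_essbounded lg nb).
  + by case: (Linf_essbounded lg nb').
  + exact: (leg_ae lg nn').
- move=> k n n' nb nb' u.
  have b1 := Linf_essbounded lg nb; have b2 := Linf_essbounded lg nb'.
  have b3 := essboundedD (essboundedM (essbounded_cst rho k) b1) b2.
  have A := mulop_fun u b1; have B := mulop_fun u b2; have C := mulop_fun u b3.
  have D := L2funD (k *: mult_rep rho i n u) (mult_rep rho i n' u).
  have E := L2funZ k (mult_rep rho i n u).
  apply: L2_eq; near=> y.
  have -> : L2fun (mult_rep rho i (fun x => k * n x + n' x) u) y =
    (k * n (i y) + n' (i y)) * L2fun u y by near: y.
  have -> : L2fun (k *: mult_rep rho i n u + mult_rep rho i n' u) y =
    L2fun (k *: mult_rep rho i n u) y + L2fun (mult_rep rho i n' u) y by near: y.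
  have -> : L2fun (k *: mult_rep rho i n u) y = k * L2fun (mult_rep rho i n u) y by near: y.
  have -> : L2fun (mult_rep rho i n u) y = n (i y) * L2fun u y by near: y.
  have -> : L2fun (mult_rep rho i n' u) y = n' (i y) * L2fun u y by near: y.
  by rewrite mulrDl mulrA.
- move=> n n' nb nb' u.
  by rewrite [RHS](mulopM _ (Linf_essbounded lg nb) (Linf_essbounded lg nb')).
- by move=> n nb u v; exact: (mulop_ip u v (Linf_essbounded lg nb)).
Unshelve. all: by end_near. Qed.

(** Applied to indicator functions of sets of finite measure, the hypothesis gives that [n] vanishes
    almost everywhere on the image side; the assumption on null sets brings this back to [nu]. *)
Lemma mult_rep_faithful : (forall A, measurable A -> rho (i @^-1` A) = 0%E -> nu A = 0%E) ->
  faithful nu (mult_rep rho i).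
Proof.
move=> H n nb n0; have [mn _] := Linf_csq nb.
pose A := [set x | n x != 0].
have mA : measurable A.
  rewrite (_ : A = (csq \o n) @^-1` [set~ 0]).
    rewrite -[X in measurable X]setTI; apply: (cmeas_csq mn) => //.
    exact: measurableC.
  by apply/seteqP; split => x /=; rewrite /A /= -csq_eq0 => /eqP.
exists A; split => //; last by move=> x /= /eqP.
apply: H => //.
have mB : measurable (i @^-1` A) by rewrite -[X in measurable X]setTI; exact: mi.
have [_ /sigma_finiteP[S [ST ndS /all_and2[mS Soo]]] _] := lg.
suff SA j : rho (i @^-1` A `&` S j) = 0%E.
  apply/eqP; rewrite eq_le measure_ge0 andbT.
  rewrite -[X in rho X]setIT ST setI_bigcupr.
  apply: (@le_trans _ _ (\sum_(j <oo) rho (i @^-1` A `&` S j))%E).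
    apply: generalized_Boole_inequality => [j|]; first exact: measurableI.
    by apply: bigcup_measurable => j _; exact: measurableI.
  by rewrite eseries0.
have SP := indic_sqint (mS j) (Soo j).
have := n0 (L2cls rho (fun y => (\1_(S j) y)%:C)).
move=> /(congr1 (@L2fun _ _ _ _)) E.
have := mulop_fun (L2cls rho (fun y => (\1_(S j) y)%:C)) (Linf_essbounded lg nb).
have z0 : {ae rho, forall y, L2fun (0 : L2 rho) y = 0}.
  by have := L2funZ 0 (0 : L2 rho); rewrite scale0r; apply: filterS => y ->; rewrite mul0r.
move=> F; have {}F : {ae rho, forall y, n (i y) * (\1_(S j) y)%:C = 0}.
  apply: filterS3 F z0 (L2fun_cls SP) => y; rewrite -mult_repE E => h1 h2 h3.
  by rewrite -h3 -h1.
apply: measure_negligible; first exact: measurableI.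
move: F; apply: negligibleS => y [/= Ay Sy]; rewrite indicE mem_set//= mulr1.
by move=> /eqP; apply/negP.
Qed.

Lemma mult_rep_nondegenerate : nondegenerate nu (mult_rep rho i).
Proof.
move=> u H; have := H (fun=> 1).
rewrite /mult_rep (_ : (fun x => 1 * L2fun u x) = L2fun u); last by apply/funext => x; rewrite mul1r.
rewrite L2cls_fun; apply; split; [exact: measurable_cst|exact: measurable_cst|].
by exists 1; apply: aeW => x; rewrite normr1.
Qed.

(** [h] is the density over [nu] of the image under [i] of the complex measure f.rho. For f = u v^*
    it is the predual element that represents the coefficient of [mult_rep] at u and v. *)
Definition cdensity (f : Y -> R[i]) (h : X -> R[i]) := [/\ cintegrable rho f, cintegrable nu h
  & forall n, Linf nu n -> cint rho (fun y => n (i y) * f y) = cint nu (fun x => n x * h x)].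

Lemma cdensity_lin f g h k (c : R[i]) : cdensity f h -> cdensity g k ->
  cdensity (fun y => f y + c * g y) (fun x => h x + c * k x).
Proof.
move=> [f1 h1 fh] [g1 k1 gk]; split.
- by apply: cintegrableD => //; exact: cintegrableZ.
- by apply: cintegrableD => //; exact: cintegrableZ.
have nuleg : leg nu nu id by split => //; exact: measurable_id.
move=> n nb; have bn := Linf_essbounded lg nb; have bn' := Linf_essbounded nuleg nb.
have lin d' (T : measurableType d') (m : {measure set T -> \bar R}) (p q e : T -> R[i]) :
    essbounded m e -> cintegrable m p -> cintegrable m q ->
    cint m (fun y => e y * (p y + c * q y)) =
    cint m (fun y => e y * p y) + c * cint m (fun y => e y * q y).
  move=> be ip iq; have [p1 p2] := cintegrable_mul be ip; have [q1 q2] := cintegrable_mul be iq.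
  have [r1 r2] := cintegrableZ c (cintegrable_mul be iq).
  rewrite -cintZ// -cintD//; congr cint; apply/funext => y.
  by rewrite mulrDr mulrCA.
by rewrite lin// fh// gk// -lin.
Qed.

Lemma cdensity_pos (f : Y -> R) : measurable_fun setT f -> (forall y, 0 <= f y) ->
  rho.-integrable setT (EFin \o f) -> exists h, cdensity (fun y => (f y)%:C) h.
Proof.
move=> mf f0 fi; have /integrableP[_ foo] := fi.
have absE : (\int[rho]_y `|(EFin \o f) y| = \int[rho]_y (f y)%:E)%E.
  by apply: eq_integral => y _; rewrite gee0_abs ?lee_fin.
rewrite absE in foo; have [phi [mphi phi0 C]] := density_ex snu lg mf f0 foo.
have real_ci d' (T : measurableType d') (m : {measure set T -> \bar R}) (p : T -> R) :
    m.-integrable setT (EFin \o p) -> cintegrable m (fun y => (p y)%:C).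
  by move=> pi; split => //; exact: integrable0.
have phii : nu.-integrable setT (EFin \o phi).
  apply: integrable_EFin => //; apply: le_lt_trans foo.
  have := C _ (nnmeas_cst _ (@lee01 R)).
  under eq_integral do rewrite mul1e; under [RHS]eq_integral do rewrite mul1e.
  by move=> <-.
exists (fun x => (phi x)%:C); split; [exact: real_ci|exact: real_ci|].
move=> n nb; have nuleg : leg nu nu id by split => //; exact: measurable_id.
have [|_ ->//] := chg_cint mf f0 mphi phi0 mi C (Linf_csq nb).1.
by apply: cintegrable_mul (real_ci _ _ _ _ phii); exact: (Linf_essbounded nuleg nb).
Qed.

Lemma cdensity_ex (f : Y -> R[i]) : cintegrable rho f -> exists h, cdensity f h.
Proof.
move=> fi; have mf := cintegrable_meas fi; have [f1 f2] := fi.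
have max_int (h : Y -> R) : rho.-integrable setT (EFin \o h) ->
    exists k, cdensity (fun y => (Num.max (h y) 0)%:C) k.
  move=> hi; have /integrableP[/measurable_EFinP mh _] := hi.
  have mm : measurable_fun setT (fun y => Num.max (h y) 0) by exact: measurable_maxr.
  apply: cdensity_pos => // [y|]; first by rewrite le_max lexx orbT.
  apply: (le_integrable measurableT _ _ hi); first exact/measurable_EFinP.
  by move=> y _; rewrite /= lee_fin; have [?|?] := leP (h y) 0; rewrite ?normr0.
have neg_int (h : Y -> R) : rho.-integrable setT (EFin \o h) ->
    rho.-integrable setT (EFin \o (fun y => - h y)).
  by move=> hi; rewrite (_ : _ \o _ = \- (EFin \o h))%E//; exact: integrableN.
have [k1 K1] := max_int _ f1; have [k2 K2] := max_int _ (neg_int _ f1).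
have [k3 K3] := max_int _ f2; have [k4 K4] := max_int _ (neg_int _ f2).
(* Real and imaginary parts are split into positive and negative parts, with the coefficients 1, -1,
   i and -i. *)
have := cdensity_lin (- 'i) (cdensity_lin 'i (cdensity_lin (-1) K1 K2) K3) K4.
rewrite (_ : (fun y => _) = f); first by move=> K; eexists; exact: K.
apply/funext => y /=.
have mx (a : R) : Num.max a 0 - Num.max (- a) 0 = a.
  by have [a0|a0] := leP a 0; have [b0|b0] := leP (- a) 0; lra.
case: (f y) => a b /=; rewrite -[in RHS](mx a) -[in RHS](mx b).
by congr (_ +i* _) => /=; ring.
Qed.

Lemma mult_rep_normal : normal_rep nu (mult_rep rho i).
Proof.
move=> u v.
have [h [_ [h1 h2] H]] := cdensity_ex (sqint_cintegrable (L2fun_sqint u) (L2fun_sqint v)).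
exists h; split => // n nb; have bn := Linf_essbounded lg nb.
rewrite -H// L2ipE; apply: eq_cint.
- by apply: sqint_cintegrable; exact: L2fun_sqint.
- apply: cintegrable_mul => //.
  by apply: sqint_cintegrable; exact: L2fun_sqint.
- by apply: filterS (mulop_fun u bn) => y ->; rewrite mulrA.
Qed.

Lemma mult_rep_basis : (forall A, measurable A -> rho (i @^-1` A) = 0%E -> nu A = 0%E) ->
  basis_rep nu (mult_rep rho i).
Proof.
move=> H; split; [exact: mult_rep_representation|exact: mult_rep_faithful
  |exact: mult_rep_normal|exact: mult_rep_nondegenerate].
Qed.

End OneLeg.

Lemma mult_rep_commuting dY (Y : measurableType dY) (rho : {measure set Y -> \bar R}) i j :
  leg nu rho i -> leg nu rho j -> commuting nu (mult_rep rho i) (mult_rep rho j).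
Proof.
move=> li lj n n' nb nb' u.
have b1 := Linf_essbounded li nb; have b2 := Linf_essbounded lj nb'.
rewrite [LHS](mulopM _ b1 b2) [RHS](mulopM _ b2 b1).
by congr (mulop _ _); apply/funext => y; rewrite mulrC.
Qed.

End Basis.

(** * Relative tensor products *)

Definition tens d1 d2 dZ (Y1 : measurableType d1) (Y2 : measurableType d2)
    (Z : measurableType dZ) (R : realType)
    (rho1 : {measure set Y1 -> \bar R}) (rho2 : {measure set Y2 -> \bar R})
    (M : {measure set Z -> \bar R}) (q1 : Z -> Y1) (q2 : Z -> Y2)
    (xi : L2 rho1) (eta : L2 rho2) : L2 M :=
  L2cls M (fun z => L2fun xi (q1 z) * L2fun eta (q2 z)).
Arguments tens {d1 d2 dZ Y1 Y2 Z R rho1 rho2} M q1 q2 xi eta.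

Lemma in_preimage (T U : Type) (f : T -> U) (B : set U) x : (x \in f @^-1` B) = (f x \in B).
Proof. by apply/idP/idP; rewrite !inE. Qed.

(** Polarization. Expanding at k u + v gives k B(u, v) + k^* B(v, u) = 0; k = 1 makes the two values
    opposite and k = i makes them equal. *)
Lemma sesqui_diag (R : realType) (V : lmodType R[i]) (B : V -> V -> R[i]) :
  (forall k u u' v, B (k *: u + u') v = k * B u v + B u' v) ->
  (forall k u v v', B u (k *: v + v') = k^* * B u v + B u v') ->
  (forall u, B u u = 0) -> forall u v, B u v = 0.
Proof.
move=> Bl Br B0 u v.
have E (k : R[i]) : k * B u v + k^* * B v u = 0.
  have := B0 (k *: u + v).
  by rewrite Bl !Br !B0 !mulr0 !(addr0, add0r).
have E1 := E 1; have Ei := E (0 +i* 1).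
have cE (a b : R) : Num.conj (a +i* b) = a +i* - b by [].
rewrite rmorph1 !mul1r in E1; rewrite cE in Ei.
have {}Ei : (0 +i* 1) * (B u v - B v u) = 0.
  by rewrite -[RHS]Ei mulrBr; case: (B u v) (B v u) => [a b] [c e]; congr (_ +i* _) => /=; ring.
have i0 : (0 +i* 1 : R[i]) != 0 by rewrite eq_complex /= oner_eq0 andbF.
move: Ei => /eqP; rewrite mulf_eq0 (negbTE i0) /= subr_eq0 => /eqP Euv.
by move: E1; rewrite -Euv -mulr2n => /eqP; rewrite mulrn_eq0 => /eqP.
Qed.

(** A bracket is only tested on bounded functions, so an unbounded weight [w] is cut to the sets
    where it is at most [k]. *)
Lemma trunc_weight_cvg d (T : measurableType d) (R : realType) (mu : {measure set T -> \bar R})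
    (f w : T -> R) : measurable_fun setT f -> measurable_fun setT w -> (forall x, 0 <= w x) ->
  mu.-integrable setT (EFin \o (fun x => f x * w x)) ->
  (\int[mu]_x (f x * (w x * (w x <= k%:R)%R%:R))) @[k --> \oo] --> \int[mu]_x (f x * w x).
Proof.
move=> mf mw w0 fi; have /integrableP[mfw fwoo] := fi.
apply: fine_cvg; rewrite fineK; last exact: integrable_fin_num.
apply: (dominated_cvg measurableT _ _ _ (integrable_abse fi)) => //.
- move=> k; apply/measurable_EFinP; apply: measurable_funM => //; apply: measurable_funM => //.
  rewrite (_ : (fun x => _) = \1_[set x | w x <= k%:R]).
    apply: measurable_indic; rewrite -[X in measurable X]setTI.
    exact: measurable_fun_le.
  by apply/funext => x; rewrite indicE; congr ((nat_of_bool _)%:R); apply/idP/idP; rewrite inE.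
- move=> x _; apply: cvg_EFin; first exact: nearW.
  apply: cvg_near_cst; exists (Num.truncn (w x)).+1 => // k /= nk.
  rewrite (_ : w x <= k%:R) ?mulr1//.
  by rewrite (le_trans (ltW (truncnS_gt _)))// ler_nat.
- move=> k x _; rewrite /= lee_fin mulrA normrM ler_piMr//.
  by case: (w x <= k%:R); rewrite ?normr1 ?normr0.
Qed.

Section RelativeTensor.
Context d (X : measurableType d) (R : realType) (nu : {measure set X -> \bar R}).
Hypothesis snu : sigma_finite setT nu.
Context d1 d2 dZ (Y1 : measurableType d1) (Y2 : measurableType d2) (Z : measurableType dZ).
Context (rho1 : {measure set Y1 -> \bar R}) (i1 : Y1 -> X).
Context (rho2 : {measure set Y2 -> \bar R}) (i2 : Y2 -> X).
Context (M : {measure set Z -> \bar R}) (q1 : Z -> Y1) (q2 : Z -> Y2).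
Hypotheses (lg1 : leg nu rho1 i1) (lg2 : leg nu rho2 i2).
Hypothesis P : fibprod nu rho1 i1 rho2 i2 M q1 q2.
Implicit Types (xi : L2 rho1) (eta : L2 rho2).

Let mq1 : measurable_fun setT q1. Proof. by case: P. Qed.
Let mq2 : measurable_fun setT q2. Proof. by case: P. Qed.
Let mi1 : measurable_fun setT i1. Proof. by case: lg1. Qed.
Let mi2 : measurable_fun setT i2. Proof. by case: lg2. Qed.
Local Notation D := (bounded_vector nu (mult_rep rho1 i1)).
Local Notation t := (tens M q1 q2).

Lemma fibprod_ae1 (Q : set Y1) : {ae rho1, forall y, Q y} -> {ae M, forall z, Q (q1 z)}.
Proof.
move=> [N [mN N0 QN]]; exists (q1 @^-1` N); split.
- by rewrite -[X in measurable X]setTI; exact: mq1.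
- exact: (fibprod_null1 snu lg1 lg2 P).
- by move=> z; apply: QN.
Qed.

Lemma fibprod_ae2 (Q : set Y2) : {ae rho2, forall y, Q y} -> {ae M, forall z, Q (q2 z)}.
Proof.
move=> [N [mN N0 QN]]; exists (q2 @^-1` N); split.
- by rewrite -[X in measurable X]setTI; exact: mq2.
- exact: (fibprod_null1 snu lg2 lg1 (fibprod_sym P)).
- by move=> z; apply: QN.
Qed.

Lemma sqint_density eta : exists psi : X -> R,
  density nu rho2 i2 (csq \o L2fun eta) psi /\ (\int[nu]_x (psi x)%:E < +oo)%E.
Proof.
have [|psi Dpsi] := density_ex snu lg2 (cmeas_csq (L2fun_meas eta)) (fun y => csq_ge0 _).
  exact: nrm2_fin.
exists psi; split => //; have [mpsi psi0 C] := Dpsi.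
have := C _ (nnmeas_cst _ (@lee01 R)).
under eq_integral do rewrite mul1e; under [RHS]eq_integral do rewrite mul1e.
by move=> <-; exact: nrm2_fin.
Qed.

(** Integrating |eta|^2 first leaves its density [psi]; the integral of |xi|^2 psi(i1) is then at
    most [k] times that of [psi], since [xi] is left bounded. *)
Lemma tens_sqint xi eta : D xi ->
  (fun z => L2fun xi (q1 z) * L2fun eta (q2 z)) \in sqint M.
Proof.
move=> /(bounded_vector_density lg1)[k [k0 kb]].
apply/sqintP; split.
  by apply: cmeasM; [apply: (cmeas_comp mq1)|apply: (cmeas_comp mq2)]; exact: L2fun_meas.
have [psi [Dpsi psioo]] := sqint_density eta; have [mpsi psi0 _] := Dpsi.
have C := fibprod_chg snu lg1 P (cmeas_csq (L2fun_meas eta)) (fun y => csq_ge0 _) Dpsi.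
under eq_integral do rewrite csqM EFinM.
rewrite (C _ (nnmeas_csq (L2fun_meas xi))).
under eq_integral do rewrite muleC.
apply: le_lt_trans (kb _ (nnmeas_EFin mpsi psi0)) _.
by rewrite lte_mul_pinfty ?lee_fin.
Qed.

Lemma tens_fun xi eta : D xi ->
  {ae M, forall z, L2fun (t xi eta) z = L2fun xi (q1 z) * L2fun eta (q2 z)}.
Proof. by move=> Dxi; apply: L2fun_cls; exact: tens_sqint. Qed.

Lemma tens_linl k xi xi' eta : D xi -> D xi' ->
  t (k *: xi + xi') eta = k *: t xi eta + t xi' eta.
Proof.
move=> Dx Dx'; rewrite -[RHS]L2cls_fun; apply: L2cls_eq.
- by apply: cmeasM; [apply: (cmeas_comp mq1)|apply: (cmeas_comp mq2)]; exact: L2fun_meas.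
- exact: L2fun_meas.
have A := fibprod_ae1 (L2funD (k *: xi) xi'); have B := fibprod_ae1 (L2funZ k xi).
have C := L2funD (k *: t xi eta) (t xi' eta); have E := L2funZ k (t xi eta).
have F := tens_fun eta Dx; have G := tens_fun eta Dx'.
near=> z.
have -> : L2fun (k *: xi + xi') (q1 z) = L2fun (k *: xi) (q1 z) + L2fun xi' (q1 z) by near: z.
have -> : L2fun (k *: xi) (q1 z) = k * L2fun xi (q1 z) by near: z.
have -> : L2fun (k *: t xi eta + t xi' eta) z = L2fun (k *: t xi eta) z + L2fun (t xi' eta) z.
  by near: z.
have -> : L2fun (k *: t xi eta) z = k * L2fun (t xi eta) z by near: z.
have -> : L2fun (t xi eta) z = L2fun xi (q1 z) * L2fun eta (q2 z) by near: z.
have -> : L2fun (t xi' eta) z = L2fun xi' (q1 z) * L2fun eta (q2 z) by near: z.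
by rewrite mulrDl mulrA.
Unshelve. all: by end_near. Qed.

Lemma tens_linr k xi eta eta' : D xi ->
  t xi (k *: eta + eta') = k *: t xi eta + t xi eta'.
Proof.
move=> Dx; rewrite -[RHS]L2cls_fun; apply: L2cls_eq.
- by apply: cmeasM; [apply: (cmeas_comp mq1)|apply: (cmeas_comp mq2)]; exact: L2fun_meas.
- exact: L2fun_meas.
have A := fibprod_ae2 (L2funD (k *: eta) eta'); have B := fibprod_ae2 (L2funZ k eta).
have C := L2funD (k *: t xi eta) (t xi eta'); have E := L2funZ k (t xi eta).
have F := tens_fun eta Dx; have G := tens_fun eta' Dx.
near=> z.
have -> : L2fun (k *: eta + eta') (q2 z) = L2fun (k *: eta) (q2 z) + L2fun eta' (q2 z) by near: z.
have -> : L2fun (k *: eta) (q2 z) = k * L2fun eta (q2 z) by near: z.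
have -> : L2fun (k *: t xi eta + t xi eta') z = L2fun (k *: t xi eta) z + L2fun (t xi eta') z.
  by near: z.
have -> : L2fun (k *: t xi eta) z = k * L2fun (t xi eta) z by near: z.
have -> : L2fun (t xi eta) z = L2fun xi (q1 z) * L2fun eta (q2 z) by near: z.
have -> : L2fun (t xi eta') z = L2fun xi (q1 z) * L2fun eta' (q2 z) by near: z.
by rewrite mulrDr mulrCA.
Unshelve. all: by end_near. Qed.

(** Says that [h] is the density over [nu] of the image under [i1] of xi xi'^*, tested on integrable
    nonnegative weights. For truncated weights this is the definition of the bracket; the general
    case is a limit. *)
Lemma bracket_weight xi xi' h (psi : X -> R) : D xi -> D xi' ->
  bracket nu (mult_rep rho1 i1) xi xi' h ->
  measurable_fun setT psi -> (forall x, 0 <= psi x) -> (\int[nu]_x (psi x)%:E < +oo)%E ->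
  cintegrable rho1 (fun y => L2fun xi y * (L2fun xi' y)^* * (psi (i1 y))%:C) /\
  cintegrable nu (fun x => h x * (psi x)%:C) /\
  cint rho1 (fun y => L2fun xi y * (L2fun xi' y)^* * (psi (i1 y))%:C) =
  cint nu (fun x => h x * (psi x)%:C).
Proof.
move=> Dx Dx' [hb Hh] mpsi psi0 psioo.
have nuleg : leg nu nu id by split => //; exact: measurable_id.
have psii : nu.-integrable setT (EFin \o psi) by exact: integrable_EFin.
have ci2 : cintegrable nu (fun x => h x * (psi x)%:C).
  apply: cintegrable_mul; first exact: (Linf_essbounded nuleg hb).
  by split => //; exact: integrable0.
have mf : cmeas (fun y => L2fun xi y * (L2fun xi' y)^*).
  by apply: cmeasM; [|apply: cmeas_conj]; exact: L2fun_meas.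
have reM (z : R[i]) (c : R) : re (z * c%:C) = re z * c.
  by case: z => a b /=; rewrite mulr0 subr0.
have imM (z : R[i]) (c : R) : im (z * c%:C) = im z * c.
  by case: z => a b /=; rewrite mulr0 add0r.
have ci1 (w : X -> R) : measurable_fun setT w -> (forall x, 0 <= w x) ->
    (\int[nu]_x (w x)%:E < +oo)%E ->
    cintegrable rho1 (fun y => L2fun xi y * (L2fun xi' y)^* * (w (i1 y))%:C).
  move=> mw w0 woo.
  have bd (eta : L2 rho1) : D eta ->
      rho1.-integrable setT (EFin \o (fun y => csq (L2fun eta y) * w (i1 y))).
    move=> /(bounded_vector_density lg1)[k [k0 kb]]; apply: integrable_EFin.
    - apply: measurable_funM; first exact: (cmeas_csq (L2fun_meas eta)).
      exact: measurableT_comp.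
    - by move=> y; rewrite mulr_ge0 ?csq_ge0.
    under eq_integral do rewrite mulrC EFinM.
    apply: le_lt_trans (kb _ (nnmeas_EFin mw w0)) _.
    by rewrite lte_mul_pinfty ?lee_fin.
  apply: (@le_cintegrable _ _ _ _ _ (fun y => csq (L2fun xi y) * w (i1 y) +
    csq (L2fun xi' y) * w (i1 y))).
  - by apply: cmeasM => //; apply: cmeas_real; exact: measurableT_comp.
  - rewrite (_ : _ \o _ = (EFin \o (fun y => csq (L2fun xi y) * w (i1 y))%R) \+
      (EFin \o (fun y => csq (L2fun xi' y) * w (i1 y))%R))%E//.
    by apply: integrableD => //; exact: bd.
  - by move=> y; rewrite reM normrM (ger0_norm (w0 _)) -mulrDl ler_wpM2r// norm_re_mul.
  - by move=> y; rewrite imM normrM (ger0_norm (w0 _)) -mulrDl ler_wpM2r// norm_im_mul.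
have ci0 := ci1 _ mpsi psi0 psioo.
split => //; split => //.
pose w k x := psi x * (psi x <= k%:R)%R%:R.
have mw k : measurable_fun setT (w k).
  apply: measurable_funM => //.
  rewrite (_ : (fun x => _) = \1_[set x | psi x <= k%:R]).
    apply: measurable_indic; rewrite -[X in measurable X]setTI.
    exact: measurable_fun_le.
  by apply/funext => x; rewrite indicE; congr ((nat_of_bool _)%:R); apply/idP/idP; rewrite inE.
have w0 k x : 0 <= w k x by rewrite mulr_ge0.
have wk k x : w k x <= k%:R.
  by rewrite /w; have [h'|_] := boolP (psi x <= k%:R); rewrite ?mulr1 ?mulr0 ?ler0n.
have wpsi k x : w k x <= psi x by rewrite ler_piMr//; case: (psi x <= k%:R).
have Ek k : cint rho1 (fun y => L2fun xi y * (L2fun xi' y)^* * (w k (i1 y))%:C) =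
    cint nu (fun x => h x * (w k x)%:C).
  (* The truncated weight is the product of [n] and its conjugate. It is bounded and integrable, so
     [n] belongs to [Linf2] and may be inserted in both arguments of the bracket. *)
  pose n x := (Num.sqrt (w k x))%:C : R[i].
  have ms : measurable_fun setT (fun x => Num.sqrt (w k x)).
    by apply: measurableT_comp => //; exact: measurable_sqrtr.
  have mn : cmeas n by exact: cmeas_real.
  have nb : Linf nu n.
    split; [exact: mn.1|exact: mn.2|exists (Num.sqrt k%:R)%:C; apply: aeW => x].
    by rewrite normc_csq csqR sqr_sqrtr// lecR ler_sqrt ?ler0n.
  have n2 : Linf2 nu n.
    split => //; apply/sqintP; split => //.
    apply: le_lt_trans psioo; apply: le_nnmeas_integral; first exact: nnmeas_csq.
      exact: nnmeas_EFin.
    by move=> x; rewrite csqR sqr_sqrtr// lee_fin.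
  have sw x : n x * (n x)^* = (w k x)%:C by rewrite mulz_conj csqR sqr_sqrtr.
  have := Hh n n n2 n2; under [in RHS]eq_fun do rewrite -mulrA sw.
  move=> <-; have bn := Linf_essbounded lg1 nb.
  rewrite L2ipE; apply: eq_cint.
  - apply: ci1 => //; apply: le_lt_trans psioo.
    by apply: le_nnmeas_integral => [||x]; [exact: nnmeas_EFin|exact: nnmeas_EFin|rewrite lee_fin].
  - by apply: sqint_cintegrable; exact: L2fun_sqint.
  - apply: filterS2 (mulop_fun xi bn) (mulop_fun xi' bn) => y -> ->.
    rewrite -sw; move: (n (i1 y)) (L2fun xi y) (L2fun xi' y) => [a b] [c e] [k' l].
    by congr (_ +i* _) => /=; ring.
have mh := (Linf_csq hb).1; have mpi := measurableT_comp mpsi mi1.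
have rew (dT : measure_display) (T : measurableType dT) (m : {measure set T -> \bar R})
    (p : R[i] -> R) (F : T -> R[i]) (w' : T -> R) :
    (forall z c, p (z * c%:C) = p z * c) ->
    m.-integrable setT (EFin \o (p \o (fun x => F x * (w' x)%:C))) ->
    m.-integrable setT (EFin \o (fun x => p (F x) * w' x)).
  by move=> pM; congr integrable; apply/funext => x /=; rewrite pM.
have lim_eq (p : R[i] -> R) : (forall z c, p (z * c%:C) = p z * c) ->
    measurable_fun setT (p \o (fun y => L2fun xi y * (L2fun xi' y)^*)) ->
    measurable_fun setT (p \o h) ->
    rho1.-integrable setT (EFin \o (p \o (fun y => L2fun xi y * (L2fun xi' y)^* * (psi (i1 y))%:C))) ->
    nu.-integrable setT (EFin \o (p \o (fun x => h x * (psi x)%:C))) ->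
    (forall k, \int[rho1]_y p (L2fun xi y * (L2fun xi' y)^* * (w k (i1 y))%:C) =
       \int[nu]_x p (h x * (w k x)%:C)) ->
    \int[rho1]_y p (L2fun xi y * (L2fun xi' y)^* * (psi (i1 y))%:C) =
    \int[nu]_x p (h x * (psi x)%:C).
  move=> pM m1 m2 j1 j2 Epk.
  have c1 := trunc_weight_cvg m1 mpi (fun y => psi0 _) (rew _ _ _ _ _ _ pM j1).
  have c2 := trunc_weight_cvg m2 mpsi psi0 (rew _ _ _ _ _ _ pM j2).
  under eq_Rintegral do rewrite pM.
  under [RHS]eq_Rintegral do rewrite pM.
  apply: cvg_unique c1 _ => //; apply: cvg_trans c2.
  apply: near_eq_cvg; apply: nearW => k.
  have := Epk k; under eq_Rintegral do rewrite pM.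
  by under [in RHS]eq_Rintegral do rewrite pM.
rewrite /cint; congr (_ +i* _); apply: lim_eq => //.
- exact: mf.1.
- exact: mh.1.
- exact: ci0.1.
- exact: ci2.1.
- by move=> k; have [] := Ek k.
- exact: mf.2.
- exact: mh.2.
- exact: ci0.2.
- exact: ci2.2.
- by move=> k; have [] := Ek k.
Qed.

(** By polarization it suffices to take equal second arguments; their squared modulus then has a
    nonnegative density [psi] over [nu], and both sides become integrals against [psi]. *)
Lemma tens_ip xi xi' eta eta' h : D xi -> D xi' -> bracket nu (mult_rep rho1 i1) xi xi' h ->
  ip (t xi eta) (t xi' eta') = ip (mult_rep rho2 i2 h eta) eta'.
Proof.
move=> Dx Dx' br; have hb : Linf nu h by case: br.
have b2 := Linf_essbounded lg2 hb.
apply/eqP; rewrite -subr_eq0; apply/eqP.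
pose B (u v : L2 rho2) : R[i] := ip (t xi u) (t xi' v) - ip (mult_rep rho2 i2 h u) v.
apply: (@sesqui_diag _ _ B) => [k u u' v|k u v v'|u]; rewrite {}/B.
- have -> : mult_rep rho2 i2 h (k *: u + u') =
    k *: mult_rep rho2 i2 h u + mult_rep rho2 i2 h u' := mulop_linear b2 k u u'.
  rewrite tens_linr// !linearDl /= !linearZl /=; ring.
- rewrite tens_linr// !linearDr /= !linearZr /=; ring.
have [psi [Dpsi psioo]] := sqint_density u; have [mpsi psi0 C2] := Dpsi.
have mu2 := cmeas_csq (L2fun_meas u).
have C := fibprod_chg snu lg1 P mu2 (fun y => csq_ge0 _) Dpsi.
have [ci1 [ci2 E]] := bracket_weight Dx Dx' br mpsi psi0 psioo.
apply/eqP; rewrite subr_eq0; apply/eqP.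
have mf : cmeas (fun y => L2fun xi y * (L2fun xi' y)^*).
  by apply: cmeasM; [|apply: cmeas_conj]; exact: L2fun_meas.
have [j1 E1] := chg_cint (measurableT_comp mu2 mq2) (fun z => csq_ge0 _)
  (measurableT_comp mpsi mi1) (fun y => psi0 _) mq1 C mf ci1.
have [j2 E2] := chg_cint mu2 (fun z => csq_ge0 _) mpsi psi0 mi2 C2 (Linf_csq hb).1 ci2.
transitivity (cint M (fun z => L2fun xi (q1 z) * (L2fun xi' (q1 z))^* * (csq (L2fun u (q2 z)))%:C)).
  rewrite L2ipE; apply: eq_cint => //.
    by apply: sqint_cintegrable; exact: L2fun_sqint.
  apply: filterS2 (tens_fun u Dx) (tens_fun u Dx') => z -> ->.
  rewrite -mulz_conj; move: (L2fun u _) (L2fun xi _) (L2fun xi' _) => [a b] [c e] [k' l].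
  by congr (_ +i* _) => /=; ring.
rewrite [LHS]E1 E -[LHS]E2 L2ipE; apply: eq_cint => //.
  by apply: sqint_cintegrable; exact: L2fun_sqint.
by apply: filterS (mulop_fun u b2) => y ->; rewrite -mulz_conj mulrA.
Qed.

(** Indicator functions of rectangles are elementary tensors; a Dynkin argument inside the closed
    span reaches all measurable subsets of the sets [W n], on which everything is
    square-integrable. *)
Lemma tens_dense : dense_span [set t xi eta | xi in D & eta in [set: L2 rho2]].
Proof.
have [A [k [mA ndA AT Aoo /all_and2[k0 Ak]]]] := leg_cover snu lg1.
have [_ /sigma_finiteP[S [ST ndS /all_and2[mS Soo]]] _] := lg2.
have mqA B : measurable B -> measurable (q1 @^-1` B).
  by move=> mB; rewrite -[X in measurable X]setTI; exact: mq1.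
have mqS B : measurable B -> measurable (q2 @^-1` B).
  by move=> mB; rewrite -[X in measurable X]setTI; exact: mq2.
pose W n := q1 @^-1` A n `&` q2 @^-1` S n.
have mW n : measurable (W n) by apply: measurableI; [exact: mqA|exact: mqS].
(* Intersecting with [A n] makes the first factor left bounded, and with [S n] the second one
   square-integrable. *)
have rect n B1 B2 : measurable B1 -> measurable B2 ->
    exists2 v, [set t xi eta | xi in D & eta in [set: L2 rho2]] v &
    (fun z => (\1_((q1 @^-1` B1 `&` q2 @^-1` B2) `&` W n) z)%:C) \in sqint M /\
    v = rcls M \1_((q1 @^-1` B1 `&` q2 @^-1` B2) `&` W n).
  move=> mB1 mB2.
  have m1 : measurable (B1 `&` A n) by exact: measurableI.
  have m2 : measurable (B2 `&` S n) by exact: measurableI.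
  have P1 : (fun y => (\1_(B1 `&` A n) y)%:C) \in sqint rho1.
    apply: indic_sqint => //; apply: le_lt_trans (Aoo n).
    by apply: le_measure; rewrite ?inE//; exact: subIsetr.
  have P2 : (fun y => (\1_(B2 `&` S n) y)%:C) \in sqint rho2.
    apply: indic_sqint => //; apply: le_lt_trans (Soo n).
    by apply: le_measure; rewrite ?inE//; exact: subIsetr.
  have Dx : D (rcls rho1 \1_(B1 `&` A n)).
    apply/(bounded_vector_density lg1); exists (k n); split => // F nF.
    apply: le_trans (Ak n F nF).
    have [g1 g2] := nnmeas_csq (L2fun_meas (rcls rho1 \1_(B1 `&` A n))).
    have [h1 h2] := nnmeas_comp mi1 nF.
    apply: ae_ge0_le_integral => //.
    - by move=> y _; apply: mule_ge0; [exact: h2|exact: g2].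
    - exact: emeasurable_funM.
    - by move=> y _; apply: mule_ge0; [exact: h2|rewrite lee_fin].
    - by apply: emeasurable_funM => //; apply/measurable_EFinP; exact: measurable_indic.
    - apply: filterS (L2fun_cls P1) => y /= -> _; apply: lee_wpmul2l; first exact: h2.
      rewrite lee_fin csqR !indicE in_setI; case: (y \in B1) => /=; case: (y \in A n);
        by rewrite ?expr1n ?expr0n.
  have indE z : (\1_(B1 `&` A n) (q1 z))%:C * (\1_(B2 `&` S n) (q2 z))%:C =
      (\1_((q1 @^-1` B1 `&` q2 @^-1` B2) `&` W n) z)%:C :> R[i].
    rewrite -rmorphM !indicE -natrM mulnb; congr ((nat_of_bool _)%:R%:C).
    by rewrite /W !in_setI !in_preimage andbACA.
  have mI : measurable ((q1 @^-1` B1 `&` q2 @^-1` B2) `&` W n).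
    by apply: measurableI => //; apply: measurableI; [exact: mqA|exact: mqS].
  have aeE : {ae M, forall z, L2fun (rcls rho1 \1_(B1 `&` A n)) (q1 z) *
      L2fun (rcls rho2 \1_(B2 `&` S n)) (q2 z) =
      (\1_((q1 @^-1` B1 `&` q2 @^-1` B2) `&` W n) z)%:C}.
    apply: filterS2 (fibprod_ae1 (L2fun_cls P1)) (fibprod_ae2 (L2fun_cls P2)) => z -> ->.
    exact: indE.
  exists (t (rcls rho1 \1_(B1 `&` A n)) (rcls rho2 \1_(B2 `&` S n))).
    by exists (rcls rho1 \1_(B1 `&` A n)) => //; exists (rcls rho2 \1_(B2 `&` S n)).
  split.
    apply: eq_sqint aeE (tens_sqint _ Dx).
    by apply: cmeas_real; exact: measurable_indic.
  apply: L2cls_eq => //; last by apply: cmeas_real; exact: measurable_indic.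
  by apply: cmeasM; [apply: (cmeas_comp mq1)|apply: (cmeas_comp mq2)]; exact: L2fun_meas.
have WP n : (fun z => (\1_(W n) z)%:C) \in sqint M.
  have [_ _ [+ _]] := rect n _ _ measurableT measurableT.
  by rewrite !preimage_setT !setTI.
have EP n E : measurable E -> (fun z => (\1_(E `&` W n) z)%:C) \in sqint M.
  move=> mE; apply: sqint_le (WP n) _ => [|z].
    by apply: cmeas_real; apply: measurable_indic; exact: measurableI.
  rewrite !csqR !indicE in_setI; case: (z \in E) => //=.
  by rewrite expr0n sqr_ge0.
apply: dense_span_l2closure; apply: (l2closure_total mW).
- move=> m n mn; apply/subsetPset => z [Az Sz]; split.
    by have /subsetPset := ndA _ _ mn; exact.
  by have /subsetPset := ndS _ _ mn; exact.
- rewrite -subTset => z _.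
  have [n _ An] : (\bigcup_n A n) (q1 z) by rewrite AT.
  have [l _ Sl] : (\bigcup_n S n) (q2 z) by rewrite -ST.
  exists (maxn n l) => //; split.
    by have /subsetPset := ndA _ _ (leq_maxl n l); exact.
  by have /subsetPset := ndS _ _ (leq_maxr n l); exact.
move=> n E mE; have [_ _ [q [mq qK]] _] := P.
pose p z := (q1 z, q2 z).
have mp : measurable_fun setT p by exact: measurable_fun_pair.
have mpE (F : set (Y1 * Y2)) : measurable F -> measurable (p @^-1` F).
  by move=> mF; rewrite -[X in measurable X]setTI; exact: mp.
have mE' : measurable (q @^-1` E) by rewrite -[X in measurable X]setTI; exact: mq.
(* Because of the left inverse [q], every measurable set of [Z] is the preimage of a measurable set
   of the product, so rectangles generate. *)
have -> : E = p @^-1` (q @^-1` E) by apply/seteqP; split => z; rewrite /p /= qK.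
set cl := l2closure _.
pose G := [set B1 `*` B2 | B1 in measurable & B2 in measurable] : set (set (Y1 * Y2)).
pose PP (F : set (Y1 * Y2)) := cl (rcls M \1_(p @^-1` F `&` W n)).
have inW F z : (z \in p @^-1` F `&` W n) = (p z \in F) && (z \in W n).
  by rewrite in_setI in_preimage.
have GE : @measurable _ (Y1 * Y2)%type = <<s G >> := measurable_prod_measurableType Y1 Y2.
have GP : G `<=` PP.
  move=> _ [B1 mB1 [B2 mB2 <-]]; rewrite /PP.
  have [v Av [_ vE]] := rect n _ _ mB1 mB2.
  by apply: sub_l2closure; rewrite -vE.
have PT : PP setT.
  by apply: GP; exists setT => //; exists setT => //; rewrite setXTT.
suff H : forall F, <<s G >> F -> PP F by apply: H; rewrite -GE.
apply: (dynkin_induction GE) => //.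
- move=> _ _ [B1 mB1 [B2 mB2 <-]] [C1 mC1 [C2 mC2 <-]].
  exists (B1 `&` C1); first exact: measurableI.
  by exists (B2 `&` C2); [exact: measurableI|rewrite setXI].
- move=> F mF PF; rewrite /PP.
  have -> : rcls M \1_(p @^-1` (~` F) `&` W n) =
      rcls M \1_(p @^-1` setT `&` W n) + (-1)%:C *: rcls M \1_(p @^-1` F `&` W n).
    rewrite -rcls_lin; [|exact/EP/mpE/measurableT|exact/EP/mpE].
    congr rcls; apply/funext => z; rewrite !indicE !inW in_setT.
    rewrite (_ : (p z \in ~` F) = ~~ (p z \in F)); last first.
      by apply/idP/negP; rewrite !inE.
    by case: (p z \in F); case: (z \in W n) => /=; ring.
  by apply: l2closureD; [exact: PT|apply: l2closureZ; exact: PF].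
- move=> F mF tF PF; rewrite /PP.
  (* Finite disjoint unions are handled by linearity, and the countable union by dominated
     convergence in norm. *)
  pose U N := \bigcup_(j in `I_N) F j.
  have mU N : measurable (U N) by apply: bigcup_measurable => j _; exact: mF.
  have PU N : cl (rcls M \1_(p @^-1` U N `&` W n)).
    elim: N => [|N IH].
      rewrite /U II0 bigcup_set0 preimage_set0 set0I.
      have -> : rcls M \1_set0 = 0%:C *: rcls M \1_(W n).
        rewrite -(add0r (_ *: _)) -[X in X + _](subrr (rcls M \1_(W n))) -addrA.
        have := rcls_lin (-1) (WP n) (WP n).
        have -> : (fun z => \1_(W n) z + -1 * \1_(W n) z) = \1_set0 :> (Z -> R).
          by apply/funext => z; rewrite mulN1r subrr indic0.
        by move=> ->; rewrite rmorph0 scale0r addr0 rmorphN1 scaleN1r.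
      apply: l2closureZ; move: PT; rewrite /PP preimage_setT setTI; exact.
    have -> : rcls M \1_(p @^-1` U N.+1 `&` W n) =
        rcls M \1_(p @^-1` U N `&` W n) + 1%:C *: rcls M \1_(p @^-1` F N `&` W n).
      rewrite -rcls_lin; [|exact/EP/mpE|exact/EP/mpE].
      congr rcls; apply/funext => z; rewrite !indicE !inW mul1r.
      have -> : U N.+1 = U N `|` F N by rewrite /U IIS bigcup_setU bigcup_set1.
      rewrite in_setU; case: (boolP (p z \in U N)) => [|_ /=]; last by rewrite add0r.
      rewrite inE => -[j /= jN Fj]; rewrite (_ : p z \in F N = false) ?addr0//.
      apply/negP; rewrite inE => FN.
      move/trivIsetP : tF => /(_ j N Logic.I Logic.I); rewrite (ltn_eqF jN) => /(_ isT).
      by move=> /seteqP[+ _] => /(_ (p z)); apply.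
    by apply: l2closureD => //; apply: l2closureZ; exact: PF.
  have mUF : measurable (\bigcup_j F j) by apply: bigcup_measurable => j _; exact: mF.
  have [|||_ conv] := @rcls_cvg _ _ _ M _ (fun N => \1_(p @^-1` U N `&` W n)) (EP n _ (mpE _ mUF)).
  + by move=> N; apply: measurable_indic; apply: measurableI => //; exact: mpE.
  + move=> N z; rewrite indicE ler0n indicE ler_nat !inW.
    case: (z \in W n); rewrite ?andbF ?andbT//=.
    case: (boolP (p z \in U N)) => //; rewrite inE => -[j _ Fj].
    by rewrite mem_set//; exists j.
  + move=> z; apply: cvg_near_cst.
    have [[j _ Fj]|nF] := pselect ((\bigcup_j F j) (p z)).
      exists j.+1 => // N /= jN; rewrite !indicE !inW.
      have -> : p z \in U N by rewrite inE; exists j.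
      by have -> : p z \in \bigcup_j F j by rewrite inE; exists j.
    exists 0%N => // N _; rewrite !indicE !inW.
    have -> : (p z \in U N) = false by apply/negP; rewrite inE => -[j _ Fj]; apply: nF; exists j.
    by have -> : (p z \in \bigcup_j F j) = false by apply/negP; rewrite inE.
  apply: l2closure_lim => e e0; have [N HN] := conv e e0.
  exists (rcls M \1_(p @^-1` U N `&` W n)); [exact: PU|exact: HN].
Qed.

Theorem tens_relative_tensor :
  relative_tensor nu (mult_rep rho1 i1) (mult_rep rho2 i2) t.
Proof.
split.
- exact: hilbert_L2.
- exact: tens_linl.
- by move=> k xi eta eta' Dx; exact: tens_linr.
- by move=> xi xi' eta eta' h Dx Dx' br; exact: tens_ip.
- exact: tens_dense.
Qed.

End RelativeTensor.

(** * Kernels and iterated integrals *)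

Section Kernels.
Context d1 d2 (Y1 : measurableType d1) (Y2 : measurableType d2) (R : realType).
Implicit Types K : Y1 -> {measure set Y2 -> \bar R}.

(* The sets S n make the kernel s-finite, and the condition is stable by
   composition with a measurable map into Y1. *)
Definition skernel K := (forall E, measurable E -> measurable_fun setT (fun y => K y E)) /\
  exists S : (set Y2)^nat, [/\ forall n, measurable (S n), nondecreasing_seq S,
    \bigcup_n S n = setT & forall n y, (K y (S n) < +oo)%E].

Lemma skernel_sigma_finite K y : skernel K -> sigma_finite setT (K y).
Proof. by move=> [_ [S [mS ndS ST Soo]]]; exists S. Qed.

(** The sections are cut by [S n], so that complements in the Dynkin argument become differences of
    finite quantities; the limit in [n] restores the full kernel. *)
Lemma skernel_integral K F : skernel K -> nnmeas F ->
  nnmeas (fun y => \int[K y]_z F (y, z))%E.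
Proof.
move=> [mK [S [mS ndS ST Soo]]] nF; split; last first.
  by move=> y; apply: integral_ge0 => z _; exact: nF.2.
have limE (E : set Y2) y : measurable E -> (K y (E `&` S n) @[n --> \oo] --> K y E)%E.
  move=> mE; have {2}-> : E = \bigcup_n (E `&` S n) by rewrite -setI_bigcupr ST setIT.
  apply: nondecreasing_cvg_mu => [n||m n mn]; first exact: measurableI.
    by apply: bigcup_measurable => n _; exact: measurableI.
  by apply/subsetPset; apply: setIS; apply/subsetPset; exact: ndS.
elim/nnmeas_ind: F / nF.
- move=> E mE.
  have -> : (fun y => \int[K y]_z (\1_E (y, z))%:E)%E = (fun y => K y (xsection E y)).
    apply/funext => y; rewrite -[X in _ = K y X]setIT -integral_indic//; last exact: measurable_xsection.
    by apply: eq_integral => z _; rewrite !indicE mem_xsection.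
  apply: (emeasurable_fun_cvg (fun n y => K y (xsection E y `&` S n))) => [n|y _]; last first.
    by apply: limE; exact: measurable_xsection.
  pose G := [set B1 `*` B2 | B1 in measurable & B2 in measurable] : set (set (Y1 * Y2)).
  have GE : @measurable _ (Y1 * Y2)%type = <<s G >> := measurable_prod_measurableType Y1 Y2.
  suff H : forall F, <<s G >> F -> measurable_fun setT (fun y => K y (xsection F y `&` S n)).
    by apply: H; rewrite -GE.
  have GP : G `<=` [set F | measurable_fun setT (fun y => K y (xsection F y `&` S n))].
    move=> _ [B1 mB1 [B2 mB2 <-]] /=.
    have -> : (fun y => K y (xsection (B1 `*` B2) y `&` S n)) =
        (fun y => (\1_B1 y)%:E * K y (B2 `&` S n))%E.
      apply/funext => y; rewrite indicE; have [yB|yB] := boolP (y \in B1).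
        by rewrite in_xsectionX// mul1e.
      by rewrite notin_xsectionX// set0I measure0 mul0e.
    apply: emeasurable_funM; first by apply/measurable_EFinP; exact: measurable_indic.
    by apply: mK; exact: measurableI.
  apply: (dynkin_induction GE) => //.
  + move=> _ _ [B1 mB1 [B2 mB2 <-]] [C1 mC1 [C2 mC2 <-]].
    exists (B1 `&` C1); first exact: measurableI.
    by exists (B2 `&` C2); [exact: measurableI|rewrite setXI].
  + by apply: GP; exists setT => //; exists setT => //; rewrite setXTT.
  + move=> F mF PF.
    have -> : (fun y => K y (xsection (~` F) y `&` S n)) =
        (fun y => K y (S n) - K y (xsection F y `&` S n))%E.
      apply/funext => y; rewrite (_ : xsection (~` F) y = ~` xsection F y); last by rewrite !xsectionE preimage_setC.
      rewrite setIC -setDE measureD//.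
      * by rewrite setIC.
      * exact: measurable_xsection.
      * exact: Soo.
    by apply: emeasurable_funB => //; exact: mK.
  + move=> F mF tF PF.
    have -> : (fun y => K y (xsection (\bigcup_k F k) y `&` S n)) =
        (fun y => \sum_(k <oo) K y (xsection (F k) y `&` S n))%E.
      apply/funext => y; rewrite xsection_bigcup setI_bigcupl.
      rewrite measure_semi_bigcup//.
      * by move=> k; apply: measurableI => //; exact: measurable_xsection.
      * by apply: trivIset_setIr; exact: trivIset_xsection.
      * apply: bigcup_measurable => k _; apply: measurableI => //.
        exact: measurable_xsection.
    by apply: ge0_emeasurable_sum => // k _; exact: PF.
- move=> f g nf ng mf mg.
  have -> : (fun y => \int[K y]_z (f \+ g) (y, z))%E =
      (fun y => \int[K y]_z f (y, z) + \int[K y]_z g (y, z))%E.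
    apply/funext => y; rewrite ge0_integralD//.
    + by move=> z _; exact: nf.2.
    + by apply: measurableT_comp nf.1 _; exact: measurable_pair1.
    + by move=> z _; exact: ng.2.
    + by apply: measurableT_comp ng.1 _; exact: measurable_pair1.
  exact: emeasurable_funD.
- move=> c f c0 nf mf.
  have -> : (fun y => \int[K y]_z (c%:E * f (y, z)))%E =
      (fun y => c%:E * \int[K y]_z f (y, z))%E.
    apply/funext => y; rewrite ge0_integralZl ?lee_fin//.
    + by apply: measurableT_comp nf.1 _; exact: measurable_pair1.
    + by move=> z _; exact: nf.2.
  by apply: emeasurable_funM => //; exact: measurable_cst.
- move=> f_ nf mf nd.
  have mn n y : measurable_fun setT (fun z => f_ n (y, z)).
    by apply: measurableT_comp (nf n).1 _; exact: measurable_pair1.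
  apply: (emeasurable_fun_cvg (fun n y => \int[K y]_z f_ n (y, z))%E) => // y _.
  rewrite (monotone_convergence (K y) measurableT (fun n => mn n y)
    (fun n z _ => (nf n).2 (y, z)) (fun z _ => nd (y, z))).
  apply: ereal_nondecreasing_is_cvgn => m n le_mn; apply: ge0_le_integral => //.
  + by move=> z _; exact: (nf m).2.
  + by move=> z _; exact: nd.
Qed.

End Kernels.

Lemma skernel_comp d0 d1 d2 (Y0 : measurableType d0) (Y1 : measurableType d1)
    (Y2 : measurableType d2) (R : realType) (j : Y0 -> Y1) (K : Y1 -> {measure set Y2 -> \bar R}) :
  measurable_fun setT j -> skernel K -> skernel (fun y => K (j y)).
Proof.
move=> mj [mK [S [mS ndS ST Soo]]]; split.
  by move=> E mE; exact: (measurableT_comp (mK E mE) mj).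
by exists S; split.
Qed.

(** The bare measures are repackaged as s-finite ones, the structure in which the library states
    Fubini's theorem. *)
Lemma tonelli d1 d2 (Y1 : measurableType d1) (Y2 : measurableType d2) (R : realType)
    (m1 : {measure set Y1 -> \bar R}) (m2 : {measure set Y2 -> \bar R}) F :
  sigma_finite setT m1 -> sigma_finite setT m2 -> nnmeas F ->
  (\int[m1]_x \int[m2]_y F (x, y) = \int[m2]_y \int[m1]_x F (x, y))%E.
Proof.
move=> s1 s2 [mF F0].
pose m1' := HB.pack_for (SFiniteMeasure.type Y1 R) (Measure.sort m1)
  (isSFinite.Build _ _ _ _ (sfinite_measure_sigma_finite s1)).
pose m2' := HB.pack_for (SFiniteMeasure.type Y2 R) (Measure.sort m2)
  (isSFinite.Build _ _ _ _ (sfinite_measure_sigma_finite s2)).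
exact: (@sfinite_Fubini _ _ _ _ _ m1' m2').
Qed.

Section KProd.
Context d1 d2 dZ (Y1 : measurableType d1) (Y2 : measurableType d2) (Z : measurableType dZ).
Context (R : realType).

(* M is the measure rho(dy) K_y(dy') on Z, identified with Y1 * Y2 by (q1, q2). *)
Definition kprod (rho : {measure set Y1 -> \bar R}) (K : Y1 -> {measure set Y2 -> \bar R})
    (M : {measure set Z -> \bar R}) (q1 : Z -> Y1) (q2 : Z -> Y2) :=
  [/\ measurable_fun setT q1, measurable_fun setT q2,
      exists q : Y1 * Y2 -> Z, measurable_fun setT q /\ forall z, q (q1 z, q2 z) = z
    & forall F : Y1 * Y2 -> \bar R, nnmeas F ->
        (\int[M]_z F (q1 z, q2 z) = \int[rho]_y \int[K y]_y' F (y, y'))%E].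

(** Each [K y] is pushed into [Z] by [q (y, _)] as a mixture of Dirac masses, and the results are
    mixed over [rho]. *)
Lemma kprod_ex rho K (q1 : Z -> Y1) (q2 : Z -> Y2) (q : Y1 * Y2 -> Z) : skernel K ->
  measurable_fun setT q1 -> measurable_fun setT q2 -> measurable_fun setT q ->
  (forall z, q (q1 z, q2 z) = z) -> (forall y, q1 (q y) = y.1) -> (forall y, q2 (q y) = y.2) ->
  exists M, kprod rho K M q1 q2.
Proof.
move=> sK mq1 mq2 mq qK q1K q2K.
have mqy y : measurable_fun setT (fun y' => q (y, y')).
  by apply: measurableT_comp mq _; exact: measurable_pair1.
have mdir y : measurable_family (fun y' => dirac (q (y, y')) : {measure set Z -> \bar R}).
  move=> F [mF F0]; under eq_fun do rewrite integral_dirac// diracT mul1e.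
  exact: measurableT_comp mF (mqy y).
pose K' y := mixm (K y) (mdir y).
have K'E y F : nnmeas F -> (\int[K' y]_z F z = \int[K y]_y' F (q (y, y')))%E.
  move=> nF; rewrite (integral_mixm _ (mdir y) nF).
  by apply: eq_integral => y' _; rewrite integral_dirac ?diracT ?mul1e//; case: nF.
have mK' : measurable_family K'.
  move=> F nF; under eq_fun do rewrite K'E//.
  exact: (skernel_integral sK (nnmeas_comp mq nF)).1.
exists (mixm rho mK'); split => //; first by exists q.
move=> F nF; rewrite (integral_mixm _ mK'); last first.
  by apply: (nnmeas_comp _ nF); exact: measurable_fun_pair.
apply: eq_integral => y _; rewrite K'E; last first.
  by apply: (nnmeas_comp _ nF); exact: measurable_fun_pair.
by apply: eq_integral => y' _; rewrite q1K q2K.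
Qed.

End KProd.

(** Having [i y] on one side and [u] on the other also encodes that [kappa u] is carried by the
    fibre of [i] over [u]. *)
Definition disint dX dY (X : measurableType dX) (Y : measurableType dY) (R : realType)
    (nu : {measure set X -> \bar R}) (mu : {measure set Y -> \bar R}) (i : Y -> X)
    (kappa : X -> {measure set Y -> \bar R}) :=
  forall F : X * Y -> \bar R, nnmeas F ->
    (\int[mu]_y F (i y, y) = \int[nu]_u \int[kappa u]_y F (u, y))%E.

Section KProdTheory.
Context dX (X : measurableType dX) (R : realType) (nu : {measure set X -> \bar R}).

(** Once the second leg is integrated, [f2] has become a function of [i1 y], which [phi1] brings to
    [nu]; the disintegration of [rho2] reassembles it, and [phi2] finishes. *)
Lemma kprod_fibprod d1 d2 dZ (Y1 : measurableType d1) (Y2 : measurableType d2)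
    (Z : measurableType dZ) (rho1 : {measure set Y1 -> \bar R}) (i1 : Y1 -> X)
    (rho2 : {measure set Y2 -> \bar R}) (i2 : Y2 -> X) (kappa : X -> {measure set Y2 -> \bar R})
    (M : {measure set Z -> \bar R}) (q1 : Z -> Y1) (q2 : Z -> Y2) :
  skernel kappa -> measurable_fun setT i1 -> measurable_fun setT i2 ->
  disint nu rho2 i2 kappa -> kprod rho1 (fun y => kappa (i1 y)) M q1 q2 ->
  fibprod nu rho1 i1 rho2 i2 M q1 q2.
Proof.
move=> sk mi1 mi2 dis [mq1 mq2 mq kp]; split => //.
move=> f1 f2 phi1 phi2 mf1 f10 mf2 f20 [mp1 p10 C1] [mp2 p20 C2].
have nf1 := nnmeas_EFin mf1 f10; have nf2 := nnmeas_EFin mf2 f20.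
have np1 := nnmeas_EFin mp1 p10.
have -> : (\int[M]_z (f1 (q1 z) * f2 (q2 z))%:E =
    \int[M]_z ((EFin \o f1) (q1 z) * (EFin \o f2) (q2 z)))%E.
  by apply: eq_integral => z _; rewrite EFinM.
have nF : nnmeas (fun y : Y1 * Y2 => (EFin \o f1) y.1 * (EFin \o f2) y.2)%E.
  by apply: nnmeasM; [exact: (nnmeas_comp measurable_fst nf1)|exact: (nnmeas_comp measurable_snd nf2)].
rewrite (kp _ nF).
have nH : nnmeas (fun u => \int[kappa u]_y (EFin \o f2) y)%E.
  exact: (skernel_integral sk (nnmeas_comp measurable_snd nf2)).
transitivity (\int[rho1]_y ((\int[kappa (i1 y)]_y' (EFin \o f2) y') * (f1 y)%:E))%E.
  apply: eq_integral => y _; rewrite [RHS]muleC.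
  have f1y : (0 <= (f1 y)%:E)%E by rewrite lee_fin.
  exact: (ge0_integralZl (kappa (i1 y)) measurableT nf2.1 (fun y' _ => nf2.2 y') f1y).
rewrite (C1 _ nH).
have nG : nnmeas (fun p : X * Y2 => (EFin \o phi1) p.1 * (EFin \o f2) p.2)%E.
  by apply: nnmeasM; [exact: (nnmeas_comp measurable_fst np1)|exact: (nnmeas_comp measurable_snd nf2)].
transitivity (\int[nu]_u \int[kappa u]_y ((EFin \o phi1) u * (EFin \o f2) y))%E.
  apply: eq_integral => u _; rewrite [LHS]muleC; apply/esym.
  have p1u : (0 <= (phi1 u)%:E)%E by rewrite lee_fin.
  exact: (ge0_integralZl (kappa u) measurableT nf2.1 (fun y' _ => nf2.2 y') p1u).
rewrite -(dis _ nG) /= (C2 _ np1).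
by apply: eq_integral => u _; rewrite EFinM.
Qed.

Lemma leg_comp d1 d2 dZ (Y1 : measurableType d1) (Y2 : measurableType d2)
    (Z : measurableType dZ) (rho1 : {measure set Y1 -> \bar R}) (i1 j : Y1 -> X)
    (rho2 : {measure set Y2 -> \bar R}) (i2 : Y2 -> X)
    (M : {measure set Z -> \bar R}) (q1 : Z -> Y1) (q2 : Z -> Y2) :
  sigma_finite setT nu -> leg nu rho1 i1 -> leg nu rho2 i2 ->
  fibprod nu rho1 i1 rho2 i2 M q1 q2 -> leg nu rho1 j -> leg nu M (fun z => j (q1 z)).
Proof.
move=> snu l1 l2 fp [mj _ jac]; have [mq1 mq2 _ _] := fp; split.
- exact: measurableT_comp mj mq1.
- exact: (fibprod_sigma_finite snu l1 l2 fp).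
- move=> A mA A0; apply: (fibprod_null1 snu l1 l2 fp (N := j @^-1` A)); last exact: jac.
  by rewrite -[X in measurable X]setTI; exact: mj.
Qed.

End KProdTheory.

Section Star.
Context (R : realType) dY (Y : measurableType dY) (mu : {measure set Y -> \bar R}).

(* Two kernels attached to the same centre commute, by Tonelli. *)
Lemma kprod_star dA dB d1 d2 dZ (YA : measurableType dA) (YB : measurableType dB)
    (Z1 : measurableType d1) (Z2 : measurableType d2) (Z : measurableType dZ)
    (K : Y -> {measure set YA -> \bar R}) (K' : Y -> {measure set YB -> \bar R})
    (M1 : {measure set Z1 -> \bar R}) (c1 : Z1 -> Y) (a : Z1 -> YA)
    (M2 : {measure set Z2 -> \bar R}) (c2 : Z2 -> Y) (b : Z2 -> YB)
    (T : {measure set Z -> \bar R}) (p1 : Z -> Z1) (qb : Z -> YB) (p2 : Z -> Z2) (qa : Z -> YA) :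
  skernel K -> skernel K' -> kprod mu K M1 c1 a -> kprod mu K' M2 c2 b ->
  kprod M1 (fun w => K' (c1 w)) T p1 qb ->
  measurable_fun setT p2 -> measurable_fun setT qa ->
  (exists q : Z2 * YA -> Z, measurable_fun setT q /\ forall z, q (p2 z, qa z) = z) ->
  (forall z, c2 (p2 z) = c1 (p1 z)) -> (forall z, b (p2 z) = qb z) ->
  (forall z, qa z = a (p1 z)) ->
  kprod M2 (fun w => K (c2 w)) T p2 qa.
Proof.
move=> sK sK' [mc1 ma _ k1] [mc2 mb [q2 [mq2 q2K]] k2] [mp1 mqb _ kT] mp2 mqa eq2 cE bE aE.
split => // F nF.
pose H (w : Y * YB * YA) := F (q2 w.1, w.2).
have nH : nnmeas H.
  apply: (nnmeas_comp _ nF); apply: measurable_fun_pair => //.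
  exact: measurableT_comp.
have nH1 : nnmeas (fun w : Z1 * YB => H ((c1 w.1, w.2), a w.1)).
  apply: (nnmeas_comp _ nH); apply: measurable_fun_pair; last exact: measurableT_comp.
  by apply: measurable_fun_pair => //; exact: measurableT_comp.
have -> : (\int[T]_z F (p2 z, qa z) = \int[T]_z H ((c1 (p1 z), qb z), a (p1 z)))%E.
  by apply: eq_integral => z _; rewrite /H /= -cE -bE q2K aE.
rewrite (kT _ nH1) /=.
have nH2 : nnmeas (fun w : Y * YA => \int[K' w.1]_y H ((w.1, y), w.2))%E.
  apply: (skernel_integral (skernel_comp measurable_fst sK') (F := fun w => H ((w.1.1, w.2), w.1.2))).
  apply: (nnmeas_comp _ nH); apply: measurable_fun_pair; last exact: measurableT_comp.
  by apply: measurable_fun_pair => //; exact: measurableT_comp.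
rewrite (k1 _ nH2) /=.
have nH3 : nnmeas (fun w : Y * YB => \int[K w.1]_x H (w, x))%E.
  by apply: (skernel_integral (skernel_comp measurable_fst sK) (F := H)).
transitivity (\int[M2]_w \int[K (c2 w)]_x H ((c2 w, b w), x))%E; last first.
  by apply: eq_integral => w _; apply: eq_integral => x _; rewrite /H /= q2K.
rewrite (k2 _ nH3) /=; apply: eq_integral => c _.
apply: (tonelli (F := fun w => H ((c, w.2), w.1))).
- exact: skernel_sigma_finite.
- exact: skernel_sigma_finite.
- apply: (nnmeas_comp _ nH); apply: measurable_fun_pair => //.
  exact: measurable_fun_pair.
Qed.

End Star.

Section Amplification.
Context (R : realType) dX (X : measurableType dX) dY (Y : measurableType dY).
Context d d' dT dT' (W : measurableType d) (W' : measurableType d')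
  (Z : measurableType dT) (Z' : measurableType dT').
Context (M : {measure set W -> \bar R}) (M' : {measure set W' -> \bar R}).
Context (th : W' -> W) (D : W' -> R).
Context (kappa : X -> {measure set Y -> \bar R}) (j : W -> X) (j' : W' -> X).
Context (T : {measure set Z -> \bar R}) (p : Z -> W) (q : Z -> Y).
Context (T' : {measure set Z' -> \bar R}) (p' : Z' -> W') (q' : Z' -> Y).
Context (Th : Z' -> Z).
Hypotheses (sk : skernel kappa) (mj : measurable_fun setT j) (mj' : measurable_fun setT j').
Hypothesis tr : transports M M' th D.
Hypothesis jth : {ae M', forall w, j (th w) = j' w}.
Hypothesis kT : kprod M (fun w => kappa (j w)) T p q.
Hypothesis kT' : kprod M' (fun w => kappa (j' w)) T' p' q'.
Hypothesis pTh : forall z, p (Th z) = th (p' z).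
Hypothesis qTh : forall z, q (Th z) = q' z.

(** The integral of [F] over the kernel attached to [j (th w)] depends on [th w] only, so the
    transport by [th] applies to it. The kernels on the two sides match because [j o th = j'] almost
    everywhere. *)
Lemma kprod_transports : transports T T' Th (fun z => D (p' z)).
Proof.
have [mth mD D0 _] := tr; have [mp mq [s [ms sK]] k] := kT; have [mp' mq' _ k'] := kT'.
have mTh : measurable_fun setT Th.
  have -> : Th = fun z => s (th (p' z), q' z) by apply/funext => z; rewrite -pTh -qTh sK.
  apply: measurableT_comp ms _; apply: measurable_fun_pair => //.
  exact: measurableT_comp.
split => //; first exact: measurableT_comp.
move=> F nF.
have nD : nnmeas (EFin \o D) by exact: nnmeas_EFin.
have nG : nnmeas (fun w : W' * Y => (F (s (th w.1, w.2)) * (EFin \o D) w.1)%E).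
  apply: nnmeasM; last exact: (nnmeas_comp measurable_fst nD).
  apply: (nnmeas_comp _ nF); apply: measurableT_comp ms _.
  by apply: measurable_fun_pair => //; exact: measurableT_comp.
have -> : (\int[T']_z (F (Th z) * (D (p' z))%:E) =
    \int[T']_z (F (s (th (p' z), q' z)) * (EFin \o D) (p' z)))%E.
  by apply: eq_integral => z _; rewrite -pTh -qTh sK.
rewrite (k' _ nG) /=.
have nFs : nnmeas (fun w : W * Y => F (s (w.1, w.2))).
  by apply: (nnmeas_comp _ nF); apply: measurableT_comp ms _; exact: measurable_fun_pair.
have nH := skernel_integral (skernel_comp mj sk) nFs.
have nHth := nnmeas_comp mth nH.
transitivity (\int[M']_w ((\int[kappa (j (th w))]_y F (s (th w, y))) * (D w)%:E))%E.
  apply: ae_eq_integral => //.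
  - exact: (skernel_integral (skernel_comp mj' sk) nG).1.
  - exact: (nnmeasM nHth nD).1.
  - apply: filterS jth => w jw _; rewrite -jw ge0_integralZr ?lee_fin//.
    + exact: (measurableT_comp nFs.1 (measurable_pair1 (th w))).
    + by move=> y _; exact: nF.2.
rewrite (transports_integral tr nH) /= -(k _ nFs).
by apply: eq_integral => z _; rewrite mule1 sK.
Qed.

End Amplification.

(** * Amplifications and the pentagon equation *)

Section Composition.
Context (R : realType) d d' d'' (Z : measurableType d) (Z' : measurableType d')
  (Z'' : measurableType d'').
Context (M : {measure set Z -> \bar R}) (M' : {measure set Z' -> \bar R})
  (M'' : {measure set Z'' -> \bar R}).

(** Positivity of the weight excludes the alternative of [transports_ae]. *)
Lemma transports_pos_ae (th : Z' -> Z) D (P : set Z) : transports M M' th D ->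
  {ae M', forall z, 0 < D z} -> {ae M, forall z, P z} -> {ae M', forall z, P (th z)}.
Proof.
move=> tr pos /(transports_ae tr); apply: filterS2 pos => z D0 [Dz|//].
by rewrite Dz ltxx in D0.
Qed.

Lemma transports_comp (th : Z' -> Z) D (th' : Z'' -> Z') D' :
  transports M M' th D -> transports M' M'' th' D' ->
  transports M M'' (th \o th') (fun z => D' z * D (th' z)).
Proof.
move=> tr tr'; have [mth mD D0 _] := tr; have [mth' mD' D0' _] := tr'; split.
- exact: measurableT_comp mth mth'.
- by apply: measurable_funM => //; exact: measurableT_comp.
- by move=> z; rewrite mulr_ge0.
move=> F nF; have nG : nnmeas (fun z => F (th z) * (D z)%:E)%E.
  by apply: nnmeasM; [exact: nnmeas_comp mth nF|exact: nnmeas_EFin].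
under [RHS]eq_integral do rewrite mule1.
rewrite -(transports_integral tr nF) -(transports_integral tr' nG).
by apply: eq_integral => z _; rewrite EFinM muleAC muleA.
Qed.

Lemma wcomp_comp (th : Z' -> Z) D (th' : Z'' -> Z') D' (xi : L2 M) :
  transports M M' th D -> transports M' M'' th' D' ->
  wcomp M'' th' D' (wcomp M' th D xi) =
  wcomp M'' (th \o th') (fun z => D' z * D (th' z)) xi.
Proof.
move=> tr tr'; have tr'' := transports_comp tr tr'; have [_ _ D0' _] := tr'.
apply: L2cls_eq.
- exact: (wcomp_meas tr' (L2fun_meas (wcomp M' th D xi))).
- exact: (wcomp_meas tr'' (L2fun_meas xi)).
apply: filterS (wcomp_ae tr' (wcomp_fun tr xi)) => z ->.
by rewrite mulrA -rmorphM -sqrtrM.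
Qed.

(** The integral of a weight over [E] is the [M]-measure of the set of points sent into [E] by
    [thi], because [thi] undoes the point map. It is the same for both weights, which therefore
    agree almost everywhere. *)
Lemma wcomp_unique (th1 th2 : Z' -> Z) D1 D2 (thi : Z -> Z') : sigma_finite setT M' ->
  transports M M' th1 D1 -> transports M M' th2 D2 ->
  {ae M', forall z, th1 z = th2 z} ->
  measurable_fun setT thi -> {ae M', forall z, thi (th1 z) = z} ->
  wcomp M' th1 D1 =1 wcomp M' th2 D2 :> (L2 M -> L2 M').
Proof.
move=> sM' tr1 tr2 th12 mthi thiK xi.
have [m1 mD1 D10 _] := tr1; have [m2 mD2 D20 _] := tr2.
have weight th D E : measurable E -> transports M M' th D -> {ae M', forall z, thi (th z) = z} ->
    (\int[M']_(z in E) (D z)%:E = \int[M]_z (\1_E (thi z))%:E)%E.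
  move=> mE tr K; have [mth mD D0 _] := tr.
  have nE := nnmeas_comp mthi (nnmeas_indic R mE).
  rewrite -[RHS](transports_integral tr nE) integral_mkcond; apply: ae_eq_integral => //.
  - rewrite (_ : _ \_ _ = (fun z => (\1_E z)%:E * (D z)%:E)%E).
      by have [] := nnmeasM (nnmeas_indic R mE) (nnmeas_EFin mD D0).
    by apply/funext => z; rewrite epatch_indic muleC.
  - by have [] := nnmeasM (nnmeas_comp mth nE) (nnmeas_EFin mD D0).
  - by apply: filterS K => z /= -> _; rewrite epatch_indic muleC.
have D12 : {ae M', forall z, D1 z = D2 z}.
  apply: ae_eq_weights => // E mE; rewrite (weight th1)// (weight th2)//.
  by apply: filterS2 th12 thiK => z <-.
apply: L2cls_eq.
- exact: (wcomp_meas tr1 (L2fun_meas xi)).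
- exact: (wcomp_meas tr2 (L2fun_meas xi)).
by apply: filterS2 th12 D12 => z -> ->.
Qed.

Lemma wcomp_mulop (th : Z' -> Z) D (h : Z -> R[i]) (h' : Z' -> R[i]) (xi : L2 M) :
  transports M M' th D -> essbounded M h -> essbounded M' h' ->
  {ae M', forall z, h (th z) = h' z} ->
  wcomp M' th D (mulop h xi) = mulop h' (wcomp M' th D xi).
Proof.
move=> tr bh bh' hh'; apply: L2cls_eq.
- exact: (wcomp_meas tr (L2fun_meas (mulop h xi))).
- by apply: cmeasM; [case: bh'|exact: L2fun_meas].
apply: filterS3 (wcomp_ae tr (mulop_fun xi bh)) (wcomp_fun tr xi) hh' => z -> -> ->.
by rewrite mulrCA.
Qed.

End Composition.

Section TensorOperators.
Context dX (X : measurableType dX) (R : realType) (nu : {measure set X -> \bar R}).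
Hypothesis snu : sigma_finite setT nu.
Context d1 d2 dZ (Y1 : measurableType d1) (Y2 : measurableType d2) (Z : measurableType dZ).
Context (rho1 : {measure set Y1 -> \bar R}) (i1 : Y1 -> X).
Context (rho2 : {measure set Y2 -> \bar R}) (i2 : Y2 -> X).
Context (M : {measure set Z -> \bar R}) (q1 : Z -> Y1) (q2 : Z -> Y2).
Hypotheses (lg1 : leg nu rho1 i1) (lg2 : leg nu rho2 i2).
Hypothesis P : fibprod nu rho1 i1 rho2 i2 M q1 q2.
Local Notation D := (bounded_vector nu (mult_rep rho1 i1)).

Let mtens (xi : L2 rho1) (eta : L2 rho2) : cmeas (fun z => L2fun xi (q1 z) * L2fun eta (q2 z)).
Proof.
have [mq1 mq2 _ _] := P.
by apply: cmeasM; [apply: (cmeas_comp mq1)|apply: (cmeas_comp mq2)]; exact: L2fun_meas.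
Qed.

Lemma amplify1_mult_rep (j : Y1 -> X) n : leg nu rho1 j -> Linf nu n ->
  amplify1 D (tens M q1 q2 : L2 rho1 -> L2 rho2 -> L2 M) (tens M q1 q2) (mult_rep rho1 j n) (mult_rep M (fun z => j (q1 z)) n).
Proof.
move=> lj nb; have lM := leg_comp snu lg1 lg2 P lj; have bM := Linf_essbounded lM nb.
split=> [|u v Du]; first exact: mulop_bounded.
apply: L2cls_eq; last first.
- have A := fibprod_ae1 snu lg1 lg2 P (mulop_fun u (Linf_essbounded lj nb)).
  by apply: filterS2 A (tens_fun snu lg1 lg2 P v Du) => z -> ->; rewrite mulrA.
- exact: mtens.
- by apply: cmeasM; [case: bM|exact: L2fun_meas].
Qed.

Lemma amplify2_mult_rep (j : Y2 -> X) n : leg nu rho2 j -> Linf nu n ->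
  amplify2 D (tens M q1 q2 : L2 rho1 -> L2 rho2 -> L2 M) (tens M q1 q2) (mult_rep rho2 j n) (mult_rep M (fun z => j (q2 z)) n).
Proof.
move=> lj nb; have lM := leg_comp snu lg2 lg1 (fibprod_sym P) lj; have bM := Linf_essbounded lM nb.
split=> [|u v Du]; first exact: mulop_bounded.
apply: L2cls_eq; last first.
- have A := fibprod_ae2 snu lg1 lg2 P (mulop_fun v (Linf_essbounded lj nb)).
  by apply: filterS2 A (tens_fun snu lg1 lg2 P v Du) => z -> ->; rewrite mulrCA.
- exact: mtens.
- by apply: cmeasM; [case: bM|exact: L2fun_meas].
Qed.

Context d3 dZ' (Y3 : measurableType d3) (Z' : measurableType dZ').
Context (rho3 : {measure set Y3 -> \bar R}) (i3 : Y3 -> X).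
Context (M' : {measure set Z' -> \bar R}) (Th : Z' -> Z).

Lemma amplify1_wcomp (th : Y3 -> Y1) W (p : Z' -> Y3) (q : Z' -> Y2) :
  leg nu rho3 i3 -> fibprod nu rho3 i3 rho2 i2 M' p q ->
  transports rho1 rho3 th W -> transports M M' Th (fun z => W (p z)) ->
  (forall z, q1 (Th z) = th (p z)) -> (forall z, q2 (Th z) = q z) ->
  amplify1 D (tens M q1 q2 : L2 rho1 -> L2 rho2 -> L2 M)
    (tens M' p q : L2 rho3 -> L2 rho2 -> L2 M') (wcomp rho3 th W) (wcomp M' Th (fun z => W (p z))).
Proof.
move=> lg3 P' tr trM q1T q2T; split=> [|u v Du]; first exact: (wcomp_bounded trM).
apply: L2cls_eq; last first.
- have A := wcomp_ae trM (tens_fun snu lg1 lg2 P v Du).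
  have B := fibprod_ae1 snu lg3 lg2 P' (wcomp_fun tr u).
  by apply: filterS2 A B => z -> ->; rewrite q1T q2T mulrA.
- have [mp mq _ _] := P'.
  by apply: cmeasM; [apply: (cmeas_comp mp)|apply: (cmeas_comp mq)]; exact: L2fun_meas.
- exact: (wcomp_meas trM (L2fun_meas _)).
Qed.

Lemma amplify2_wcomp (th : Y3 -> Y2) W (p : Z' -> Y1) (q : Z' -> Y3) :
  leg nu rho3 i3 -> fibprod nu rho1 i1 rho3 i3 M' p q ->
  transports rho2 rho3 th W -> transports M M' Th (fun z => W (q z)) ->
  (forall z, q2 (Th z) = th (q z)) -> (forall z, q1 (Th z) = p z) ->
  amplify2 D (tens M q1 q2 : L2 rho1 -> L2 rho2 -> L2 M)
    (tens M' p q : L2 rho1 -> L2 rho3 -> L2 M') (wcomp rho3 th W) (wcomp M' Th (fun z => W (q z))).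
Proof.
move=> lg3 P' tr trM q2T q1T; split=> [|u v Du]; first exact: (wcomp_bounded trM).
apply: L2cls_eq; last first.
- have A := wcomp_ae trM (tens_fun snu lg1 lg2 P v Du).
  have B := fibprod_ae2 snu lg1 lg3 P' (wcomp_fun tr v).
  by apply: filterS2 A B => z -> ->; rewrite q1T q2T mulrCA.
- have [mp mq _ _] := P'.
  by apply: cmeasM; [apply: (cmeas_comp mp)|apply: (cmeas_comp mq)]; exact: L2fun_meas.
- exact: (wcomp_meas trM (L2fun_meas _)).
Qed.

End TensorOperators.

Section Pentagon.
Context dX dY (X : measurableType dX) (Y : measurableType dY) (R : realType).
Context (nu : {measure set X -> \bar R}) (mu : {measure set Y -> \bar R}).
Context (r s m : Y -> X) (kr ks km : X -> {measure set Y -> \bar R}).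
Context (Msm Mmr : {measure set (Y * Y) -> \bar R}).
Context (th thi : Y * Y -> Y * Y) (D : Y * Y -> R).
Hypothesis snu : sigma_finite setT nu.
Hypotheses (lr : leg nu mu r) (ls : leg nu mu s) (lm : leg nu mu m).
Hypothesis nr : forall A, measurable A -> mu (r @^-1` A) = 0%E -> nu A = 0%E.
Hypothesis ns : forall A, measurable A -> mu (s @^-1` A) = 0%E -> nu A = 0%E.
Hypothesis nm : forall A, measurable A -> mu (m @^-1` A) = 0%E -> nu A = 0%E.
Hypotheses (skr : skernel kr) (sks : skernel ks) (skm : skernel km).
Hypotheses (dr : disint nu mu r kr) (ds : disint nu mu s ks) (dm : disint nu mu m km).
Hypothesis k1 : kprod mu (fun y => km (s y)) Msm fst snd.
Hypothesis k2 : kprod mu (fun y => ks (m y)) Msm snd fst.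
Hypothesis k3 : kprod mu (fun y => kr (m y)) Mmr fst snd.
Hypothesis k4 : kprod mu (fun y => km (r y)) Mmr snd fst.
Hypothesis tr : transports Msm Mmr th D.
Hypothesis Dpos : {ae Mmr, forall w, 0 < D w}.
Hypothesis mthi : measurable_fun setT thi.
Hypothesis thiK : {ae Mmr, forall w, thi (th w) = w}.
Hypothesis hm : {ae Mmr, forall w, m (th w).1 = m w.2}.
Hypothesis hs : {ae Mmr, forall w, s (th w).2 = s w.2}.
Hypothesis hr : {ae Mmr, forall w, r (th w).1 = r w.1}.
Hypothesis hb : {ae Mmr, forall w, r (th w).2 = s w.1}.

Let th12 (z : Y * Y * Y) := (th z.1, z.2).
Let th23 (z : Y * Y * Y) := let w := th (z.1.2, z.2) in (z.1.1, w.1, w.2).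
Let th13 (z : Y * Y * Y) := let w := th (z.1.1, z.2) in (w.1, z.1.2, w.2).

Context (N : set (Y * Y)).
Hypothesis aeN : {ae Mmr, forall w, N w}.
Hypothesis pent : forall x y z, N (x, y) -> N (y, z) -> N ((th (x, y)).1, z) ->
  th12 (th23 (x, y, z)) = th23 (th13 (th12 (x, y, z))).

Let mr : measurable_fun setT r. Proof. by case: lr. Qed.
Let ms : measurable_fun setT s. Proof. by case: ls. Qed.
Let mm : measurable_fun setT m. Proof. by case: lm. Qed.
Local Notation p12 := (fun z : Y * Y * Y => z.1).
Local Notation q3 := (fun z : Y * Y * Y => z.2).
Local Notation p23 := (fun z : Y * Y * Y => (z.1.2, z.2)).
Local Notation q1 := (fun z : Y * Y * Y => z.1.1).
Local Notation p13 := (fun z : Y * Y * Y => (z.1.1, z.2)).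
Local Notation q2 := (fun z : Y * Y * Y => z.1.2).

Let mp12 : measurable_fun setT p12. Proof. exact: measurable_fst. Qed.
Let mq3 : measurable_fun setT q3. Proof. exact: measurable_snd. Qed.
Let mq1 : measurable_fun setT q1. Proof. exact: measurableT_comp measurable_fst measurable_fst. Qed.
Let mq2 : measurable_fun setT q2. Proof. exact: measurableT_comp measurable_snd measurable_fst. Qed.
Let mp23 : measurable_fun setT p23. Proof. exact: measurable_fun_pair. Qed.
Let mp13 : measurable_fun setT p13. Proof. exact: measurable_fun_pair. Qed.
Let inv12 : exists q : Y * Y * Y -> Y * Y * Y,
  measurable_fun setT q /\ forall z, q (p12 z, q3 z) = z.
Proof. by exists id; split=> [|[]]; first exact: measurable_id. Qed.
Let inv23 : exists q : Y * Y * Y -> Y * Y * Y,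
  measurable_fun setT q /\ forall z, q (p23 z, q1 z) = z.
Proof.
exists (fun w => (w.2, w.1.1, w.1.2)); split=> [|[[]]//].
by do 2?apply: measurable_fun_pair.
Qed.
Let inv13 : exists q : Y * Y * Y -> Y * Y * Y,
  measurable_fun setT q /\ forall z, q (p13 z, q2 z) = z.
Proof.
exists (fun w => (w.1.1, w.2, w.1.2)); split=> [|[[]]//].
by do 2?apply: measurable_fun_pair.
Qed.

Let js {j : Y -> X} : measurable_fun setT j -> measurable_fun setT (fun w : Y * Y => j w.2).
Proof. by move=> mj; apply: measurableT_comp mj measurable_snd. Qed.
Let jf {j : Y -> X} : measurable_fun setT j -> measurable_fun setT (fun w : Y * Y => j w.1).
Proof. by move=> mj; apply: measurableT_comp mj measurable_fst. Qed.

Let fsm : fibprod nu mu s mu m Msm fst snd := kprod_fibprod skm ms mm dm k1.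
Let fmr : fibprod nu mu m mu r Mmr fst snd := kprod_fibprod skr mm mr dr k3.

Let sm1 {j} : leg nu mu j -> leg nu Msm (fun w => j w.1) := leg_comp snu ls lm fsm.
Let sm2 {j} : leg nu mu j -> leg nu Msm (fun w => j w.2) := leg_comp snu lm ls (fibprod_sym fsm).
Let mr1 {j} : leg nu mu j -> leg nu Mmr (fun w => j w.1) := leg_comp snu lm lr fmr.
Let mr2 {j} : leg nu mu j -> leg nu Mmr (fun w => j w.2) := leg_comp snu lr lm (fibprod_sym fmr).

Let ex12 (M : {measure set (Y * Y) -> \bar R}) (k : Y * Y -> {measure set Y -> \bar R}) :
  skernel k -> exists T, kprod M k T p12 q3.
Proof. by move=> sk; apply: (kprod_ex M (q := id) sk) => //; first [exact: measurable_id|case]. Qed.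

Let ex23 (M : {measure set (Y * Y) -> \bar R}) (k : Y * Y -> {measure set Y -> \bar R}) :
  skernel k -> exists T, kprod M k T p23 q1.
Proof.
move=> sk; apply: (kprod_ex M (q := fun w => (w.2, w.1.1, w.1.2)) sk) => //; first [by case=> -[]|by do 2?apply: measurable_fun_pair].
Qed.

Let ex13 (M : {measure set (Y * Y) -> \bar R}) (k : Y * Y -> {measure set Y -> \bar R}) :
  skernel k -> exists T, kprod M k T p13 q2.
Proof.
move=> sk; apply: (kprod_ex M (q := fun w => (w.1.1, w.2, w.1.2)) sk) => //; first [by case=> -[]|by do 2?apply: measurable_fun_pair].
Qed.

Let aetens d1 d2 d3 d4 d5 (Y1 : measurableType d1) (Y2 : measurableType d2) (Z : measurableType d3)
    (Y3 : measurableType d4) (Z' : measurableType d5)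
    (rho1 : {measure set Y1 -> \bar R}) (i1 : Y1 -> X)
    (rho2 : {measure set Y2 -> \bar R}) (i2 : Y2 -> X)
    (rho3 : {measure set Y3 -> \bar R}) (i3 : Y3 -> X)
    (M : {measure set Z -> \bar R}) a b (M' : {measure set Z' -> \bar R}) p q (k : Z -> X)
    (u : L2 rho1) (v : L2 rho2) :
  leg nu rho1 i1 -> leg nu rho2 i2 -> fibprod nu rho1 i1 rho2 i2 M a b ->
  leg nu M k -> leg nu rho3 i3 -> fibprod nu M k rho3 i3 M' p q ->
  bounded_vector nu (mult_rep rho1 i1) u ->
  {ae M', forall z, L2fun (tens M a b u v) (p z) = L2fun u (a (p z)) * L2fun v (b (p z))}.
Proof.
move=> l1 l2 fp lk l3 fp' Du.
exact: (fibprod_ae1 snu lk l3 fp' (tens_fun snu l1 l2 fp v Du)).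
Qed.

Let mtens d1 d2 d3 (Y1 : measurableType d1) (Y2 : measurableType d2) (Z : measurableType d3)
    (rho1 : {measure set Y1 -> \bar R}) (rho2 : {measure set Y2 -> \bar R})
    (u : L2 rho1) (v : L2 rho2) (a : Z -> Y1) (b : Z -> Y2) :
  measurable_fun setT a -> measurable_fun setT b ->
  cmeas (fun z => L2fun u (a z) * L2fun v (b z)).
Proof.
by move=> ma mb; apply: cmeasM; [apply: (cmeas_comp ma)|apply: (cmeas_comp mb)]; exact: L2fun_meas.
Qed.

Let Wmu := wcomp Mmr th D : L2 Msm -> L2 Mmr.

(** All five spaces are square-integrable functions on the same set of triples, for different
    measures. Both presentations of each use the same measure and differ only in which pair of
    coordinates is grouped. *)
Lemma wcomp_pentagonal :
  pentagonal nu (mult_rep mu m) (mult_rep mu s) (mult_rep mu r)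
    (tens Msm fst snd) (tens Mmr fst snd) Wmu
    (mult_rep Msm (fun w => m w.1)) (mult_rep Msm (fun w => s w.2))
    (mult_rep Msm (fun w => r w.1)) (mult_rep Msm (fun w => r w.2))
    (mult_rep Mmr (fun w => m w.2)) (mult_rep Mmr (fun w => s w.2))
    (mult_rep Mmr (fun w => r w.1)) (mult_rep Mmr (fun w => s w.1)).
Proof.
(* The leg to which both others are attached is the second one in [A], [B] and [E], the third one in
   [C] and the first one in [D]; [kprod_star] produces the other grouping. *)
have [mA kA] := ex12 Msm (skernel_comp (js ms) skm).
have [mB kB] := ex12 Mmr (skernel_comp (js ms) skm).
have [mE kE] := ex12 Mmr (skernel_comp (js mm) skr).
have [mC kC] := ex23 Mmr (skernel_comp (js mm) sks).
have [mD kD] := ex13 Mmr (skernel_comp (jf ms) skm).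
have kA' : kprod Msm (fun w => ks (m w.1)) mA p23 q1.
  exact: (kprod_star (skernel_comp mm sks) (skernel_comp ms skm) k2 k1 kA).
have kB' : kprod Msm (fun w => km (r w.1)) mB p23 q1.
  exact: (kprod_star (skernel_comp mr skm) (skernel_comp ms skm) k4 k1 kB).
have kE' : kprod Mmr (fun w => km (r w.1)) mE p23 q1.
  exact: (kprod_star (skernel_comp mr skm) (skernel_comp mm skr) k4 k3 kE).
have kC' : kprod Msm (fun w => km (r w.2)) mC p13 q2.
  exact: (kprod_star (skernel_comp mr skm) (skernel_comp mm sks) k4 k2 kC).
have kD' : kprod Msm (fun w => kr (m w.1)) mD p12 q3.
  exact: (kprod_star (skernel_comp mm skr) (skernel_comp ms skm) k3 k1 kD).
have fA := kprod_fibprod skm (js ms) mm dm kA.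
have fA' := kprod_fibprod sks (jf mm) ms ds kA'.
have fB := kprod_fibprod skm (js ms) mm dm kB.
have fB' := kprod_fibprod skm (jf mr) mm dm kB'.
have fE := kprod_fibprod skr (js mm) mr dr kE.
have fE' := kprod_fibprod skm (jf mr) mm dm kE'.
have fC := kprod_fibprod sks (js mm) ms ds kC.
have fC' := kprod_fibprod skm (js mr) mm dm kC'.
have fD := kprod_fibprod skm (jf ms) mm dm kD.
have fD' := kprod_fibprod skr (jf mm) mr dr kD'.
(* Each amplification is allowed by one of [hs], [hr], [hm], [hb]: the coordinate of [th w] to which
   the idle leg is attached equals the corresponding coordinate of [w]. *)
have tAB : transports mA mB th12 (fun z => D z.1) by exact: (kprod_transports skm (js ms) (js ms) tr hs kA kB).
have tBE : transports mB mE th23 (fun z => D (z.1.2, z.2)).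
  by apply: (kprod_transports skm (jf mr) (jf mr) tr hr kB' kE') => // z; rewrite /th23 /th13 /= -surjective_pairing.
have tAC : transports mA mC th23 (fun z => D (z.1.2, z.2)).
  by apply: (kprod_transports sks (jf mm) (js mm) tr hm kA' kC) => // z; rewrite /th23 /th13 /= -surjective_pairing.
have tCD : transports mC mD th13 (fun z => D (z.1.1, z.2)).
  by apply: (kprod_transports skm (js mr) (jf ms) tr hb kC' kD) => // z; rewrite /th23 /th13 /= -surjective_pairing.
have tDE : transports mD mE th12 (fun z => D z.1).
  exact: (kprod_transports skr (jf mm) (js mm) tr hm kD' kE).
exists (L2 mA), (L2 mB), (L2 mC), (L2 mD), (L2 mE).
exists (tens mA p12 q3), (tens mA q1 p23), (tens mB p12 q3), (tens mB q1 p23),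
  (tens mE p12 q3), (tens mE q1 p23), (tens mC q1 p23), (tens mC q2 p13),
  (tens mD q2 p13), (tens mD p12 q3); split; [split|].
- split=> [||u v w Du Dv].
  + exact: (tens_relative_tensor snu (sm2 ls) lm fA).
  + exact: (tens_relative_tensor snu ls (sm1 lm) (fibprod_sym fA')).
  have a1 := aetens v ls lm fsm (sm2 ls) lm fA Du.
  have a2 := aetens w ls lm fsm (sm1 lm) ls fA' Dv.
  by apply: L2cls_eq; [exact: mtens|exact: mtens|apply: filterS2 a1 a2 => z -> ->; rewrite mulrA].
- split=> [||u v w Du Dv].
  + exact: (tens_relative_tensor snu (mr2 ls) lm fB).
  + exact: (tens_relative_tensor snu lm (sm1 lr) (fibprod_sym fB')).
  have a1 := aetens v lm lr fmr (mr2 ls) lm fB Du.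
  have a2 := aetens w ls lm fsm (sm1 lr) lm fB' Dv.
  by apply: L2cls_eq; [exact: mtens|exact: mtens|apply: filterS2 a1 a2 => z -> ->; rewrite mulrA].
- split=> [||u v w Du Dv].
  + exact: (tens_relative_tensor snu (mr2 lm) lr fE).
  + exact: (tens_relative_tensor snu lm (mr1 lr) (fibprod_sym fE')).
  have a1 := aetens v lm lr fmr (mr2 lm) lr fE Du.
  have a2 := aetens w lm lr fmr (mr1 lr) lm fE' Dv.
  by apply: L2cls_eq; [exact: mtens|exact: mtens|apply: filterS2 a1 a2 => z -> ->; rewrite mulrA].
- split=> [||u v w Du Dv].
  + exact: (tens_relative_tensor snu ls (mr2 lm) (fibprod_sym fC)).
  + exact: (tens_relative_tensor snu lm (sm2 lr) (fibprod_sym fC')).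
  have a1 := aetens w lm lr fmr (mr2 lm) ls fC Dv.
  have a2 := aetens w ls lm fsm (sm2 lr) lm fC' Du.
  by apply: L2cls_eq; [exact: mtens|exact: mtens|apply: filterS2 a1 a2 => z -> ->; rewrite mulrCA].
- split=> [||u v w Du Dv Dw].
  + exact: (tens_relative_tensor snu lm (mr1 ls) (fibprod_sym fD)).
  + exact: (tens_relative_tensor snu (sm1 lm) lr fD').
  have a1 := aetens w lm lr fmr (mr1 ls) lm fD Du.
  have a2 := aetens v ls lm fsm (sm1 lm) lr fD' Dv.
  apply: L2cls_eq; [exact: mtens|exact: mtens|apply: filterS2 a1 a2 => z -> ->].
  by rewrite mulrCA mulrA.
exists (wcomp mB th12 (fun z => D z.1)), (wcomp mE th23 (fun z => D (z.1.2, z.2))),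
  (wcomp mC th23 (fun z => D (z.1.2, z.2))), (wcomp mD th13 (fun z => D (z.1.1, z.2))),
  (wcomp mE th12 (fun z => D z.1)).
split.
- exact: (amplify1_wcomp snu (sm2 ls) lm fA (mr2 ls) fB tr tAB).
- by apply: (amplify2_wcomp snu lm (sm1 lr) (fibprod_sym fB') (mr1 lr) (fibprod_sym fE') tr tBE) => // z; rewrite /th23 /th13 /= -surjective_pairing.
- by apply: (amplify2_wcomp snu ls (sm1 lm) (fibprod_sym fA') (mr2 lm) (fibprod_sym fC) tr tAC) => // z; rewrite /th23 /th13 /= -surjective_pairing.
split.
- by apply: (amplify2_wcomp snu lm (sm2 lr) (fibprod_sym fC') (mr1 ls) (fibprod_sym fD) tr tCD) => // z; rewrite /th23 /th13 /= -surjective_pairing.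
- exact: (amplify1_wcomp snu (sm1 lm) lr fD' (mr2 lm) fE tr tDE).
move=> u; rewrite (wcomp_comp u tAB tBE) (wcomp_comp u tAC tCD).
rewrite (wcomp_comp u (transports_comp tAC tCD) tDE).
have N12 := fibprod_ae1 snu (mr2 lm) lr fE aeN.
have N23 := fibprod_ae1 snu (mr1 lr) lm fE' aeN.
have D12 := fibprod_ae1 snu (mr2 lm) lr fE Dpos.
have D23 := fibprod_ae1 snu (mr1 lr) lm fE' Dpos.
(* The pair formed by the first coordinate of th(x, y) and z only appears on [D], after [th12]; its
   null set is pulled back to [E], which requires the positive weight. *)
have N13 := transports_pos_ae tDE D12 (fibprod_ae1 snu (mr1 ls) lm fD aeN).
have K12 := transports_pos_ae tBE D23 (fibprod_ae1 snu (mr2 ls) lm fB thiK).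
have K23 := fibprod_ae1 snu (mr1 lr) lm fE' thiK.
(* The common point map applies [th23], then [th12]; it is undone by [thi] on the first two
   coordinates, then on the last two. *)
apply: (wcomp_unique (thi := fun z => let w := thi z.1 in let w' := thi (w.2, z.2) in (w.1, w'.1, w'.2))
  _ (transports_comp tAB tBE) (transports_comp (transports_comp tAC tCD) tDE)).
- exact: (fibprod_sigma_finite snu (mr2 lm) lr fE).
- by apply: filterS3 N12 N23 N13 => -[[x y] z] /=; exact: pent.
- have m1 : measurable_fun setT (fun z : Y * Y * Y => thi z.1) by exact: measurableT_comp.
  have m2 : measurable_fun setT (fun z : Y * Y * Y => thi ((thi z.1).2, z.2)).
    apply: measurableT_comp mthi _; apply: measurable_fun_pair => //.
    exact: measurableT_comp measurable_snd m1.
  apply: measurable_fun_pair; [apply: measurable_fun_pair|].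
  + exact: measurableT_comp measurable_fst m1.
  + exact: measurableT_comp measurable_fst m2.
  + exact: measurableT_comp measurable_snd m2.
- apply: filterS2 K12 K23 => -[[x y] z] /=; rewrite /th23 /th12 /= => -> /=.
  by rewrite -surjective_pairing => ->.
Qed.

Theorem wcomp_pseudo_multiplicative :
  pseudo_multiplicative_unitary nu (mult_rep mu m) (mult_rep mu s) (mult_rep mu r)
    (tens Msm fst snd) (tens Mmr fst snd) Wmu.
Proof.
have [mth mD D0 _] := tr.
split.
- exact: hilbert_L2.
- by split; apply: mult_rep_basis.
- by split; apply: mult_rep_commuting.
- by split; [exact: (tens_relative_tensor snu ls lm fsm)|exact: (tens_relative_tensor snu lm lr fmr)].
split; first exact: (wcomp_unitary tr mthi thiK Dpos).
exists (mult_rep Msm (fun w => m w.1)), (mult_rep Msm (fun w => s w.2)),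
  (mult_rep Msm (fun w => r w.1)), (mult_rep Msm (fun w => r w.2)),
  (mult_rep Mmr (fun w => m w.2)), (mult_rep Mmr (fun w => s w.2)),
  (mult_rep Mmr (fun w => r w.1)), (mult_rep Mmr (fun w => s w.1)).
split; last exact: wcomp_pentagonal.
- move=> n nb; split.
  + exact: (amplify1_mult_rep snu ls lm fsm lm).
  + exact: (amplify2_mult_rep snu ls lm fsm ls).
  + exact: (amplify1_mult_rep snu ls lm fsm lr).
  + exact: (amplify2_mult_rep snu ls lm fsm lr).
- move=> n nb; split.
  + exact: (amplify2_mult_rep snu lm lr fmr lm).
  + exact: (amplify2_mult_rep snu lm lr fmr ls).
  + exact: (amplify1_mult_rep snu lm lr fmr lr).
  + exact: (amplify1_mult_rep snu lm lr fmr ls).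
- move=> n nb u; split.
  + apply: (wcomp_mulop u tr (Linf_essbounded (sm1 lm) nb) (Linf_essbounded (mr2 lm) nb)).
    by apply: filterS hm => w /= ->.
  + apply: (wcomp_mulop u tr (Linf_essbounded (sm2 ls) nb) (Linf_essbounded (mr2 ls) nb)).
    by apply: filterS hs => w /= ->.
  + apply: (wcomp_mulop u tr (Linf_essbounded (sm1 lr) nb) (Linf_essbounded (mr1 lr) nb)).
    by apply: filterS hr => w /= ->.
  + apply: (wcomp_mulop u tr (Linf_essbounded (sm2 lr) nb) (Linf_essbounded (mr1 ls) nb)).
    by apply: filterS hb => w /= ->.
Qed.

End Pentagon.

(** * Borel structure of locally compact spaces *)

Lemma closed_eqfun (S T : topologicalType) (f h : S -> T) : hausdorff_space T ->
  continuous f -> continuous h -> closed [set x | f x = h x].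
Proof.
move=> hT cf ch; rewrite -openC openE => x /= fhx.
have := hT; rewrite open_hausdorff => /(_ (f x) (h x)).
case=> [|[A B] [/= fA hB] [oA oB /eqP AB]]; first exact/eqP.
rewrite inE in fA; rewrite inE in hB.
have nA : nbhs x (f @^-1` A) := cf x _ (open_nbhs_nbhs (conj oA fA)).
have nB : nbhs x (h @^-1` B) := ch x _ (open_nbhs_nbhs (conj oB hB)).
suff : nbhs x [set y | f y <> h y] by [].
apply: filterS2 nA nB => y /= Ay By fhy.
have : (A `&` B) (f y) by split=> //; rewrite fhy.
by rewrite AB.
Qed.

Section SecondCountable.
Context (T : ptopologicalType) (sc : @second_countable T).

Lemma second_countable_seq : exists B : (set T)^nat, (forall n, open (B n)) /\
  forall x U, nbhs x U -> exists n, B n x /\ B n `<=` U.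
Proof.
have [B /countable_injP[f injf] [oB nB]] := sc.
pose C n := xget set0 [set b | B b /\ f b = n].
have CP n : C n = set0 \/ B (C n) /\ f (C n) = n.
  by rewrite /C; case: xgetP => [b _ [Bb fb]|_]; [right|left].
exists C; split=> [n|x U xU].
  by have [->|[Bb _]] := CP n; [exact: open0|exact: oB].
have [b [Bb bx] bU] := nB x U xU; exists (f b).
have -> : C (f b) = b.
  rewrite /C; case: xgetP => [b' _ [Bb' ff]|/(_ b)[]//].
  by apply: injf; rewrite ?inE.
by split.
Qed.

Lemma open_borel (U : set T) : open U -> measurable (U : set (borel T)).
Proof. exact: sub_sigma_algebra. Qed.

Lemma closed_borel (F : set T) : closed F -> measurable (F : set (borel T)).
Proof. by move=> cF; rewrite -(setCK F); apply: measurableC; apply: open_borel; exact: closed_openC. Qed.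

(** Second countability makes an open subset of the square a countable union of open rectangles,
    hence measurable for the product of the Borel structures. *)
Lemma open_borel_prod (U : set (T * T)) : open U -> measurable (U : set (borel T * borel T)).
Proof.
move=> oU; have [B [oB nB]] := second_countable_seq.
pose V n k : set (borel T * borel T) := if `[< B n `*` B k `<=` U >] then B n `*` B k else set0.
have -> : U = \bigcup_n \bigcup_k V n k.
  apply/seteqP; split=> [[x y] Uxy|[x y] [n _ [k _]]].
    have [[P Q] [/= Px Qy] PQU] : nbhs (x, y) U by exact: open_nbhs_nbhs.
    have [n [Bx BP]] := nB _ _ Px; have [k [By BQ]] := nB _ _ Qy.
    exists n => //; exists k => //; rewrite /V asboolT//.
    by move=> [a b] [/= /BP Pa /BQ Qb]; exact: PQU.
  by rewrite /V; case: asboolP => // H /H.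
apply: bigcup_measurable => n _; apply: bigcup_measurable => k _.
rewrite /V; case: asboolP => _ //.
by apply: measurableX; exact: open_borel.
Qed.

Lemma closed_borel_prod (F : set (T * T)) : closed F ->
  measurable (F : set (borel T * borel T)).
Proof.
move=> cF; rewrite -(setCK F); apply: measurableC; apply: open_borel_prod.
exact: closed_openC.
Qed.

Lemma measurable_eq_fun d (Y : measurableType d) (f h : Y -> borel T) : hausdorff_space T ->
  measurable_fun setT f -> measurable_fun setT h -> measurable [set y | f y = h y].
Proof.
move=> hT mf mh.
have cD : closed [set p : T * T | p.1 = p.2].
  by apply: closed_eqfun => // p; [exact: cvg_fst|exact: cvg_snd].
have := measurable_fun_pair mf mh measurableT (closed_borel_prod cD).
by rewrite setTI.
Qed.

(** Countably many basic open sets of measure zero cover [A]. In particular the complement of the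
    support is null. *)
Lemma null_from_support (R : realType) (mu : {measure set (borel T) -> \bar R}) (A : set T) :
  (forall x, A x -> exists U, [/\ open U, U x & mu U = 0%E]) ->
  mu.-negligible (A : set (borel T)).
Proof.
move=> H; have [B [oB nB]] := second_countable_seq.
pose C n : set (borel T) := if `[< mu (B n) = 0%E >] then B n else set0.
have nC n : mu.-negligible (C n).
  exists (C n); rewrite /C; case: asboolP => B0; split=> //.
  exact: open_borel.
apply: negligibleS (negligible_bigcup nC) => x /H[U [oU Ux U0]].
have [n [Bx BU]] := nB _ _ (open_nbhs_nbhs (conj oU Ux)).
exists n => //; rewrite /C asboolT//; apply/eqP; rewrite -measure_le0 -U0.
by apply: le_measure; rewrite ?inE; [exact: open_borel|exact: open_borel|].
Qed.

End SecondCountable.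

(** * Continuous functions with compact support *)

Section CompactSupport.
Context (R : realType) (T : ptopologicalType).

Definition bump (f : T -> R) := [/\ continuous f, forall x, 0 <= f x
  & exists K, compact K /\ forall x, ~ K x -> f x = 0].

Lemma bump0 : bump (fun=> 0).
Proof.
split=> //; first by move=> x; exact: cvg_cst.
by exists set0; split=> //; exact: compact0.
Qed.

Lemma bumpD f h : bump f -> bump h -> bump (fun x => f x + h x).
Proof.
move=> [cf f0 [K [cK fK]]] [ch h0 [L [cL hL]]]; split.
- by move=> x; apply: cvgD; [exact: cf|exact: ch].
- by move=> x; rewrite addr_ge0.
- exists (K `|` L); split; first exact: compactU.
  by move=> x /not_orP[nK nL]; rewrite fK// hL// addr0.
Qed.

Lemma bump_min1 (c : R) f : 0 <= c -> bump f -> bump (fun x => Num.min 1 (c * f x)).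
Proof.
move=> c0 [cf f0 [K [cK fK]]]; split.
- move=> x; apply: (@continuous_min _ _ (fun=> 1) (fun x => c * f x)).
    exact: cvg_cst.
  by apply: cvgM; [exact: cvg_cst|exact: cf].
- by move=> x; rewrite le_min ler01 mulr_ge0.
- by exists K; split=> // x nK; rewrite fK// mulr0 min_r.
Qed.

Hypotheses (hT : hausdorff_space T) (lT : locally_compact [set: T]).

(** A separating function between [x] and the complement of a relatively compact neighbourhood
    inside [U], given by complete regularity; its complement to 1 is the bump. *)
Lemma bump_at (U : set T) (x : T) : open U -> U x ->
  exists f, [/\ bump f, 0 < f x & forall y, ~ U y -> f y = 0].
Proof.
move=> oU Ux; have [K nK [cK _]] := lT (I : [set: T] x).
have {}nK : nbhs x K by move: nK; rewrite /within /=; apply: filterS => y /(_ I).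
pose V := U `&` K°.
have oV : open V by apply: openI => //; exact: open_interior.
have /uniform_separatorP : uniform_separator [set x] (~` V).
  by apply: (@locally_compact_completely_regular T R lT hT); [exact: open_closedC|apply].
move=> /(_ R)[f [cf f01 fx fV]].
have f1 y : f y <= 1.
  by have := f01 (f y) (imageT f y); rewrite /= in_itv/= => /andP[].
exists (fun y => 1 - f y); split.
- split.
  + by move=> y; apply: cvgB; [exact: cvg_cst|exact: cf].
  + by move=> y; rewrite subr_ge0.
  + exists K; split=> // y nKy; have -> : f y = 1; last by rewrite subrr.
    by apply: fV; exists y => // -[_ /interior_subset].
- by have -> : f x = 0; [apply: fx; exists x|rewrite subr0].
- move=> y nUy; have -> : f y = 1; last by rewrite subrr.
  by apply: fV; exists y => // -[].
Qed.

Lemma bump_sum (f_ : nat -> T -> R) n : (forall k, bump (f_ k)) ->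
  bump (fun x => \sum_(k < n) f_ k x).
Proof.
move=> bf; elim: n => [|n IH].
  by under eq_fun do rewrite big_ord0; exact: bump0.
by under eq_fun do rewrite big_ord_recr /=; exact: bumpD.
Qed.

Hypothesis sc : @second_countable T.

Lemma open_indic_sup (U : set T) : open U -> exists g_ : nat -> T -> R,
  [/\ forall n, bump (g_ n), forall n x, g_ n x <= 1,
      forall x, nondecreasing_seq (g_ ^~ x), forall n x, ~ U x -> g_ n x = 0
    & forall x, U x -> exists n, g_ n x = 1].
Proof.
move=> oU; have [B [oB nB]] := second_countable_seq sc.
(* The zero function is the default when no bump supported in [U] is positive on the whole of [B n];
   the others still exhaust [U], because the positivity set of any bump contains basic open sets. *)
pose f n := xget (fun=> 0) [set f : T -> R | [/\ bump f, forall y, ~ U y -> f y = 0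
  & forall y, B n y -> 0 < f y]].
have fP n : bump (f n) /\ forall y, ~ U y -> f n y = 0.
  by rewrite /f; case: xgetP => [h _ []//|_]; split=> //; exact: bump0.
have f0 n y : 0 <= f n y by have [[_ + _] _] := fP n.
have fx x : U x -> exists n, 0 < f n x.
  move=> /(bump_at oU)[h [bh hx hU]]; have [ch _ _] := bh.
  have [n [Bx Bh]] : exists n, B n x /\ B n `<=` [set y | 0 < h y].
    by apply: (nB x [set y | 0 < h y]); apply: (ch x [set c | 0 < c]); exact: lt_nbhsr.
  exists n; rewrite /f; case: xgetP => [k _ [_ _]|/(_ h)[]//]; exact.
pose F n x := \sum_(k < n) f k x.
have F0 n x : 0 <= F n x by exact: sumr_ge0.
(* The factor [n] lifts the sum above 1 at each point of [U] from some stage on; the cut at 1 makes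
   the value 1 exact. *)
exists (fun n x => Num.min 1 (n%:R * F n x)); split.
- by move=> n; apply: bump_min1 => //; apply: bump_sum => k; case: (fP k).
- by move=> n x; rewrite ge_min lexx.
- move=> x n k nk; rewrite le_min ge_min lexx /= ge_min; apply/orP; right.
  apply: ler_pM => //; first by rewrite ler_nat.
  rewrite /F -(subnKC nk) big_split_ord /= lerDl; exact: sumr_ge0.
- by move=> n x nU; rewrite /F big1 ?mulr0 ?min_r// => k _; case: (fP k) => _ /(_ x nU).
- move=> x /fx[k fk].
  have Fk n : (k < n)%N -> f k x <= F n x.
    by move=> kn; rewrite /F (bigD1 (Ordinal kn))//= lerDl sumr_ge0.
  have [j jk] : exists j, (f k x)^-1 < j%:R.
    by exists (Num.bound (f k x)^-1); rewrite archi_boundP// invr_ge0.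
  exists (maxn k.+1 j); rewrite min_l//; apply: (@le_trans _ _ ((f k x)^-1 * f k x)).
    by rewrite mulVf// lt0r_neq0.
  apply: ler_pM => //; first by rewrite invr_ge0.
    by apply: (le_trans (ltW jk)); rewrite ler_nat leq_maxr.
  by apply: Fk; rewrite leq_max ltnSn.
Qed.

End CompactSupport.

(** * Groupoids and factorizations *)

Section GroupoidAlgebra.
Context (G : Type) (g : groupoid G).
Local Notation r := (grr g).
Local Notation s := (grs g).
Local Notation inv := (ginv g).
Local Notation mul := (gmul g).
Implicit Types x y z : G.

Lemma grs_inv x : s (inv x) = r x. Proof. by rewrite /grs /grr ginvK. Qed.
Lemma grr_inv x : r (inv x) = s x. Proof. by rewrite /grs /grr ginvK. Qed.

Lemma grs_mul x y : s x = r y -> s (mul x y) = s y.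
Proof.
move=> xy; have [||-> _ _] := @gmulA _ g x y (inv y); [by []|by rewrite grr_inv|exact: grr_inv].
Qed.

Lemma grr_mul x y : s x = r y -> r (mul x y) = r x.
Proof.
by move=> xy; have [||_ <- _] := @gmulA _ g (inv x) x y; rewrite ?grs_inv.
Qed.

Lemma gmul_assoc x y z : s x = r y -> s y = r z -> mul (mul x y) z = mul x (mul y z).
Proof. by move=> xy yz; have [] := gmulA xy yz. Qed.

Lemma gmul_mulV x y : r x = r y -> mul x (mul (inv x) y) = y.
Proof. by move=> xy; have := @gmulKV _ g (inv x) y; rewrite grs_inv ginvK; apply. Qed.

Lemma gmul_divK x y : s x = s y -> mul (mul x (inv y)) y = x.
Proof. by move=> xy; have := @gmulVK _ g x (inv y); rewrite grr_inv ginvK; apply. Qed.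

Lemma gmulx1 x : mul x (s x) = x. Proof. exact: gmul_mulV. Qed.
Lemma grr_s x : r (s x) = s x.
Proof. by rewrite {1}/grs grr_mul ?grr_inv ?grs_inv. Qed.
Lemma grs_s x : s (s x) = s x.
Proof. by rewrite {2}/grs grs_mul ?grs_inv. Qed.
Lemma grr_r x : r (r x) = r x. Proof. by rewrite -{1}(grs_inv x) grr_s grs_inv. Qed.
Lemma grs_r x : s (r x) = r x. Proof. by rewrite -{1}(grs_inv x) grs_s grs_inv. Qed.

Lemma gmulI x y z : s x = r y -> s x = r z -> mul x y = mul x z -> y = z.
Proof. by move=> xy xz e; rewrite -(gmulKV xy) e gmulKV. Qed.

Lemma ginvM x y : s x = r y -> inv (mul x y) = mul (inv y) (inv x).
Proof.
move=> xy; have yx : s (inv y) = r (inv x) by rewrite grs_inv grr_inv.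
have sxy : s (mul x y) = r (mul (inv y) (inv x)) by rewrite grs_mul// grr_mul// grr_inv.
apply: (@gmulI (mul x y)) => //; first by rewrite grr_inv.
rewrite -/(r (mul x y)) grr_mul// gmul_assoc //; last by rewrite grr_mul// grr_inv.
by rewrite gmul_mulV ?grr_inv.
Qed.

End GroupoidAlgebra.

Section Units.
Context (G : ptopologicalType) (g : groupoid G).
Local Notation r := (grr g).
Local Notation s := (grs g).

Lemma units_r x : units g (r x). Proof. by exists x. Qed.
Lemma units_s x : units g (s x). Proof. by exists (s x); rewrite ?grr_s. Qed.
Lemma unitsP x : units g x <-> r x = x.
Proof. by split=> [[y _ <-]|<-]; [exact: grr_r|exact: units_r]. Qed.

Lemma units_s_r x : units g x -> s x = x.
Proof. by move=> /unitsP <-; exact: grs_r. Qed.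

End Units.

Section Factors.
Context (G : ptopologicalType) (g : groupoid G) (H1 H2 : set G).
Local Notation r := (grr g).
Local Notation s := (grs g).
Local Notation inv := (ginv g).
Local Notation mul := (gmul g).
Local Notation p1 := (p1 g H1 H2).
Local Notation p2 := (p2 g H1 H2).
Local Notation mid := (mid g H1 H2).
Hypothesis sub1 : closed_subgroupoid g H1.
Hypothesis sub2 : closed_subgroupoid g H2.
Hypothesis int12 : H1 `&` H2 = units g.

Lemma factorsP x : gprod g H1 H2 x ->
  [/\ H1 (p1 x), H2 (p2 x), s (p1 x) = r (p2 x) & mul (p1 x) (p2 x) = x].
Proof.
move=> [a [b [Ha Hb ab ->]]]; rewrite /p1 /p2 /factors.
by case: xgetP => [[c e] _ []//|/(_ (a, b))[]].
Qed.

(** If ab = ce, then c^-1 a = e b^-1 lies in [H1] and in [H2], hence is a unit, so that a = c and b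
    = e. *)
Lemma factors_uniq a b : H1 a -> H2 b -> s a = r b -> p1 (mul a b) = a /\ p2 (mul a b) = b.
Proof.
move=> Ha Hb ab.
have [Hc He ce E] : [/\ H1 (p1 (mul a b)), H2 (p2 (mul a b)),
    s (p1 (mul a b)) = r (p2 (mul a b)) & mul (p1 (mul a b)) (p2 (mul a b)) = mul a b].
  by apply: factorsP; exists a, b.
move: (p1 _) (p2 _) Hc He ce E => c e Hc He ce E.
have [_ V1 M1] := sub1; have [_ V2 M2] := sub2.
have rca : r c = r a by rewrite -(grr_mul ce) E grr_mul.
have seb : s e = s b by rewrite -(grs_mul ce) E grs_mul.
have u : mul (inv c) a = mul e (inv b).
  have ica : s (inv c) = r a by rewrite grs_inv.
  have eib : s e = r (inv b) by rewrite grr_inv.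
  apply: (@gmulI _ g c); [by rewrite grr_mul// grr_inv|by rewrite grr_mul|].
  by rewrite gmul_mulV// -gmul_assoc// E gmulVK.
have Uca : units g (mul (inv c) a).
  rewrite -int12; split; first by apply: M1 => //; [exact: V1|rewrite grs_inv].
  by rewrite u; apply: M2 => //; [exact: V2|rewrite grr_inv].
have sca : s a = s c.
  have ica : s (inv c) = r a by rewrite grs_inv.
  rewrite -(grs_mul ica) (units_s_r Uca).
  by have /(unitsP g) := Uca; rewrite grr_mul// grr_inv.
have ca : c = a.
  rewrite -[RHS](gmul_mulV rca) -(units_s_r Uca) grs_mul ?grs_inv// sca.
  by rewrite gmulx1.
by split=> //; apply: (@gmulI _ g c); [by []|by rewrite ca|by rewrite E ca].
Qed.


End Factors.

Lemma measurable_fun_paste d d' (T : measurableType d) (Y : measurableType d') (A : set T)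
    (f h : T -> Y) : measurable A -> measurable_fun A f -> measurable_fun setT h ->
  measurable_fun setT (fun x => if `[< A x >] then f x else h x).
Proof.
move=> mA mf mh _ B mB; rewrite setTI.
have -> : (fun x => if `[< A x >] then f x else h x) @^-1` B =
    (A `&` f @^-1` B) `|` (~` A `&` h @^-1` B).
  apply/seteqP; split=> x /=; first by case: asboolP => Ax Bx; [left|right].
  by case=> -[Ax Bx]; [rewrite asboolT|rewrite asboolF].
apply: measurableU; first exact: mf.
by apply: measurableI; [exact: measurableC|rewrite -[X in measurable X]setTI; exact: mh].
Qed.

(** * Borel measurability in a topological groupoid *)

Section TopologicalGroupoid.
Context (G : ptopologicalType) (g : groupoid G).
Hypothesis lcG : lc_groupoid g.
Local Notation r := (grr g).
Local Notation s := (grs g).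
Local Notation inv := (ginv g).
Local Notation mul := (gmul g).

Let hG : hausdorff_space G. Proof. by have [[]] := lcG. Qed.
Let scG : @second_countable G. Proof. by have [[]] := lcG. Qed.

Definition composable : set (G * G) := [set p | s p.1 = r p.2].

(** A total version of the product, with value [x] on pairs that cannot be composed, for which Borel
    measurability makes sense on the whole square. *)
Definition cmul x y := if `[< s x = r y >] then mul x y else x.

Lemma cmulE x y : s x = r y -> cmul x y = mul x y.
Proof. by move=> xy; rewrite /cmul asboolT. Qed.

(** The pairs (x, x^-1) are composable, so the continuity of the product within composable pairs
    applies along them. *)
Lemma continuous_grr : continuous r.
Proof.
move=> x W nW; have [_ [cI /subspace_continuousP cM]] := lcG.
have Cx : s x = r (inv x) by rewrite grr_inv.
have n1 := cM (x, inv x) Cx W nW.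
have cp : (fun y => (y, inv y)) @ x --> (x, inv x).
  by apply: cvg_pair; [exact: cvg_id|exact: cI].
have := cp _ n1; apply: (@filterS _ (nbhs x)) => y /=; apply.
by rewrite grr_inv.
Qed.

Lemma continuous_grs : continuous s.
Proof.
move=> x; have [_ [cI _]] := lcG.
rewrite (_ : s = r \o inv); last by apply/funext => y /=; rewrite grr_inv.
by apply: continuous_comp; [exact: cI|exact: continuous_grr].
Qed.

Lemma closed_composable : closed composable.
Proof.
apply: (closed_eqfun (f := fun p : G * G => s p.1) (h := fun p => r p.2)) => // p.
- by apply: (@continuous_comp _ _ _ fst s); [exact: cvg_fst|exact: continuous_grs].
- by apply: (@continuous_comp _ _ _ snd r); [exact: cvg_snd|exact: continuous_grr].
Qed.

Lemma continuous_borel (f : G -> G) : continuous f ->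
  measurable_fun setT (f : borel G -> borel G).
Proof.
move=> /continuousP cf; apply: (@measurability _ _ (borel G) (borel G) setT f open); first by [].
move=> _ [U oU <-].
by rewrite setTI; apply: open_borel; exact: cf.
Qed.

Lemma measurable_grr : measurable_fun setT (r : borel G -> borel G).
Proof. exact: continuous_borel continuous_grr. Qed.
Lemma measurable_grs : measurable_fun setT (s : borel G -> borel G).
Proof. exact: continuous_borel continuous_grs. Qed.
Lemma measurable_ginv : measurable_fun setT (inv : borel G -> borel G).
Proof. by apply: continuous_borel; have [_ []] := lcG. Qed.

Lemma measurable_cmul :
  measurable_fun setT (fun p : borel G * borel G => cmul p.1 p.2 : borel G).
Proof.
have mC : measurable (composable : set (borel G * borel G)).
  by apply: closed_borel_prod => //; exact: closed_composable.
apply: (@measurable_fun_paste _ _ (borel G * borel G)%type (borel G) composable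
  (fun p => mul p.1 p.2) (fun p => p.1) mC); last exact: measurable_fst.
apply: (@measurability _ _ (borel G * borel G)%type (borel G) composable _ open); first by [].
move=> _ [U oU <-].
have [_ [_ /subspace_continuousP cM]] := lcG.
have -> : composable `&` (fun p => mul p.1 p.2) @^-1` U =
    composable `&` [set p | composable p -> U (mul p.1 p.2)]°.
  apply/seteqP; split=> p [Cp Up]; split=> //.
    exact: (cM p Cp U (open_nbhs_nbhs (conj oU Up))).
  exact: (interior_subset Up).
by apply: measurableI => //; apply: open_borel_prod => //; exact: open_interior.
Qed.

Lemma gprod_compact (A B : set G) : compact A -> compact B -> compact (gprod g A B).
Proof.
move=> cA cB.
have -> : gprod g A B = (fun p => mul p.1 p.2) @` ((A `*` B) `&` composable).
  apply/seteqP; split=> [x [a [b [Aa Bb ab ->]]]|_ [[a b] [[/= Aa Bb] ab] <-]].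
    by exists (a, b).
  by exists a, b.
apply: continuous_compact; last first.
  by apply: compact_closedI; [exact: compact_setX|exact: closed_composable].
have [_ [_ cM]] := lcG; apply: continuous_subspaceW cM; exact: subIsetr.
Qed.

(** Closed subsets of a sigma-compact space are countable unions of compact sets, and a product of
    compact sets is compact, hence closed. *)
Lemma measurable_gprod (A B : set G) : closed A -> closed B ->
  measurable (gprod g A B : set (borel G)).
Proof.
move=> cA cB; have [[_ [K [cK KT]] _ _] _] := lcG.
have -> : gprod g A B = \bigcup_n \bigcup_k gprod g (K n `&` A) (K k `&` B).
  apply/seteqP; split=> [x [a [b [Aa Bb ab ->]]]|x [n _ [k _ [a [b [[_ Aa] [_ Bb] ab ->]]]]]].
    have [n _ Ka] : (\bigcup_n K n) a by rewrite KT.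
    have [k _ Kb] : (\bigcup_n K n) b by rewrite KT.
    by exists n => //; exists k => //; exists a, b.
  by exists a, b.
apply: bigcup_measurable => n _; apply: bigcup_measurable => k _.
apply: closed_borel; apply: compact_closed => //.
by apply: gprod_compact; exact: compact_closedI.
Qed.

Lemma measurable_units : measurable (units g : set (borel G)).
Proof.
rewrite (_ : units g = [set x | r x = x]); last by apply/seteqP; split=> x /unitsP.
exact: (@measurable_eq_fun G scG _ (borel G) (r : borel G -> borel G) id hG measurable_grr (@measurable_id _ _ _)).
Qed.

Lemma measurable_singleton (x : G) : measurable ([set x] : set (borel G)).
Proof. by apply: closed_borel; apply: compact_closed => //; exact: compact_set1. Qed.

Section MatchedPair.
Context (H1 H2 : set G).
Hypothesis sub1 : closed_subgroupoid g H1.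
Hypothesis sub2 : closed_subgroupoid g H2.
Hypothesis int12 : H1 `&` H2 = units g.

Let mgp : measurable (gprod g H1 H2 : set (borel G)).
Proof. by have [[? _ _] [? _ _]] := (sub1, sub2); exact: measurable_gprod. Qed.

(** For [p1], the inverse image of a closed [F] within H1 H2 is the product of H1 n F and H2, by
    uniqueness of the factorization; similarly for [p2]. Off H1 H2 the junk value [e] is
    continuous. *)
Let factor_measurable (p e : G -> G) :
  (forall F, closed F -> exists A B, [/\ closed A, closed B
    & gprod g H1 H2 `&` p @^-1` F = gprod g A B]) ->
  continuous e -> (forall x, ~ gprod g H1 H2 x -> p x = e x) ->
  measurable_fun setT (p : borel G -> borel G).
Proof.
move=> pF ce pe; apply: (@measurability _ _ (borel G) (borel G) setT p open); first by [].
move=> _ [U oU <-].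
have [A [B [cA cB E]]] := pF _ (open_closedC oU).
have -> : setT `&` p @^-1` U =
    (gprod g H1 H2 `\` gprod g A B) `|` (~` gprod g H1 H2 `&` e @^-1` U).
  rewrite -E setTI; apply/seteqP; split=> [x Ux|x].
    have [gx|ngx] := pselect (gprod g H1 H2 x); [left|right].
      by split=> // -[_]; exact.
    by split=> //=; rewrite -pe.
  case=> [[gx nA]|[gx ex]]; last by rewrite /= pe.
  by apply: contrapT => nU; apply: nA.
apply: measurableU.
  by apply: measurableD => //; exact: measurable_gprod.
apply: measurableI; first exact: measurableC.
by apply: open_borel; move/continuousP: ce; exact.
Qed.

Lemma measurable_p1 : measurable_fun setT (p1 g H1 H2 : borel G -> borel G).
Proof.
have [[c1 _ _] [c2 _ _]] := (sub1, sub2).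
apply: (factor_measurable (e := id)).
- move=> F cF; exists (H1 `&` F), H2; split=> //; first exact: closedI.
  apply/seteqP; split=> [x [gx Fx]|x [a [b [[Ha Fa] Hb ab ->]]]].
    have [Ha Hb ab E] := factorsP gx.
    by exists (p1 g H1 H2 x), (p2 g H1 H2 x).
  split; first by exists a, b.
  by rewrite /= (factors_uniq sub1 sub2 int12 Ha Hb ab).1.
- by move=> x; exact: cvg_id.
- move=> x ngx; rewrite /p1 /factors; case: xgetP => // -[a b] _ [/= Ha Hb ab E].
  by exfalso; apply: ngx; exists a, b.
Qed.

Lemma measurable_p2 : measurable_fun setT (p2 g H1 H2 : borel G -> borel G).
Proof.
have [[c1 _ _] [c2 _ _]] := (sub1, sub2).
apply: (factor_measurable (e := s)).
- move=> F cF; exists H1, (H2 `&` F); split=> //; first exact: closedI.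
  apply/seteqP; split=> [x [gx Fx]|x [a [b [Ha [Hb Fb] ab ->]]]].
    have [Ha Hb ab E] := factorsP gx.
    by exists (p1 g H1 H2 x), (p2 g H1 H2 x).
  split; first by exists a, b.
  by rewrite /= (factors_uniq sub1 sub2 int12 Ha Hb ab).2.
- exact: continuous_grs.
- move=> x ngx; rewrite /p2 /factors; case: xgetP => // -[a b] _ [/= Ha Hb ab E].
  by exfalso; apply: ngx; exists a, b.
Qed.

Lemma measurable_mid : measurable_fun setT (mid g H1 H2 : borel G -> borel G).
Proof. exact: measurableT_comp measurable_grs measurable_p1. Qed.

End MatchedPair.

End TopologicalGroupoid.

(** * Kernels from disintegrations and Haar systems *)

Section KernelCriterion.
Context d1 d2 (Y1 : measurableType d1) (Y2 : measurableType d2) (R : realType).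
Context (K : Y1 -> {measure set Y2 -> \bar R}) (Gen : set (set Y2)) (S : (set Y2)^nat).
Hypothesis GenE : @measurable _ Y2 = <<s Gen >>.
Hypothesis GenI : setI_closed Gen.
Hypothesis GenT : Gen setT.
Hypothesis mS : forall n, measurable (S n).
Hypothesis ndS : nondecreasing_seq S.
Hypothesis ST : \bigcup_n S n = setT.
Hypothesis Soo : forall n y, (K y (S n) < +oo)%E.
Hypothesis mK : forall E n, Gen E -> measurable_fun setT (fun y => K y (E `&` S n)).

Lemma skernel_pi_system : skernel K.
Proof.
split; last by exists S.
move=> E mE.
apply: (emeasurable_fun_cvg (fun n y => K y (E `&` S n))) => [n|y _]; last first.
  have {2}-> : E = \bigcup_n (E `&` S n) by rewrite -setI_bigcupr ST setIT.
  apply: nondecreasing_cvg_mu => [k||k l kl]; first exact: measurableI.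
    by apply: bigcup_measurable => k _; exact: measurableI.
  by apply/subsetPset; apply: setIS; apply/subsetPset; exact: ndS.
suff H : forall F, <<s Gen >> F -> measurable_fun setT (fun y => K y (F `&` S n)).
  by apply: H; rewrite -GenE.
apply: (dynkin_induction GenE) => //.
- exact: mK.
- by move=> F GF; exact: mK.
- move=> F mF PF.
  have -> : (fun y => K y (~` F `&` S n)) = (fun y => K y (S n) - K y (F `&` S n))%E.
    apply/funext => y; rewrite setIC -setDE measureD//; last exact: Soo.
    by rewrite setIC.
  apply: emeasurable_funB => //.
  by have := mK n GenT; under eq_fun do rewrite setTI.
- move=> F mF tF PF.
  have -> : (fun y => K y (\bigcup_k F k `&` S n)) = (fun y => \sum_(k <oo) K y (F k `&` S n))%E.
    apply/funext => y; rewrite setI_bigcupl measure_semi_bigcup//.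
    + by move=> k; apply: measurableI.
    + exact: trivIset_setIr.
    + by apply: bigcup_measurable => k _; apply: measurableI.
  by apply: ge0_emeasurable_sum => // k _; exact: PF.
Qed.

End KernelCriterion.

Section DisintegrationKernels.
Context dX dY (X : measurableType dX) (Y : measurableType dY) (R : realType).
Context (nu : {measure set X -> \bar R}) (mu : {measure set Y -> \bar R}) (i : Y -> X).
Context (K : X -> {measure set Y -> \bar R}).
Hypothesis sK : skernel K.
Hypothesis mi : measurable_fun setT i.

Lemma skernel_disint : (forall E, measurable E -> mu E = \int[nu]_u K u E)%E ->
  (forall u, {ae K u, forall y, i y = u}) -> disint nu mu i K.
Proof.
move=> muE Ki F nF.
have nH : nnmeas (fun y => F (i y, y)).
  by apply: (nnmeas_comp _ nF); exact: measurable_fun_pair.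
have mfK : measurable_family K.
  by move=> H nH'; exact: (skernel_integral sK (nnmeas_comp measurable_snd nH')).1.
rewrite (integral_mix mfK muE nH); apply: eq_integral => u _.
apply: ae_eq_integral => //.
- exact: nH.1.
- by apply: measurableT_comp nF.1 _; exact: measurable_pair1.
- by apply: filterS (Ki u) => y /= ->.
Qed.

(** A set of [mu] that lies in [S n], over a set [T l] of finite measure where [K u (S n)] is at
    most [k], has measure at most [k] times that of [T l]. *)
Lemma disint_sigma_finite : sigma_finite setT nu -> disint nu mu i K -> sigma_finite setT mu.
Proof.
move=> [T TT mT] dis; have [mK [S [mS ndS ST Soo]]] := sK.
pose B n k := [set u | (K u (S n) <= k%:R%:E)%E].
have mB n k : measurable (B n k).
  rewrite -[B n k]setTI; apply: emeasurable_fun_le => //; exact: mK.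
pose A (p : nat * nat * nat) := S p.1.1 `&` i @^-1` (T p.2 `&` B p.1.1 p.1.2).
have mTB p : measurable (T p.2 `&` B p.1.1 p.1.2).
  by apply: measurableI => //; case: (mT p.2).
have mA p : measurable (A p).
  by apply: measurableI => //; rewrite -[X in measurable X]setTI; exact: mi.
(* The triples (n, k, l) are enumerated by their codes; a number that codes no triple gives the
   empty set. *)
exists (fun n => if @choice.unpickle (nat * nat * nat)%type n is Some p then A p else set0).
  apply/seteqP; split=> // y _.
  have [n _ Sy] : (\bigcup_n S n) y by rewrite ST.
  have [l _ Ty] : (\bigcup_n T n) (i y) by rewrite -TT.
  have [k Bk] : exists k : nat, B n k (i y).
    have := Soo n (i y); rewrite /B /=.
    case: (K (i y) (S n)) => [a _|//|_]; last by exists 0%N; rewrite leNye.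
    by exists (Num.bound `|a|); rewrite lee_fin (le_trans (ler_norm a))// ltW// archi_boundP.
  by exists (choice.pickle (n, k, l)) => //; rewrite choice.pickleK.
move=> n; case: (choice.unpickle n) => [[[a k] l]|]; last by rewrite measure0; split.
split=> //; have [_ Too] := mT l.
have n1 := nnmeas_comp (measurable_fst (T2 := Y)) (nnmeas_indic R (mTB (a, k, l))).
have n2 := nnmeas_comp (measurable_snd (T1 := X)) (nnmeas_indic R (mS a)).
have nF := nnmeasM n1 n2.
have -> : mu (A (a, k, l)) = (\int[mu]_y ((\1_(T l `&` B a k) (i y))%:E * (\1_(S a) y)%:E))%E.
  rewrite -[A _]setIT -integral_indic//; apply: eq_integral => y _.
  by rewrite /A indicI /= -EFinM mulrC.
rewrite (dis _ nF) /=.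
apply: (@le_lt_trans _ _ (\int[nu]_u (k%:R%:E * (\1_(T l) u)%:E))%E).
  apply: le_nnmeas_integral.
  - exact: (skernel_integral sK nF).
  - apply: nnmeasM; first by apply: nnmeas_cst; rewrite lee_fin.
    by apply: nnmeas_indic; case: (mT l).
  - move=> u; rewrite ge0_integralZl//; last by apply/measurable_EFinP.
    rewrite integral_indic// setIT indicI /=.
    have [Bu|Bu] := boolP (u \in B a k).
      rewrite [\1_(B a k) u]indicE Bu /= mulr1 muleC.
      by apply: lee_wpmul2r; rewrite ?lee_fin//; move: Bu; rewrite inE.
    by rewrite [\1_(B a k) u]indicE (negbTE Bu) /= mulr0 mul0e mule_ge0// lee_fin.
have mTl : measurable (T l) by case: (mT l).
rewrite ge0_integralZl ?lee_fin//; last by apply/measurable_EFinP.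
by rewrite integral_indic// setIT lte_mul_pinfty// lee_fin.
Qed.

End DisintegrationKernels.

Lemma image_measure_ex d d' (T : measurableType d) (Y : measurableType d') (R : realType)
    (m : {measure set T -> \bar R}) (f : T -> Y) : measurable_fun setT f ->
  exists m' : {measure set Y -> \bar R}, forall F, nnmeas F -> (\int[m']_y F y = \int[m]_x F (f x))%E.
Proof.
move=> mf.
have md : measurable_family (fun x => dirac (f x) : {measure set Y -> \bar R}).
  move=> F [mF F0]; under eq_fun do rewrite integral_dirac// diracT mul1e.
  exact: measurableT_comp mF mf.
exists (mixm m md) => F nF; rewrite (integral_mixm _ md nF).
by apply: eq_integral => x _; rewrite integral_dirac ?diracT ?mul1e//; case: nF.
Qed.

Lemma integral_carried d (T : measurableType d) (R : realType) (m : {measure set T -> \bar R})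
    (A : set T) F : measurable A -> {ae m, forall x, A x} -> nnmeas F ->
  (\int[m]_(x in A) F x = \int[m]_x F x)%E.
Proof.
move=> mA aeA nF; rewrite integral_mkcond; apply: ae_eq_integral => //.
- rewrite (_ : _ \_ _ = (fun x => F x * (\1_A x)%:E)%E); last first.
    by apply/funext => x; rewrite epatch_indic.
  by have [] := nnmeasM nF (nnmeas_indic R mA).
- exact: nF.1.
- by apply: filterS aeA => x Ax _; rewrite patchE mem_set.
Qed.

Section UnitKernels.
Context (R : realType) (G : ptopologicalType) (g : groupoid G).
Hypothesis lcG : lc_groupoid g.
Local Notation measureG := {measure set (borel G) -> \bar R}.
Implicit Types (nu mu : measureG) (kap : borel G -> measureG).

Let hG : hausdorff_space G. Proof. by have [[]] := lcG. Qed.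
Let mU : measurable (units g : set (borel G)). Proof. exact: measurable_units. Qed.

(** Families of measures are only meaningful at units; the zero measure elsewhere turns an integral
    over the units into one over the whole space. *)
Definition unit_kernel kap (u : borel G) : measureG := if `[< units g u >] then kap u else mzero.

Lemma unit_kernelE kap u : units g u -> unit_kernel kap u = kap u.
Proof. by move=> Uu; rewrite /unit_kernel asboolT. Qed.

Lemma compact_cover : exists S : (set (borel G))^nat, [/\ forall n, measurable (S n),
  nondecreasing_seq S, \bigcup_n S n = setT & forall n, compact (S n : set G)].
Proof.
have [[_ [K [cK KT]] _ _] _] := lcG.
exists (fun n => \big[setU/set0]_(i < n.+1) K i); split.
- move=> n; apply: closed_borel; apply: compact_closed => //.
  exact: bigsetU_compact.
- by move=> n k nk; apply/subsetPset; exact: subset_bigsetU.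
- by rewrite bigcup_bigsetU_bigcup.
- by move=> n; exact: bigsetU_compact.
Qed.

Lemma radon_sigma_finite nu : radon nu -> sigma_finite setT nu.
Proof.
by move=> [nK _]; have [S [mS _ ST cS]] := compact_cover; exists S => // n; split=> //; exact: nK.
Qed.

Lemma mixtureE nu kap (E : set (borel G)) : mixture g nu kap E = (\int[nu]_u unit_kernel kap u E)%E.
Proof.
rewrite /mixture integral_mkcond; apply: eq_integral => u _; rewrite patchE /unit_kernel.
case: asboolP => Uu; first by rewrite ifT// inE.
by rewrite ifF//; apply/negP; rewrite inE.
Qed.

Lemma unit_kernel_measurable kap (E : set (borel G)) :
  measurable_fun (units g : set (borel G)) (fun u => kap u E) ->
  measurable_fun setT (fun u => unit_kernel kap u E).
Proof.
move=> mk; have := measurable_fun_paste mU mk (@measurable_cst _ _ _ _ setT 0%E).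
by congr measurable_fun; apply/funext => u; rewrite /unit_kernel; case: asboolP.
Qed.

Lemma unit_kernel_ae kap u (P : set G) : (units g u -> {ae kap u, forall y, P y}) ->
  {ae unit_kernel kap u, forall y, P y}.
Proof.
rewrite /unit_kernel; case: asboolP => [Uu /(_ Uu)//|_ _].
by exists setT; split.
Qed.

Lemma disintegration_skernel nu mu (i : G -> G) kap : disintegration g nu mu i kap ->
  skernel (unit_kernel kap).
Proof.
move=> [_ rk _ mk _]; split; first by move=> E mE; apply: unit_kernel_measurable; exact: mk.
have [S [mS ndS ST cS]] := compact_cover; exists S; split=> // n u.
rewrite /unit_kernel; case: asboolP => Uu; last by rewrite /mzero /= ltry.
by have [kK _] := rk u Uu; exact: kK.
Qed.

Lemma disintegration_disint nu mu (i : borel G -> borel G) kap : measurable_fun setT i ->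
  disintegration g nu mu i kap -> disint nu mu i (unit_kernel kap).
Proof.
move=> mi dis; have sk := disintegration_skernel dis; have [_ _ ki _ muE] := dis.
apply: skernel_disint => // [E mE|u]; first by rewrite muE// mixtureE.
apply: unit_kernel_ae => Uu; exists (~` (i @^-1` [set u])); split=> //.
  apply: measurableC; rewrite -[X in measurable X]setTI; apply: mi => //.
  exact: (measurable_singleton lcG).
exact: ki.
Qed.

Lemma disintegration_leg nu mu (i : borel G -> borel G) kap : measurable_fun setT i ->
  sigma_finite setT mu -> disintegration g nu mu i kap -> leg nu mu i.
Proof. by move=> mi smu [iff _ _ _ _]; split=> // A mA /iff; apply. Qed.

End UnitKernels.

(** * Haar systems as kernels *)

Section HaarSystem.
Context (R : realType) (G : ptopologicalType) (g : groupoid G).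
Hypothesis lcG : lc_groupoid g.
Local Notation measureG := {measure set (borel G) -> \bar R}.
Context (lam : borel G -> measureG).
Hypothesis haar : haar_system g setT lam.
Local Notation r := (grr g).
Local Notation s := (grs g).
Local Notation inv := (ginv g).
Local Notation mul := (gmul g).

Let hG : hausdorff_space G. Proof. by have [[]] := lcG. Qed.
Let scG : @second_countable G. Proof. by have [[]] := lcG. Qed.
Let lG : locally_compact [set: G]. Proof. by have [[]] := lcG. Qed.

Let within_borel (A : set (borel G)) (f : G -> R) : measurable A ->
  {within (A : set G), continuous f} -> measurable_fun A (f : borel G -> R).
Proof.
move=> mA /subspace_continuousP cf; apply: (measurability _ (RGenOpens.measurableE R)).
move=> _ [_ [a [b ->] <-]].
have oI : open `]a, b[%classic by exact: interval_open.
have -> : A `&` f @^-1` `]a, b[ = A `&` [set x | A x -> `]a, b[%classic (f x)]°.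
  apply/seteqP; split=> x [Ax fx]; split=> //.
    exact: (cf x Ax _ (open_nbhs_nbhs (conj oI fx))).
  exact: (interior_subset fx).
by apply: measurableI => //; apply: open_borel; exact: open_interior.
Qed.

Let bump_borel (f : G -> R) : bump f -> measurable_fun setT (f : borel G -> R).
Proof. by move=> [cf _ _]; apply: within_borel => //; exact: continuous_subspaceT. Qed.

Let bump_fin (m : measureG) (A : set (borel G)) (f : G -> R) : measurable A -> (forall K : set G, compact K -> m K < +oo)%E ->
  bump f -> (forall x, f x <= 1) -> (\int[m]_(x in A) (f x)%:E < +oo)%E.
Proof.
move=> mA mK bf f1; have [_ f0 [K [cK fK]]] := bf.
have mKb : measurable (K : set (borel G)) by apply: closed_borel; exact: compact_closed.
apply: (@le_lt_trans _ _ (\int[m]_x (\1_K x)%:E)%E).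
  apply: (@le_trans _ _ (\int[m]_x (f x)%:E)%E).
    apply: ge0_subset_integral => //; first by apply/measurable_EFinP; exact: bump_borel.
    by move=> x _; rewrite lee_fin.
  apply: ge0_le_integral => //.
  - by move=> x _; rewrite lee_fin.
  - by apply/measurable_EFinP; exact: bump_borel.
  - by apply/measurable_EFinP.
  - move=> x _; rewrite lee_fin indicE; have [xK|/negP xK] := boolP (x \in K); first exact: f1.
    by rewrite fK//; move=> /mem_set.
by rewrite integral_indic// setIT; exact: mK.
Qed.

Let bump_Cc (f : G -> R) : bump f -> Cc_on setT f.
Proof.
move=> [cf _ [K [cK fK]]]; split; first exact: continuous_subspaceT.
by exists K; split=> // x _; exact: fK.
Qed.

Section Approximation.
Context (U : set G) (g_ : nat -> G -> R).
Hypothesis bg : forall n, bump (g_ n).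
Hypothesis g1 : forall n x, g_ n x <= 1.
Hypothesis ndg : forall x, nondecreasing_seq (g_ ^~ x).
Hypothesis gU : forall n x, ~ U x -> g_ n x = 0.
Hypothesis gS : forall x, U x -> exists n, g_ n x = 1.

Lemma approx_cvg (m : measureG) : open U -> (\int[m]_x (g_ n x)%:E @[n --> \oo] --> m U)%E.
Proof.
move=> oU; have mU : measurable (U : set (borel G)) by exact: open_borel.
rewrite -[U in m U]setIT -integral_indic//.
have -> : (\int[m]_x (\1_U x)%:E = \int[m]_x limn (fun n => (g_ n x)%:E))%E.
  apply: eq_integral => x _; apply/esym/cvg_lim => //; apply: cvg_near_cst.
  rewrite indicE; have [xU|/negP xU] := boolP (x \in U); last first.
    by near=> n; rewrite gU// => /mem_set.
  have [k gk] := gS (set_mem xU); near=> n; congr _%:E; apply/eqP.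
  rewrite eq_le g1 /= -gk; apply: ndg; near: n; exact: nbhs_infty_ge.
apply: cvg_monotone_convergence => //.
- by move=> n; apply/measurable_EFinP; exact: bump_borel.
- by move=> n x _; rewrite lee_fin; have [_ + _] := bg n.
- by move=> x _ n k nk; rewrite lee_fin; exact: ndg.
Unshelve. all: by end_near. Qed.

End Approximation.

Let bump_EFin (m : measureG) (A : set (borel G)) (f : G -> R) : measurable A ->
  (forall K : set G, compact K -> m K < +oo)%E -> bump f -> (forall x, f x <= 1) ->
  ((\int[m]_(x in A) f x)%:E = \int[m]_(x in A) (f x)%:E)%E.
Proof.
move=> mA mK bf f1; have [_ f0 _] := bf; rewrite /Rintegral fineK// ge0_fin_numE.
  exact: bump_fin.
by apply: integral_ge0 => x _; rewrite lee_fin.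
Qed.

(** Integrals of bumps are continuous on the units, so measures of open sets are limits of
    measurable functions; the open sets are a generating pi-system. *)
Lemma haar_kernel : skernel (unit_kernel g lam).
Proof.
have [rl _ cl _] := haar.
have lK u : units g u -> forall K : set G, compact K -> (lam u K < +oo)%E.
  by move=> Uu; have [] := rl u Uu.
have mU : measurable (units g : set (borel G)) by exact: measurable_units.
have open_meas (U : set G) : open U -> measurable_fun setT (fun u => unit_kernel g lam u U).
  move=> oU; have [g_ [bg g1 ndg gU gS]] := open_indic_sup R hG lG scG oU.
  apply: (emeasurable_fun_cvg (fun n u => \int[unit_kernel g lam u]_x (g_ n x)%:E)%E) => [n|u _].
    have mR : measurable_fun (units g : set (borel G)) (fun u => \int[lam u]_(x in setT) g_ n x).
      exact: (within_borel mU (cl _ (bump_Cc (bg n)))).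
    have mE : measurable_fun (units g : set (borel G)) (fun u => (\int[lam u]_(x in setT) g_ n x)%:E).
      exact/measurable_EFinP.
    have := measurable_fun_paste mU mE (@measurable_cst _ _ _ _ setT 0%E).
    congr measurable_fun; apply/funext => u; rewrite /unit_kernel; case: asboolP => Uu.
      by rewrite bump_EFin//; exact: lK.
    by rewrite integral_measure_zero.
  exact: (approx_cvg bg g1 ndg gU gS).
have [h [bh h1 ndh _ hS]] := open_indic_sup R hG lG scG openT.
(* Open sets contained in the compact supports of the [h n], hence of finite measure for all units
   at once; together they cover [G]. *)
pose S n : set (borel G) := [set x | 0 < h n x].
have oS n : open (S n : set G).
  by have [/continuousP ch _ _] := bh n; exact: (ch _ (@open_gt R 0)).
apply: (@skernel_pi_system _ _ (borel G) (borel G) R (unit_kernel g lam) open S) => //.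
- exact: openI.
- exact: openT.
- by move=> n; exact: open_borel.
- move=> n k nk; apply/subsetPset => x; rewrite /S /= => /lt_le_trans; apply; exact: ndh.
- by apply/seteqP; split=> // x _; have [n hn] := hS x I; exists n => //; rewrite /S /= hn.
- move=> n u; rewrite /unit_kernel; case: asboolP => Uu; last by rewrite /mzero /= ltry.
  have [_ _ [K [cK hK]]] := bh n; apply: le_lt_trans (lK u Uu K cK).
  apply: le_measure; rewrite ?inE; [exact: open_borel|apply: closed_borel; exact: compact_closed|].
  by move=> x; rewrite /S /=; apply: contraPP => /hK ->; rewrite ltxx.
- by move=> E n oE; apply: open_meas; exact: openI.
Qed.

(** A point outside the fibre is outside the support, so it has a null neighbourhood. *)
Lemma haar_carried u : units g u -> {ae lam u, forall y, r y = u}.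
Proof.
move=> Uu; have [_ sl _ _] := haar.
apply: null_from_support => // x rx; apply: contrapT => nU.
apply: rx; suff [] : (setT `&` r @^-1` [set u]) x by [].
rewrite -(sl u Uu) => V oV Vx; rewrite lt0e measure_ge0 andbT; apply/eqP => V0.
by apply: nU; exists V.
Qed.

Lemma bump_determines (m1 m2 : measureG) :
  (forall f, bump f -> (forall x, f x <= 1) -> (\int[m1]_x (f x)%:E = \int[m2]_x (f x)%:E)%E) ->
  (forall K : set G, compact K -> (m1 K < +oo)%E) ->
  forall E, measurable E -> m1 E = m2 E.
Proof.
move=> m12 m1K.
have [h [bh h1 ndh _ hS]] := open_indic_sup R hG lG scG openT.
pose S n : set (borel G) := [set x | 0 < h n x].
apply: (@measure_unique _ R (borel G) open S) => //.
- exact: openI.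
- by move=> n; have [/continuousP ch _ _] := bh n; exact: (ch _ (@open_gt R 0)).
- by apply/seteqP; split=> // x _; have [n hn] := hS x I; exists n => //; rewrite /S /= hn.
- move=> U oU; have [g_ [bg g1 ndg gU gS]] := open_indic_sup R hG lG scG oU.
  have c1 := approx_cvg bg g1 ndg gU gS (m := m1) oU; have c2 := approx_cvg bg g1 ndg gU gS (m := m2) oU.
  rewrite (_ : (fun n => _) = fun n => (\int[m1]_x (g_ n x)%:E)%E) in c2; last first.
    by apply/funext => n; rewrite m12.
  by rewrite -(cvg_lim _ c1)// (cvg_lim _ c2).
- move=> n; have [/continuousP ch _ [K [cK hK]]] := bh n; apply: le_lt_trans (m1K K cK).
  have oS : open (S n : set G) by exact: (ch _ (@open_gt R 0)).
  apply: le_measure; rewrite ?inE; [exact: open_borel|apply: closed_borel; exact: compact_closed|].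
  by move=> x; rewrite /S /=; apply: contraPP => /hK ->; rewrite ltxx.
Qed.

(** The translate of [lam (s x)] and [lam (r x)] agree on bumps by the axiom of Haar systems, hence
    on all Borel sets. *)
Lemma haar_left x (F : borel G -> \bar R) : nnmeas F ->
  (\int[lam (s x)]_y F (cmul g x y) = \int[lam (r x)]_y F y)%E.
Proof.
move=> nF; have [rl _ _ inv_lam] := haar.
have lK u : units g u -> forall K : set G, compact K -> (lam u K < +oo)%E.
  by move=> Uu; have [] := rl u Uu.
have [Us Ur] := (units_s g x, units_r g x).
have mx : measurable_fun setT (fun y : borel G => cmul g x y : borel G).
  exact: (measurableT_comp (measurable_cmul lcG) (@measurable_pair1 _ _ (borel G) (borel G) x)).
have mfib u : measurable (setT `&` r @^-1` [set u] : set (borel G)).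
  by apply: (measurable_grr lcG) => //; exact: (measurable_singleton lcG).
have [m' m'E] := image_measure_ex (lam (s x)) mx.
rewrite -m'E//; apply: eq_measure_integral => E mE _; apply/esym.
apply: bump_determines E mE => [f bf f1|]; last exact: lK.
have [_ f0 [K [cK fK]]] := bf.
have nf : nnmeas (fun y : borel G => (f y)%:E).
  by apply: nnmeas_EFin => //; exact: bump_borel.
have nfx := nnmeas_comp mx nf.
have aeS : {ae lam (s x), forall y, (setT `&` r @^-1` [set s x]) y}.
  have [N [mN N0 sN]] := haar_carried Us; exists N; split=> // y ny; apply: sN => /= ry.
  by apply: ny; split.
rewrite m'E// -(integral_carried (mfib (r x)) _ nf); last first.
  have [N [mN N0 sN]] := haar_carried Ur; exists N; split=> // y ny; apply: sN => /= ry.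
  by apply: ny; split.
rewrite -(integral_carried (mfib (s x)) aeS nfx) /=.
rewrite -(bump_EFin (mfib (r x)) (lK _ Ur) bf f1) -(inv_lam f x (bump_Cc bf) I).
have -> : (\int[lam (s x)]_(y in setT `&` r @^-1` [set s x]) (f (cmul g x y))%:E =
    \int[lam (s x)]_(y in setT `&` r @^-1` [set s x]) (f (mul x y))%:E)%E.
  by apply: eq_integral => y; rewrite inE => -[_ /= ry]; rewrite cmulE.
rewrite /Rintegral fineK// ge0_fin_numE; last by apply: integral_ge0 => y _; rewrite lee_fin.
(* f(xy) vanishes for y outside the compact set x^-1 K. Its integral is therefore finite, and the
   invariance of real integrals carries over to extended ones. *)
have cL := gprod_compact lcG (@compact_set1 _ (inv x)) cK.
have mL : measurable (gprod g [set inv x] K : set (borel G)).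
  by apply: closed_borel; exact: compact_closed.
apply: le_lt_trans (lK _ Us _ cL).
rewrite -[X in lam (s x) X]setIT -integral_indic//.
rewrite -(integral_carried (mfib (s x)) aeS (nnmeas_indic R mL)).
apply: ge0_le_integral => //.
- by move=> y _; rewrite lee_fin.
- apply: (eq_measurable_fun (fun y : borel G => (f (cmul g x y))%:E)).
    by move=> y; rewrite inE => -[_ /= ry]; rewrite cmulE.
  by apply: measurable_funS nfx.1.
- by apply/measurable_EFinP; exact: measurable_indic.
- move=> y [_ /= ry]; rewrite lee_fin indicE.
  have [yL|/negP yL] := boolP (y \in _); first exact: f1.
  rewrite fK// => Kxy; apply: yL; apply: mem_set; exists (inv x), (mul x y); split=> //.
    by rewrite grs_inv grr_mul.
  by rewrite gmulKV.
Qed.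

End HaarSystem.

(** * Change of variables *)

Section KernelSwap.
Context dX dA dB (X : measurableType dX) (A : measurableType dA) (B : measurableType dB) (R : realType).
Context (nu : {measure set X -> \bar R}).
Context (rho : {measure set A -> \bar R}) (i : A -> X) (lam : X -> {measure set A -> \bar R}).
Context (rho' : {measure set B -> \bar R}) (j : B -> X) (kap : X -> {measure set B -> \bar R}).
Hypotheses (sl : skernel lam) (sk : skernel kap).
Hypotheses (dl : disint nu rho i lam) (dk : disint nu rho' j kap).

(** Both sides are the integral over [nu] of the double integral of [F] against [lam u] and [kap u].
    The disintegrations may be any that are available. *)
Lemma kernel_swap F : nnmeas F ->
  (\int[rho]_a \int[kap (i a)]_b F (a, b) = \int[rho']_b \int[lam (j b)]_a F (a, b))%E.
Proof.
move=> nF.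
have nF1 : nnmeas (fun w : X * A * B => F (w.1.2, w.2)).
  apply: (nnmeas_comp _ nF); apply: measurable_fun_pair => //.
  exact: measurableT_comp measurable_snd measurable_fst.
have nF2 : nnmeas (fun w : X * B * A => F (w.2, w.1.2)).
  apply: (nnmeas_comp _ nF); apply: measurable_fun_pair => //.
  exact: measurableT_comp measurable_snd measurable_fst.
have nH1 : nnmeas (fun w : X * A => \int[kap w.1]_b F (w.2, b))%E.
  exact: (skernel_integral (skernel_comp measurable_fst sk) nF1).
have nH2 : nnmeas (fun w : X * B => \int[lam w.1]_a F (a, w.2))%E.
  exact: (skernel_integral (skernel_comp measurable_fst sl) nF2).
rewrite (dl nH1) (dk nH2) /=; apply: eq_integral => u _.
by apply: tonelli; [exact: skernel_sigma_finite|exact: skernel_sigma_finite|].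
Qed.

Lemma kprod_swap dZ (Z : measurableType dZ) (M : {measure set Z -> \bar R}) q1 q2 :
  kprod rho (fun a => kap (i a)) M q1 q2 -> kprod rho' (fun b => lam (j b)) M q2 q1.
Proof.
move=> [m1 m2 [q [mq qK]] k]; split => //.
  exists (fun w => q (w.2, w.1)); split=> //; apply: measurableT_comp mq _.
  exact: measurable_fun_pair.
move=> F nF; have nG : nnmeas (fun w => F (w.2, w.1)).
  by apply: (nnmeas_comp _ nF); exact: measurable_fun_pair.
by rewrite (k _ nG) (kernel_swap nG).
Qed.

End KernelSwap.

Section FibreMeasure.
Context dX dA dB (X : measurableType dX) (A : measurableType dA) (B : measurableType dB) (R : realType).
Context (nu : {measure set X -> \bar R}) (rho : {measure set A -> \bar R}) (i : A -> X).
Context (lam : X -> {measure set A -> \bar R}) (kap : X -> {measure set B -> \bar R}).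
Context (M : {measure set (A * B) -> \bar R}).
Hypotheses (sk : skernel kap) (mi : measurable_fun setT i).
Hypothesis dl : disint nu rho i lam.

Lemma fibre_kprod : (forall E, measurable E -> M E = \int[nu]_u (lam u \x kap u) E)%E ->
  kprod rho (fun a => kap (i a)) M fst snd.
Proof.
move=> ME; have sk' := skernel_comp mi sk.
have [T kT] : exists T, kprod rho (fun a => kap (i a)) T (fst : A * B -> A) snd.
  by apply: (kprod_ex rho (q := id) sk') => //; first [exact: measurable_id|case].
have [m1 m2 q k] := kT; split=> // F nF; rewrite -(k _ nF).
apply: eq_measure_integral => E mE _; rewrite ME//.
rewrite -[E in RHS]setIT -integral_indic//.
have nE : nnmeas (fun w : A * B => (\1_E w)%:E : \bar R) by exact: nnmeas_indic.
have -> : (\int[T]_w (\1_E w)%:E = \int[T]_w (\1_E (w.1, w.2))%:E)%E.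
  by apply: eq_integral => -[].
rewrite (k _ nE).
have nE' : nnmeas (fun w : X * A * B => (\1_E (w.1.2, w.2))%:E : \bar R).
  apply: (nnmeas_comp _ nE); apply: measurable_fun_pair => //.
  exact: measurableT_comp measurable_snd measurable_fst.
have nH : nnmeas (fun w : X * A => \int[kap w.1]_b (\1_E (w.2, b))%:E)%E.
  exact: (skernel_integral (skernel_comp measurable_fst sk) nE').
rewrite (dl nH) /=; apply: eq_integral => u _; apply: eq_integral => a _ /=.
rewrite -[X in _ X = _]setIT -integral_indic//; last exact: measurable_xsection.
by apply: eq_integral => b _; rewrite !indicE mem_xsection.
Qed.

End FibreMeasure.

(** * Strictly positive densities of equivalent measures *)

Section EquivalentMeasures.
Context d (T : measurableType d) (R : realType) (mu mu' : {measure set T -> \bar R}).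
Hypotheses (smu : sigma_finite setT mu) (smu' : sigma_finite setT mu').

(** The densities on pieces of finite measure are glued into one function; equivalence of the
    measures makes its zero set null. *)
Lemma equivalent_density :
  (forall E, measurable E -> mu E = 0%E <-> mu' E = 0%E) ->
  exists delta : T -> R, [/\ measurable_fun setT delta, forall x, 0 < delta x
    & forall F, nnmeas F -> (\int[mu]_x F x = \int[mu']_x (F x * (delta x)%:E))%E].
Proof.
move=> mumu'.
have [S ST mS] := smu.
have mSn n : measurable (S n) by case: (mS n).
pose B := seqDU S.
have mB n : measurable (B n) by apply: measurableD => //; exact: bigsetU_measurable.
have Boo n : (mu (B n) < +oo)%E.
  have [_] := mS n; apply: le_lt_trans; apply: le_measure; rewrite ?inE//; exact: subset_seqDU.
have BT : \bigcup_n B n = setT by rewrite -seqDU_bigcup_eq ST.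
have lg : leg mu' mu id.
  by split=> [||A mA /(mumu' _ mA)//]; first exact: measurable_id.
have /choice[phi phiP] : forall n, exists f, density mu' mu id \1_(B n) f.
  by move=> n; exact: (density_indic smu' lg (mB n) (Boo n)).
(* The index of the piece that contains [x]; the pieces cover the space, so the default value does
   not occur. *)
pose N x := xget 0%N [set n | B n x].
have NE n x : B n x -> N x = n.
  move=> Bn; rewrite /N; case: xgetP => [k _ Bk|/(_ n)//].
  by apply: (@trivIset_seqDU _ S k n I I); exists x.
pose del x := phi (N x) x.
have mdel : measurable_fun setT del.
  move=> _ C mC; rewrite setTI.
  have -> : del @^-1` C = \bigcup_n (B n `&` phi n @^-1` C).
    apply/seteqP; split=> [x Cx|x [n _ [Bn Cx]]].
      have [n _ Bn] : (\bigcup_n B n) x by rewrite BT.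
      by exists n => //; split=> //; rewrite -(NE _ _ Bn).
    by rewrite /del /= (NE _ _ Bn).
  apply: bigcup_measurable => n _; apply: measurableI => //.
  by rewrite -[X in measurable X]setTI; have [mp _ _] := phiP n; exact: mp.
have del0 x : 0 <= del x by have [_ p0 _] := phiP (N x); exact: p0.
have delE F : nnmeas F -> (\int[mu]_x F x = \int[mu']_x (F x * (del x)%:E))%E.
  move=> nF; have nFd := nnmeasM nF (nnmeas_EFin mdel del0).
  have tB : trivIset setT B := @trivIset_seqDU _ S.
  rewrite -BT ge0_integral_bigcup//; last 2 first.
    by rewrite BT; exact: nF.1.
    by move=> x _; exact: nF.2.
  rewrite ge0_integral_bigcup//; last 2 first.
    by rewrite BT; exact: nFd.1.
    by move=> x _; exact: nFd.2.
  apply: eq_eseriesr => n _; have [_ _ C] := phiP n.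
  rewrite [LHS]integral_mkcond [RHS]integral_mkcond.
  have nG : nnmeas (fun x => F x * (\1_(B n) x)%:E)%E by apply: nnmeasM nF (nnmeas_indic R (mB n)).
  transitivity (\int[mu]_x ((F x * (\1_(B n) x)%:E) * (\1_(B n) x)%:E))%E.
    apply: eq_integral => x _; rewrite epatch_indic -muleA -EFinM; congr (_ * _%:E)%E.
    by rewrite indicE; case: (x \in B n); rewrite ?mulr1// mulr0.
  rewrite (C _ nG); apply: eq_integral => x _; rewrite epatch_indic /= !indicE.
  case: (boolP (x \in B n)) => [|_]; last by rewrite /= !mule0 mul0e.
  by rewrite inE /del => /NE ->; rewrite /= !mule1.
pose Z := [set x | del x <= 0].
have mZ : measurable Z.
  by rewrite -[Z]setTI; apply: measurable_fun_le => //; exact: measurable_cst.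
have Z0 : mu' Z = 0%E.
  apply/(mumu' _ mZ); rewrite -[Z]setIT -integral_indic// delE; last exact: nnmeas_indic.
  apply: integral0_eq => x _; rewrite indicE; have [xZ|_] := boolP (x \in Z); last by rewrite mul0e.
  by rewrite mul1e; congr _%:E; apply/le_anti; rewrite del0 andbT; exact: (set_mem xZ).
(* Any positive value will do on the null set [Z]; this makes the density positive everywhere, as
   division by it requires. *)
exists (fun x => if `[< Z x >] then 1 else del x); split.
- by apply: measurable_fun_paste => //; exact: measurable_cst.
- by move=> x; case: asboolP => // /negP; rewrite -ltNge.
- move=> F nF; rewrite delE//; apply: ae_eq_integral => //.
  + exact: (nnmeasM nF (nnmeas_EFin mdel del0)).1.
  + apply: emeasurable_funM; first exact: nF.1.
    by apply/measurable_EFinP; apply: measurable_fun_paste => //; exact: measurable_cst.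
  + exists Z; split=> // x /=; apply: contra_notP => nZ _.
    by rewrite asboolF.
Qed.

End EquivalentMeasures.

(** * The point map of a matched pair *)

Section ThetaAlgebra.
Context (G : ptopologicalType) (g : groupoid G) (H1 H2 : set G).
Local Notation r := (grr g).
Local Notation s := (grs g).
Local Notation inv := (ginv g).
Local Notation mul := (gmul g).
Local Notation p1 := (p1 g H1 H2).
Local Notation p2 := (p2 g H1 H2).
Local Notation mid := (mid g H1 H2).
Local Notation cm := (cmul g).
Local Notation gp := (gprod g H1 H2).
Local Notation dom := (theta_dom g H1 H2).
Hypothesis sub1 : closed_subgroupoid g H1.
Hypothesis sub2 : closed_subgroupoid g H2.
Hypothesis int12 : H1 `&` H2 = units g.

(** The map [theta] written with the total product, hence Borel on the whole square; the two agree
    on [theta_dom]. *)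
Definition thetac (w : G * G) : G * G :=
  let z := cm (inv (p2 w.1)) w.2 in (cm w.1 (p1 z), z).

(** From X = x p1(z) and z = p2(x)^-1 y one recovers x = X p1(z)^-1, then y = p2(x) z. *)
Definition thetac_inv (w : G * G) : G * G :=
  let x := cm w.1 (inv (p1 w.2)) in (x, cm (p2 x) w.2).

Lemma theta_domP x y : dom (x, y) -> [/\ mid x = r y, gp x & gp (mul (inv (p2 x)) y)].
Proof. by []. Qed.

Lemma grr_p1 x : gp x -> r (p1 x) = r x.
Proof. by move=> /factorsP[_ _ e {2}<-]; rewrite grr_mul. Qed.

Lemma grs_p2 x : gp x -> s (p2 x) = s x.
Proof. by move=> /factorsP[_ _ e {2}<-]; rewrite grs_mul. Qed.

Lemma mid_r x : gp x -> mid x = r (p2 x).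
Proof. by move=> /factorsP[_ _ e _]. Qed.

Lemma thetac_dom x y : gp x -> r y = mid x -> let z := mul (inv (p2 x)) y in
  [/\ cm (inv (p2 x)) y = z, r z = s x, s z = s y & mul (p2 x) z = y].
Proof.
move=> gx ry z; have e : s (inv (p2 x)) = r y by rewrite grs_inv ry mid_r.
split; first exact: cmulE.
- by rewrite /z grr_mul// grr_inv grs_p2.
- by rewrite /z grs_mul.
- by rewrite /z gmul_mulV// ry mid_r.
Qed.

Lemma thetacE x y : dom (x, y) -> thetac (x, y) = theta g H1 H2 (x, y).
Proof.
move=> [/= xy gx gz]; have [E rz _ _] := thetac_dom gx (esym xy).
by rewrite /thetac /theta /= E cmulE// grr_p1.
Qed.

Lemma theta_domE : dom = [set w | [/\ mid w.1 = r w.2, gp w.1 & gp (cm (inv (p2 w.1)) w.2)]].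
Proof.
by apply/seteqP; split=> -[x y] [/= xy gx]; have [E _ _ _] := thetac_dom gx (esym xy);
  rewrite -?E => gz; split=> //=; rewrite -?E// E.
Qed.

Lemma thetacK w : dom w -> thetac_inv (thetac w) = w.
Proof.
case: w => x y Dxy; have [xy gx gz] := theta_domP Dxy.
have [E rz _ bz] := thetac_dom gx (esym xy).
rewrite (thetacE Dxy) /theta /thetac_inv /=.
have rc := grr_p1 gz; set c := p1 _ in rc *; set z := mul (inv (p2 x)) y in rz bz rc *.
have xc : s x = r c by rewrite rc.
rewrite cmulE ?grs_mul ?grr_inv// gmulVK// cmulE ?bz//.
by rewrite grs_p2.
Qed.

(* With x = ab, b^-1 y = cd and y = ef', one gets xc = (ae)f for f = f' d^-1. *)
Lemma theta_factors x y : dom (x, y) -> gp y ->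
  let z := mul (inv (p2 x)) y in let f := mul (p2 y) (inv (p2 z)) in
  [/\ p1 (mul x (p1 z)) = mul (p1 x) (p1 y), p2 (mul x (p1 z)) = f,
      s (p1 x) = r (p1 y), s f = r (p2 z) & mul f (p2 z) = p2 y].
Proof.
move=> [/= xy gx gz] gy; have [_ rz sz bz] := thetac_dom gx (esym xy).
move: (mul (inv (p2 x)) y) gz rz sz bz => z gz rz sz bz /=.
have [Ha Hb ab E] := factorsP gx; have [Hc Hd cd Ez] := factorsP gz.
have [He Hf ef Ey] := factorsP gy.
have [_ _ M1] := sub1; have [_ V2 M2] := sub2.
have ae : s (p1 x) = r (p1 y) by rewrite grr_p1.
have fd : s (p2 y) = r (inv (p2 z)) by rewrite grr_inv !grs_p2.
have Hfd : H2 (mul (p2 y) (inv (p2 z))) by apply: M2 => //; exact: V2.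
have xc : mul x (p1 z) = mul (mul (p1 x) (p1 y)) (mul (p2 y) (inv (p2 z))).
  have bc : s (p2 x) = r (p1 z) by rewrite grs_p2// grr_p1.
  have bz' : s (p2 x) = r z by rewrite grs_p2.
  have zd : s z = r (inv (p2 z)) by rewrite grr_inv grs_p2.
  have yd : s y = r (inv (p2 z)) by rewrite -sz.
  rewrite gmul_assoc//; last by rewrite grr_mul.
  rewrite -[X in mul (p1 x) X]gmul_assoc// Ey -bz gmul_assoc// -{2}Ez gmulVK//.
  by rewrite -{1}E gmul_assoc.
have aef : s (mul (p1 x) (p1 y)) = r (mul (p2 y) (inv (p2 z))).
  by rewrite grs_mul// grr_mul.
rewrite xc; have [-> ->] := factors_uniq sub1 sub2 int12 (M1 _ _ Ha He ae) Hfd aef.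
split=> //; first by rewrite grs_mul// grs_inv.
by rewrite gmul_divK// !grs_p2.
Qed.

Lemma thetac_grr x y : dom (x, y) -> r (thetac (x, y)).1 = r x /\ r (thetac (x, y)).2 = s x.
Proof.
move=> Dxy; have [xy gx gz] := theta_domP Dxy; have [_ rz _ _] := thetac_dom gx (esym xy).
by rewrite (thetacE Dxy) /= grr_mul// grr_p1.
Qed.

Lemma thetac_grs x y : dom (x, y) -> s (thetac (x, y)).2 = s y.
Proof.
move=> Dxy; have [xy gx gz] := theta_domP Dxy; have [_ _ sz _] := thetac_dom gx (esym xy).
by rewrite (thetacE Dxy).
Qed.

Lemma thetac_mid x y : dom (x, y) -> gp y -> mid (thetac (x, y)).1 = mid y.
Proof.
move=> Dxy gy; have [E _ ae _ _] := theta_factors Dxy gy.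
by rewrite (thetacE Dxy) /mid /= E grs_mul.
Qed.

Lemma gprod_mulr x b : gp x -> H2 b -> s x = r b ->
  [/\ gp (mul x b), p1 (mul x b) = p1 x & p2 (mul x b) = mul (p2 x) b].
Proof.
move=> gx Hb xb; have [Ha Hc ac E] := factorsP gx; have [_ _ M2] := sub2.
have cb : s (p2 x) = r b by rewrite grs_p2.
have Hcb := M2 _ _ Hc Hb cb; have acb : s (p1 x) = r (mul (p2 x) b) by rewrite grr_mul.
have Eb : mul x b = mul (p1 x) (mul (p2 x) b) by rewrite -gmul_assoc// E.
have [e1 e2] := factors_uniq sub1 sub2 int12 Ha Hcb acb.
by rewrite Eb e1 e2; split=> //; exists (p1 x), (mul (p2 x) b).
Qed.

Lemma gprod_mull a x : H1 a -> gp x -> s a = r x ->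
  [/\ gp (mul a x), p1 (mul a x) = mul a (p1 x) & p2 (mul a x) = p2 x].
Proof.
move=> Ha gx ax; have [Hb Hc bc E] := factorsP gx; have [_ _ M1] := sub1.
have ab : s a = r (p1 x) by rewrite grr_p1.
have Hab := M1 _ _ Ha Hb ab; have abc : s (mul a (p1 x)) = r (p2 x) by rewrite grs_mul.
have Eb : mul a x = mul (mul a (p1 x)) (p2 x) by rewrite gmul_assoc// E.
have [e1 e2] := factors_uniq sub1 sub2 int12 Hab Hc abc.
by rewrite Eb e1 e2; split=> //; exists (mul a (p1 x)), (p2 x).
Qed.

(** Everything rests on v = p2(t) q: as p2(X) p2(t) = p2(y), left multiplication of p2(t) q by p2(X)
    gives p2(y) q = z, which is also p2(X) v. *)
Lemma thetac_pentagon x y z : dom (x, y) -> gp y -> dom (y, z) ->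
  let t := mul (inv (p2 x)) y in let X := mul x (p1 t) in
  let q := mul (inv (p2 y)) z in let v := mul (inv (p2 X)) z in dom (X, z) ->
  thetac (x, mul y (p1 q)) = (mul X (p1 v), mul t (p1 q)) /\
  thetac (t, v) = (mul t (p1 q), q).
Proof.
move=> Dxy gy Dyz t X q v DXz; have [xy gx gt] := theta_domP Dxy.
have [_ rt st bt] := thetac_dom gx (esym xy).
have [_ EX2 _ fd fdE] := theta_factors Dxy gy.
have [yz _ gq] := theta_domP Dyz; have [_ rq _ y2q] := thetac_dom gy (esym yz).
have [Xz gX gv] := theta_domP DXz; have [_ rv _ fv] := thetac_dom gX (esym Xz).
rewrite -/t in gt rt st bt fd fdE; rewrite -/q in gq rq y2q; rewrite -/v in gv rv fv.
have EX2' : p2 X = mul (p2 y) (inv (p2 t)) := EX2.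
rewrite -EX2' in fd fdE; have [Hc Hd cd Et] := factorsP gt.
have [Hq1 Hq2 q12 Eq] := factorsP gq.
have bt' : s (p2 x) = r t by rewrite grs_p2.
have xc : s x = r (p1 t) by rewrite grr_p1.
have sX : s X = s (p1 t) by rewrite /X grs_mul.
have dq : s (p2 t) = r q by rewrite grs_p2// st rq.
have tq : s t = r (p1 q) by rewrite grr_p1// st rq.
have dq1 : s (p2 t) = r (p1 q) by rewrite grs_p2.
have vE : v = mul (p2 t) q.
  apply: (@gmulI _ g (p2 X)); first by rewrite grs_p2.
    by rewrite grr_mul.
  by rewrite fv -gmul_assoc// fdE.
have cm1 : thetac (t, v) = (mul t (p1 q), q).
  rewrite /thetac /=.
  have -> : cm (inv (p2 t)) v = q.
    rewrite vE cmulE; first by rewrite gmulKV.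
    by rewrite grs_inv grr_mul.
  by rewrite cmulE.
split=> //; rewrite /thetac /=.
have ryq : r (mul y (p1 q)) = r y by rewrite grr_mul// grr_p1.
have -> : cm (inv (p2 x)) (mul y (p1 q)) = mul t (p1 q).
  rewrite cmulE; last by rewrite grs_inv ryq -xy mid_r.
  by rewrite -{1}bt gmul_assoc// gmulKV// grr_mul.
congr pair.
(* v = p2(t) p1(q) p2(q), and multiplication on the right by an element of [H2] does not change
   [p1]. *)
have [gdq p1dq _] : [/\ gp (mul (p2 t) (p1 q)), p1 (mul (p2 t) (p1 q)) = p1 v
    & p2 (mul (p2 t) (p1 q)) = mul (p2 v) (inv (p2 q))].
  have vq : s v = r (inv (p2 q)) by rewrite vE grs_mul// grr_inv grs_p2.
  have [_ V2 _] := sub2; have := gprod_mulr gv (V2 _ Hq2) vq.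
  have qq : s q = r (inv (p2 q)) by rewrite grr_inv grs_p2.
  have qd : mul q (inv (p2 q)) = p1 q by have := gmulVK q12; rewrite Eq.
  by have <- : mul v (inv (p2 q)) = mul (p2 t) (p1 q) by rewrite vE gmul_assoc// qd.
have cdq : s (p1 t) = r (mul (p2 t) (p1 q)) by rewrite grr_mul.
have [_ E1 _] := gprod_mull Hc gdq cdq.
have -> : mul t (p1 q) = mul (p1 t) (mul (p2 t) (p1 q)) by rewrite -gmul_assoc// Et.
have cv : s (p1 t) = r (p1 v) by rewrite grr_p1// rv sX.
rewrite E1 p1dq cmulE; last by rewrite grr_mul.
by rewrite gmul_assoc.
Qed.

End ThetaAlgebra.

(** * The unitary of a matched pair *)

Lemma ae_imp d (T : measurableType d) (R : realType) (mu : {measure set T -> \bar R})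
    (P Q : T -> Prop) : (forall x, P x -> Q x) ->
  {ae mu, forall x, P x} -> {ae mu, forall x, Q x}.
Proof. by move=> PQ; apply: filterS. Qed.

Lemma ae_imp2 d (T : measurableType d) (R : realType) (mu : {measure set T -> \bar R})
    (P Q S : T -> Prop) : (forall x, P x -> Q x -> S x) ->
  {ae mu, forall x, P x} -> {ae mu, forall x, Q x} -> {ae mu, forall x, S x}.
Proof. by move=> PQ; apply: filterS2. Qed.

Section MatchedPairUnitary.
Context (R : realType) (G : ptopologicalType) (g : groupoid G).
Local Notation measureG := {measure set (borel G) -> \bar R}.
Context (lam : G -> measureG) (nu mu : measureG) (H1 H2 : set G).
Context (mur mus mum : G -> measureG).
Context (mu2sm mu2mr : {measure set (borel G * borel G) -> \bar R}).
Local Notation r := (grr g : borel G -> borel G).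
Local Notation s := (grs g : borel G -> borel G).
Local Notation m := (mid g H1 H2 : borel G -> borel G).
Local Notation inv := (ginv g).
Local Notation mul := (gmul g).
Local Notation p1 := (p1 g H1 H2).
Local Notation p2 := (p2 g H1 H2).
Local Notation cm := (cmul g).
Local Notation gp := (gprod g H1 H2).
Local Notation dom := (theta_dom g H1 H2).
Local Notation thc := (thetac g H1 H2).
Local Notation thi := (thetac_inv g H1 H2).
Hypothesis mg : measured_groupoid g lam nu.
Hypothesis muE : forall E, measurable E -> mu E = mixture g nu lam E.
Hypothesis sub1 : closed_subgroupoid g H1.
Hypothesis sub2 : closed_subgroupoid g H2.
Hypothesis int12 : H1 `&` H2 = units g.
Hypothesis gp_mu : mu.-negligible (~` gp).
Hypothesis Dr : disintegration g nu mu r mur.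
Hypothesis Ds : disintegration g nu mu s mus.
Hypothesis Dm : disintegration g nu mu m mum.
Hypothesis Msm : fiber_product_measure g nu mus mum mu2sm.
Hypothesis Mmr : fiber_product_measure g nu mum mur mu2mr.

Let lcG : lc_groupoid g. Proof. by case: mg. Qed.
Let haar : haar_system g setT lam. Proof. by case: mg. Qed.
Local Notation kr := (unit_kernel g mur).
Local Notation ks := (unit_kernel g mus).
Local Notation km := (unit_kernel g mum).
Local Notation kl := (unit_kernel g lam).

Let mr : measurable_fun setT r. Proof. exact: measurable_grr. Qed.
Let ms : measurable_fun setT s. Proof. exact: measurable_grs. Qed.
Let mm : measurable_fun setT m. Proof. exact: measurable_mid. Qed.
Let mp1 : measurable_fun setT (p1 : borel G -> borel G). Proof. exact: measurable_p1. Qed.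
Let mp2 : measurable_fun setT (p2 : borel G -> borel G). Proof. exact: measurable_p2. Qed.
Let mi : measurable_fun setT (inv : borel G -> borel G). Proof. exact: measurable_ginv. Qed.
Let mcm d (T : measurableType d) (f h : T -> borel G) : measurable_fun setT f ->
  measurable_fun setT h -> measurable_fun setT (fun x => cm (f x) (h x) : borel G).
Proof.
by move=> mf mh; exact: (measurableT_comp (measurable_cmul lcG) (measurable_fun_pair mf mh)).
Qed.
Let mgp : measurable (gp : set (borel G)).
Proof. by apply: measurable_gprod => //; [case: sub1|case: sub2]. Qed.

Let skr : skernel kr. Proof. exact: disintegration_skernel Dr. Qed.
Let sks : skernel ks. Proof. exact: disintegration_skernel Ds. Qed.
Let skm : skernel km. Proof. exact: disintegration_skernel Dm. Qed.
Let skl : skernel kl. Proof. exact: haar_kernel. Qed.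
Let dr : disint nu mu r kr. Proof. exact: disintegration_disint. Qed.
Let ds : disint nu mu s ks. Proof. exact: disintegration_disint. Qed.
Let dm : disint nu mu m km. Proof. exact: disintegration_disint. Qed.
Let dl : disint nu mu r kl.
Proof.
apply: skernel_disint => // [E mE|u]; first by rewrite muE// mixtureE.
by apply: unit_kernel_ae => Uu; exact: haar_carried.
Qed.

Let snu : sigma_finite setT nu.
Proof. by apply: (radon_sigma_finite lcG); case: mg. Qed.
Let smu : sigma_finite setT mu. Proof. exact: (disint_sigma_finite skl mr snu dl). Qed.
Let lr : leg nu mu r. Proof. exact: disintegration_leg Dr. Qed.
Let ls : leg nu mu s. Proof. exact: disintegration_leg Ds. Qed.
Let lm : leg nu mu m. Proof. exact: disintegration_leg Dm. Qed.

Let fibre_product (ka kb : G -> measureG) M : fiber_product_measure g nu ka kb M ->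
  forall E, measurable E -> (M E = \int[nu]_u (unit_kernel g ka u \x unit_kernel g kb u) E)%E.
Proof.
move=> ME E mE; rewrite ME// integral_mkcond; apply: eq_integral => u _.
rewrite patchE /unit_kernel; case: asboolP => Uu; first by rewrite mem_set.
by rewrite memNset// /product_measure1 integral_measure_zero.
Qed.

Let k1 : kprod mu (fun y => km (s y)) mu2sm fst snd.
Proof. by apply: (fibre_kprod skm ms ds) => E mE; exact: fibre_product. Qed.
Let k2 : kprod mu (fun y => ks (m y)) mu2sm snd fst.
Proof. exact: (kprod_swap sks skm ds dm k1). Qed.
Let k3 : kprod mu (fun y => kr (m y)) mu2mr fst snd.
Proof. by apply: (fibre_kprod skr mm dm) => E mE; exact: fibre_product. Qed.
Let k4 : kprod mu (fun y => km (r y)) mu2mr snd fst.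
Proof. exact: (kprod_swap skm skr dm dr k3). Qed.
(** The Haar system takes the place of [mur]: in [k4] only the kernel along [m] appears, and
    swapping the factors again may use any disintegration of [mu] along [r]. Left invariance becomes
    available for [mu2mr]. *)
Let k3' : kprod mu (fun y => kl (m y)) mu2mr fst snd.
Proof. exact: (kprod_swap skl skm dl dm k4). Qed.

Let fsm : fibprod nu mu s mu m mu2sm fst snd := kprod_fibprod skm ms mm dm k1.
Let fmr : fibprod nu mu m mu r mu2mr fst snd := kprod_fibprod skr mm mr dr k3.

Let aegp : {ae mu, forall x, gp x}.
Proof. exact: gp_mu. Qed.

Let kl_carried u : units g u -> {ae kl u, forall y, r y = u}.
Proof. by move=> Uu; apply: unit_kernel_ae => _; exact: haar_carried. Qed.

Let units_mid x : units g (m x). Proof. exact: units_s. Qed.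

Let kl_left x (F : borel G -> \bar R) : nnmeas F ->
  (\int[kl (s x)]_y F (cm x y) = \int[kl (r x)]_y F y)%E.
Proof.
move=> nF; rewrite (unit_kernelE _ (units_s g x)) (unit_kernelE _ (units_r g x)).
exact: haar_left.
Qed.

(** Quasi-invariance says that [mu] and its image under inversion have the same null sets. *)
Let density_inv : exists delta : borel G -> R, [/\ measurable_fun setT delta,
  forall x, 0 < delta x & forall F, nnmeas F ->
    (\int[mu]_x F x = \int[mu]_x (F (inv x) * (delta (inv x))%:E))%E].
Proof.
have [mu' mu'E] := image_measure_ex mu mi.
have muinv E : measurable E -> mu' E = mu (inv @^-1` E).
  move=> mE; have mE' : measurable (inv @^-1` E : set (borel G)).
    by rewrite -[X in measurable X]setTI; exact: mi.
  rewrite -[E in LHS]setIT -integral_indic// mu'E; last exact: nnmeas_indic.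
  by rewrite -[X in _ = mu X]setIT -integral_indic.
have smu' : sigma_finite setT mu'.
  have [S ST mS] := smu; exists (fun n => inv @^-1` (S n)).
    by rewrite -preimage_bigcup -ST preimage_setT.
  move=> n; have [mSn Soo] := mS n.
  have mS' : measurable (inv @^-1` S n : set (borel G)).
    by rewrite -[X in measurable X]setTI; exact: mi.
  split=> //; rewrite muinv// -comp_preimage.
  by rewrite (_ : inv \o inv = id); [rewrite preimage_id|apply/funext => x /=; rewrite ginvK].
have [|d [md d0 dE]] := equivalent_density smu smu'.
  move=> E mE; have mE' : measurable (inv @^-1` E : set (borel G)).
    by rewrite -[X in measurable X]setTI; exact: mi.
  rewrite muinv// !muE//; have [_ _ _ _ qi] := mg; exact: qi.
exists d; split=> // F nF; rewrite dE// mu'E//.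
by apply: nnmeasM => //; apply: nnmeas_EFin => // x; exact: ltW.
Qed.

Section Transport.
Context (delta : borel G -> R).
Hypothesis mdelta : measurable_fun setT delta.
Hypothesis delta_gt0 : forall x, 0 < delta x.
Hypothesis deltaE : forall F, nnmeas F ->
  (\int[mu]_x F x = \int[mu]_x (F (inv x) * (delta (inv x))%:E))%E.

Definition theta_weight (w : borel G * borel G) := delta (thc w).1 / delta w.1.

Let mf1 : measurable_fun setT (fun w : borel G * borel G => w.1).
Proof. exact: measurable_fst. Qed.
Let mf2 : measurable_fun setT (fun w : borel G * borel G => w.2).
Proof. exact: measurable_snd. Qed.
Let mz : measurable_fun setT (fun w : borel G * borel G => cm (inv (p2 w.1)) w.2 : borel G).
Proof. by apply: mcm => //; apply: measurableT_comp mi _; exact: measurableT_comp mp2 mf1. Qed.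
Let mxp : measurable_fun setT (fun w : borel G * borel G => cm w.1 (p1 w.2) : borel G).
Proof. by apply: mcm => //; exact: measurableT_comp mp1 mf2. Qed.

Lemma measurable_thetac : measurable_fun setT (thc : borel G * borel G -> borel G * borel G).
Proof.
apply: measurable_fun_pair; last exact: mz.
by apply: mcm => //; exact: measurableT_comp mp1 mz.
Qed.

Lemma measurable_thetac_inv : measurable_fun setT (thi : borel G * borel G -> borel G * borel G).
Proof.
have mx : measurable_fun setT (fun w : borel G * borel G => cm w.1 (inv (p1 w.2)) : borel G).
  by apply: mcm => //; apply: measurableT_comp mi _; exact: measurableT_comp mp1 mf2.
apply: measurable_fun_pair => //; apply: mcm => //; exact: measurableT_comp mp2 mx.
Qed.

Lemma measurable_theta_weight : measurable_fun setT theta_weight.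
Proof.
apply: measurable_funM.
  by apply: measurableT_comp mdelta _; exact: measurableT_comp measurable_fst measurable_thetac.
apply: measurable_fun_inv => [|w]; last exact: ltW.
exact: measurableT_comp mdelta mf1.
Qed.

Lemma theta_weight_gt0 w : 0 < theta_weight w.
Proof. by rewrite divr_gt0. Qed.

Let nd (f : borel G * borel G -> borel G) : measurable_fun setT f ->
  nnmeas (fun w => (delta (f w))%:E).
Proof.
move=> mf; apply: nnmeas_EFin => [|w]; last exact: ltW.
exact: measurableT_comp mdelta mf.
Qed.

Lemma thetac_transports : transports mu2sm mu2mr thc theta_weight.
Proof.
split; [exact: measurable_thetac|exact: measurable_theta_weight|by move=> w; exact/ltW/theta_weight_gt0|].
move=> F nF; under [RHS]eq_integral do rewrite mule1.
(* The integrand in the coordinates x and z = p2(x)^-1 y. *)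
pose Phi (w : borel G * borel G) :=
  (F (cm w.1 (p1 w.2), w.2) * (delta (cm w.1 (p1 w.2)) / delta w.1)%:E)%E.
have nPhi : nnmeas Phi.
  apply: nnmeasM; first by apply: (nnmeas_comp _ nF); exact: measurable_fun_pair.
  apply: nnmeas_EFin => [|w]; last by rewrite ltW// divr_gt0.
  apply: measurable_funM; first exact: measurableT_comp mdelta mxp.
  apply: measurable_fun_inv => [|w]; last exact: ltW.
  exact: measurableT_comp mdelta mf1.
have nPz : nnmeas (fun w : borel G * borel G => Phi (w.1, cm (inv (p2 w.1)) w.2)).
  by apply: (nnmeas_comp _ nPhi); exact: measurable_fun_pair.
have [_ _ _ K3] := k3'; have [_ _ _ K1] := k1.
(* The integrand in the coordinates v and z that remain once both translations are done; it is [F]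
   after inversion of the first coordinate, with the modular weight of that inversion. *)
pose Ga (w : borel G * borel G) := (F (inv w.1, w.2) * (delta (inv w.1))%:E)%E.
have nGa : nnmeas Ga.
  have mi1 : measurable_fun setT (fun w : borel G * borel G => inv w.1 : borel G).
    exact: measurableT_comp mi mf1.
  apply: nnmeasM; last exact: nd.
  by apply: (nnmeas_comp _ nF); exact: measurable_fun_pair.
have nPx x : nnmeas (fun z : borel G => Phi (x, z)).
  by apply: (nnmeas_comp _ nPhi); exact: measurable_pair1.
have nPsi := skernel_integral (skernel_comp ms skl) nPhi.
transitivity (\int[mu]_x \int[kl (m x)]_y Phi (x, cm (inv (p2 x)) y))%E.
  exact: (K3 _ nPz).
(* Left translation by p2(x)^-1, from the fibre over m(x) to the fibre over s(x). *)
transitivity (\int[mu]_x \int[kl (s x)]_z Phi (x, z))%E.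
  apply: ae_eq_integral => //.
  - exact: (skernel_integral (skernel_comp mm skl) nPz).1.
  - exact: nPsi.1.
  - apply: (ae_imp _ aegp) => x gx _.
    have := kl_left (inv (p2 x)) (nPx x).
    by rewrite grs_inv grr_inv -mid_r// grs_p2.
rewrite (deltaE nPsi).
have mcw : measurable_fun setT (fun w : borel G * borel G => inv (cm (inv w.1) (p1 w.2)) : borel G).
  apply: measurableT_comp mi _; apply: mcm; first exact: measurableT_comp mi mf1.
  exact: measurableT_comp mp1 mf2.
have nGc : nnmeas (fun w : borel G * borel G => Ga (inv (cm (inv w.1) (p1 w.2)), w.2)).
  by apply: (nnmeas_comp _ nGa); exact: measurable_fun_pair.
(* With x = w^-1, the factor delta(x) from inversion cancels the denominator of the weight, and
   delta(x p1(z)) is exactly what [Ga] carries at (x p1(z))^-1. *)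
transitivity (\int[mu]_w \int[kl (r w)]_z Ga (inv (cm (inv w) (p1 z)), z))%E.
  apply: eq_integral => w _; rewrite grs_inv -ge0_integralZr//.
  - apply: eq_integral => z _; rewrite /Phi /Ga /= ginvK -muleA -EFinM.
    by rewrite divfK// gt_eqF.
  - exact: (nPx (inv w)).1.
  - by move=> z _; exact: nPhi.2.
  - by rewrite lee_fin ltW.
rewrite (kernel_swap skl skl dl dl nGc) /=.
have nGs : nnmeas (fun w : borel G * borel G => Ga (w.2, w.1)).
  by apply: (nnmeas_comp _ nGa); exact: measurable_fun_pair.
have nGm := skernel_integral (skernel_comp mm skl) nGs.
have nGcs : nnmeas (fun w : borel G * borel G => Ga (inv (cm (inv w.2) (p1 w.1)), w.1)).
  apply: (nnmeas_comp _ nGa); apply: measurable_fun_pair => //.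
  apply: measurableT_comp mi _; apply: mcm; first exact: measurableT_comp mi mf2.
  exact: measurableT_comp mp1 mf1.
(* (w^-1 p1(z))^-1 = p1(z)^-1 w, and translation by p1(z)^-1 leads from the fibre over r(z) to the
   fibre over m(z). *)
transitivity (\int[mu]_z \int[kl (m z)]_v Ga (v, z))%E.
  apply: ae_eq_integral => //.
  - exact: (skernel_integral (skernel_comp mr skl) nGcs).1.
  - exact: nGm.1.
  - apply: (ae_imp _ aegp) => z gz _.
    have nGz : nnmeas (fun v : borel G => Ga (v, z)).
      by apply: (nnmeas_comp _ nGa); exact: measurable_pair2.
    have := kl_left (inv (p1 z)) nGz; rewrite grs_inv grr_inv grr_p1// => <-.
    apply: ae_eq_integral => //.
    + exact: (measurableT_comp nGcs.1 (@measurable_pair1 _ _ (borel G) (borel G) z)).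
    + have mcz := mcm (@measurable_cst _ _ (borel G) (borel G) setT (inv (p1 z)))
        (@measurable_id _ (borel G) setT).
      exact: (measurableT_comp nGz.1 mcz).
    + apply: (ae_imp _ (kl_carried (units_r g z))) => w rw _ /=; congr (Ga (_, z)).
      have e : s (inv w) = r (p1 z) by rewrite grs_inv rw grr_p1.
      by rewrite cmulE// ginvM// ginvK cmulE// grs_inv grr_p1.
(* Now r(v) = m(z); exchanging the roles again and undoing the inversion of v turns this relation
   into s(x) = m(z), that of [mu2sm]. *)
rewrite (kernel_swap skm skl dm dl nGs) /=.
transitivity (\int[mu]_x \int[km (s x)]_z F (x, z))%E; last first.
  by rewrite -(K1 _ nF); apply: eq_integral => -[].
rewrite (deltaE (skernel_integral (skernel_comp ms skm) nF)).
apply: eq_integral => v _; rewrite grs_inv -ge0_integralZr//.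
- exact: (measurableT_comp nF.1 (@measurable_pair1 _ _ (borel G) (borel G) (inv v))).
- by move=> z _; exact: nF.2.
- by rewrite lee_fin ltW.
Qed.

End Transport.

Lemma measurable_theta_dom : measurable (dom : set (borel G * borel G)).
Proof.
rewrite (_ : dom = [set w | m w.1 = r w.2] `&` ((fun w => w.1) @^-1` gp `&`
    (fun w => cm (inv (p2 w.1)) w.2) @^-1` gp)); last first.
  by rewrite theta_domE; apply/seteqP; split=> [w [? ? ?]|w [? [? ?]]].
have [[_ _ sc _] _] := lcG; have [[hG _ _ _] _] := lcG.
apply: measurableI.
  apply: (@measurable_eq_fun G sc _ (borel G * borel G)%type (fun w => m w.1) (fun w => r w.2) hG).
    exact: measurableT_comp mm measurable_fst.
  exact: measurableT_comp mr measurable_snd.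
apply: measurableI; rewrite -[X in measurable X]setTI.
  exact: measurable_fst.
have mz : measurable_fun setT (fun w : borel G * borel G => cm (inv (p2 w.1)) w.2 : borel G).
  by apply: mcm => //; apply: measurableT_comp mi _; exact: measurableT_comp mp2 measurable_fst.
exact: mz.
Qed.

Let mngp : measurable (~` gp : set (borel G)). Proof. exact: measurableC. Qed.

(** Disintegrating the null set along [r] gives the claim for [nu]-almost every unit; as [s] is
    nonsingular, it holds at s(x) for almost every x. *)
Let slice_null : {ae mu, forall x, kl (s x) (~` gp) = 0%E}.
Proof.
apply: (leg_ae ls (P := fun u => kl u (~` gp) = 0%E)).
have mkl : measurable_fun setT (fun u => kl u (~` gp)) by have [mk _] := skl; exact: mk.
have /(ae_eq_integral_abs nu measurableT mkl) : (\int[nu]_u `|kl u (~` gp)| = 0)%E.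
  under eq_integral do rewrite gee0_abs//.
  by rewrite -mixtureE -muE//; exact: measure_negligible.
by apply: ae_imp => u; apply.
Qed.

(** For fixed x, translation by p2(x)^-1 maps the exceptional set of y onto the complement of G1 G2
    in the fibre over s(x), which is null by [slice_null]. *)
Let aedom : {ae mu2mr, forall w, dom w}.
Proof.
have mN := measurableC measurable_theta_dom.
exists (~` dom); split=> //.
have [_ _ _ K3] := k3'.
have nN : nnmeas (fun w : borel G * borel G => (\1_(~` dom) w)%:E : \bar R) by exact: nnmeas_indic.
have nng : nnmeas (fun y : borel G => (\1_(~` gp) y)%:E : \bar R) by exact: nnmeas_indic.
rewrite -[~` dom]setIT -integral_indic//.
have -> : (\int[mu2mr]_w (\1_(~` dom) w)%:E = \int[mu2mr]_w (\1_(~` dom) (w.1, w.2))%:E)%E.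
  by apply: eq_integral => -[].
rewrite (K3 _ nN) -(integral0 mu setT); apply: ae_eq_integral => //.
- exact: (skernel_integral (skernel_comp mm skl) nN).1.
- move: slice_null aegp; apply: filterS2 => x kx gx _.
  have nngc := nnmeas_comp (mcm (@measurable_cst _ _ (borel G) (borel G) setT (inv (p2 x)))
    (@measurable_id _ (borel G) setT)) nng.
  transitivity (\int[kl (m x)]_y (\1_(~` gp) (cm (inv (p2 x)) y))%:E)%E.
    apply: ae_eq_integral => //.
    + exact: (measurableT_comp nN.1 (@measurable_pair1 _ _ (borel G) (borel G) x)).
    + exact: nngc.1.
    + apply: (ae_imp _ (kl_carried (units_mid x))) => y ry _; rewrite !indicE; congr ((nat_of_bool _)%:R%:E).
      have [E _ _ _] := thetac_dom gx ry.
      apply/idP/idP; rewrite !inE; apply: contra_not; rewrite E => gz; last by case: gz.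
      by split.
  have := kl_left (inv (p2 x)) nng; rewrite grs_inv grr_inv -mid_r// grs_p2// => ->.
  by rewrite integral_indic// setIT.
Qed.

Let aegp2 : {ae mu2mr, forall w, gp w.2}.
Proof. exact: (fibprod_ae2 snu lm lr fmr aegp). Qed.

Let smr : sigma_finite setT mu2mr.
Proof. exact: (fibprod_sigma_finite snu lm lr fmr). Qed.

(** The image becomes an inverse image under a Borel map cut by an equalizer, which shows that it is
    Borel. *)
Let theta_image (E : set (G * G)) : E `<=` dom ->
  theta g H1 H2 @` E = thi @^-1` E `&` [set w | thc (thi w) = w].
Proof.
move=> Ed; apply/seteqP; split=> [_ [[x y] Exy <-]|w [Ew ww]].
  have Dxy := Ed _ Exy; rewrite -(thetacE Dxy).
  by split; rewrite /preimage /= (thetacK Dxy).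
exists (thi w) => //; rewrite -[RHS]ww; apply/esym.
by move: (Ed _ Ew); case: (thi w) => x y; exact: thetacE.
Qed.

Let measurable_theta_image (E : set (borel G * borel G)) : measurable E -> E `<=` dom ->
  measurable (theta g H1 H2 @` E : set (borel G * borel G)).
Proof.
move=> mE Ed; rewrite theta_image//; apply: measurableI.
  by rewrite -[X in measurable X]setTI; exact: measurable_thetac_inv.
have mti : measurable_fun setT (fun w : borel G * borel G => thc (thi w) : borel G * borel G).
  exact: measurableT_comp measurable_thetac measurable_thetac_inv.
have [[hG _ sc _] _] := lcG.
rewrite (_ : [set w | thc (thi w) = w] =
    [set w | (thc (thi w)).1 = w.1] `&` [set w | (thc (thi w)).2 = w.2]); last first.
  apply/seteqP; split=> w; first by move=> e; split; [exact: (congr1 fst e)|exact: (congr1 snd e)].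
  have pairI (a b : G * G) : a.1 = b.1 -> a.2 = b.2 -> a = b by case: a b => [? ?] [? ?] /= -> ->.
  by case; exact: pairI.
apply: measurableI.
  apply: (@measurable_eq_fun G sc _ (borel G * borel G)%type (fun w => (thc (thi w)).1) fst hG).
    exact: measurableT_comp measurable_fst mti.
  exact: measurable_fst.
apply: (@measurable_eq_fun G sc _ (borel G * borel G)%type (fun w => (thc (thi w)).2) snd hG).
  exact: measurableT_comp measurable_snd mti.
exact: measurable_snd.
Qed.

Theorem matched_pair_unitary :
  (exists D, RN_theta g H1 H2 mu2sm mu2mr D) /\
  forall D, RN_theta g H1 H2 mu2sm mu2mr D ->
  exists W : L2 mu2sm -> L2 mu2mr,
    (forall xi, xi \in sqint mu2sm ->
       {ae mu2mr, forall xy,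
          L2fun (W (L2cls mu2sm xi)) xy = (Num.sqrt (D xy))%:C * xi (theta g H1 H2 xy)}) /\
    pseudo_multiplicative_unitary nu
      (mult_rep mu m) (mult_rep mu s) (mult_rep mu r)
      (L2tensor mu2sm) (L2tensor mu2mr) W.
Proof.
have [delta [md d0 dE]] := density_inv.
pose D0 := theta_weight delta.
have mD0 : measurable_fun setT D0 := measurable_theta_weight md d0.
have D0pos w : 0 < D0 w := theta_weight_gt0 d0 w.
have D00 w : 0 <= D0 w := ltW (D0pos w).
have tr : transports mu2sm mu2mr thc D0 := thetac_transports md d0 dE.
(* On the domain, the indicator function of theta(E) composed with theta is that of E, by
   injectivity. *)
have RN0 : RN_theta g H1 H2 mu2sm mu2mr D0.
  split=> // E mE Ed; have mI := measurable_theta_image mE Ed.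
  have nI : nnmeas (fun w : borel G * borel G => (\1_(theta g H1 H2 @` E) w)%:E : \bar R).
    exact: nnmeas_indic.
  rewrite -[X in mu2sm X]setIT -integral_indic// -(transports_integral tr nI) [RHS]integral_mkcond.
  apply: ae_eq_integral => //.
  - exact: (nnmeasM (nnmeas_comp measurable_thetac nI) (nnmeas_EFin mD0 D00)).1.
  - rewrite (_ : _ \_ _ = (fun w => (D0 w)%:E * (\1_E w)%:E)%E); last first.
      by apply/funext => w; rewrite epatch_indic.
    exact: (nnmeasM (nnmeas_EFin mD0 D00) (nnmeas_indic R mE)).1.
  - apply: (ae_imp _ aedom) => w dw _; rewrite epatch_indic muleC; congr (_ * _%:E)%E.
    rewrite !indicE; congr ((nat_of_bool _)%:R); apply/idP/idP; rewrite !inE theta_image//.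
      by case=> Ew _; rewrite /preimage /= (thetacK dw) in Ew.
    by move=> Ew; split; rewrite /preimage /= (thetacK dw).
split; first by exists D0.
move=> D [mD Dge0 RN].
(* [RN_theta] only tests subsets of the domain; its complement is null, so arbitrary sets can be cut
   down to it. *)
have cut (f : borel G * borel G -> R) (E : set (borel G * borel G)) : measurable_fun setT f -> (forall w, 0 <= f w) -> measurable E ->
    (\int[mu2mr]_(w in E) (f w)%:E = \int[mu2mr]_(w in E `&` dom) (f w)%:E)%E.
  move=> mf f0 mE.
  have pE (A : set (borel G * borel G)) : (fun w => (f w)%:E) \_ A = (fun w => (f w)%:E * (\1_A w)%:E)%E.
    by apply/funext => w; rewrite epatch_indic.
  have mA (A : set (borel G * borel G)) : measurable A -> measurable_fun setT (fun w => (f w)%:E * (\1_A w)%:E)%E.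
    by move=> mA; exact: (nnmeasM (nnmeas_EFin mf f0) (nnmeas_indic R mA)).1.
  rewrite [LHS]integral_mkcond [RHS]integral_mkcond !pE; apply: ae_eq_integral => //.
  - exact: mA.
  - by apply: mA; apply: measurableI => //; exact: measurable_theta_dom.
  - apply: (ae_imp _ aedom) => w dw _; rewrite indicI /= [\1_dom w]indicE mem_set//.
    by rewrite mulr1.
have D0D : {ae mu2mr, forall w, D0 w = D w}.
  apply: ae_eq_weights => // E mE; rewrite (cut D0)// (cut D)//.
  have mEd : measurable (E `&` dom) by apply: measurableI => //; exact: measurable_theta_dom.
  have Ed : E `&` dom `<=` dom by apply: subIsetr.
  by have [_ _ RN0E] := RN0; rewrite -RN0E// RN.
(* [W] is built with the Borel map [thetac] and the positive weight [D0]; almost everywhere these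
   are [theta] and the given [D]. *)
exists (wcomp mu2mr (thc : borel G * borel G -> borel G * borel G) D0 : L2 mu2sm -> L2 mu2mr); split.
  move=> xi xi2; move: (wcomp_cls tr xi2) D0D aedom.
  by apply: filterS3 => -[x y] -> <- dw; rewrite thetacE.
have [nr _ _ _ _] := Dr; have [ns _ _ _ _] := Ds; have [nm _ _ _ _] := Dm.
apply: (@wcomp_pseudo_multiplicative _ _ (borel G) (borel G) R nu mu r s m kr ks km
  mu2sm mu2mr thc thi D0 snu lr ls lm _ _ _ skr sks skm dr ds dm k1 k2 k3 k4 tr _ _ _ _ _ _ _
  (dom `&` [set w | gp w.2])).
- by move=> A mA; exact: (nr A mA).2.
- by move=> A mA; exact: (ns A mA).2.
- by move=> A mA; exact: (nm A mA).2.
- exact: aeW.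
- exact: measurable_thetac_inv.
- by apply: (ae_imp _ aedom) => w dw; rewrite thetacK.
- by apply: (ae_imp2 _ aedom aegp2) => -[x y] dw gw; exact: thetac_mid.
- by apply: (ae_imp _ aedom) => -[x y] dw; exact: thetac_grs.
- by apply: (ae_imp _ aedom) => -[x y] dw; exact: (thetac_grr dw).1.
- by apply: (ae_imp _ aedom) => -[x y] dw; exact: (thetac_grr dw).2.
- by apply: (ae_imp2 _ aedom aegp2) => w dw gw; split.
- move=> x y z [Dxy gy] [Dyz _] [+ _]; rewrite (thetacE Dxy) (thetacE Dyz) => DXz.
  have [e1 e2] := thetac_pentagon sub1 sub2 int12 Dxy gy Dyz DXz.
  by rewrite /theta [_.1]/= [_.2]/= (thetacE DXz) /theta [_.1]/= e1 e2.
Qed.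

End MatchedPairUnitary.

Unset Implicit Arguments.

Theorem proposition3p5p4 (R : realType) (G : ptopologicalType) (g : groupoid G)
  (lam lam1 lam2 : G -> {measure set (borel G) -> \bar R})
  (nu mu : {measure set (borel G) -> \bar R}) (G1 G2 : set G)
  (mur mus mum : G -> {measure set (borel G) -> \bar R})
  (mu2sm mu2mr : {measure set (borel G * borel G) -> \bar R}) :
  let r : borel G -> borel G := grr g in
  let s : borel G -> borel G := grs g in
  let m : borel G -> borel G := mid g G1 G2 in
  let th := theta g G1 G2 in
  measured_groupoid g lam nu ->
  (forall E, measurable E -> mu E = mixture g nu lam E) ->
  matched_pair g nu mu G1 lam1 G2 lam2 ->
  disintegration g nu mu r mur ->
  disintegration g nu mu s mus ->
  disintegration g nu mu m mum ->
  fiber_product_measure g nu mus mum mu2sm ->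
  fiber_product_measure g nu mum mur mu2mr ->
  (exists D, RN_theta g G1 G2 mu2sm mu2mr D) /\
  forall D, RN_theta g G1 G2 mu2sm mu2mr D ->
  exists W : L2 mu2sm -> L2 mu2mr,
    (forall xi, xi \in sqint mu2sm ->
       {ae mu2mr, forall xy,
          L2fun (W (L2cls mu2sm xi)) xy = (Num.sqrt (D xy))%:C * xi (th xy)}) /\
    pseudo_multiplicative_unitary nu
      (mult_rep mu m) (mult_rep mu s) (mult_rep mu r)
      (L2tensor mu2sm) (L2tensor mu2mr) W.
Proof.
move=> r s m th mg muE [[sub1 _] [sub2 _] int12 gp_mu _] Dr Ds Dm Msm Mmr.
exact: (matched_pair_unitary mg muE sub1 sub2 int12 gp_mu Dr Ds Dm Msm Mmr).
Qed.
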